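(* Let $H<\infty$ and let $\mathcal X$ be an $H$-concentrated metric flow over $(-\infty,0]$. Then for any two points $x_0,y_0\in\mathcal X$ (not necessarily in the same time-slice) we have, up to isometry, $$\mathcal T^\infty_{x_0}=\mathcal T^\infty_{y_0},$$ where $\mathcal T^\infty_{x}$ denotes the set of tangent flows at infinity of $\mathcal X$ based at $x$. That is, the tangent flow at infinity of an ancient $H$-concentrated metric flow does not depend on the base point.
   Context: Metric flows (Bamler). Let $\Phi:\mathbb R\to(0,1)$ satisfy $\Phi'(x)=(4\pi)^{-1/2}e^{-x^2/4}$, $\Phi(-\infty)=0$, $\Phi(\infty)=1$. A metric flow over $I\subset\mathbb R$ is a tuple $(\mathcal X,\mathfrak t,(\mathrm{dist}_t)_{t\in I},(\nu_{x|s})_{x\in\mathcal X,\,s\in I,\,s\le\mathfrak t(x)})$ where $\mathcal X$ is a set, $\mathfrak t:\mathcal X\to I$ a map with time-slices $\mathcal X_t=\mathfrak t^{-1}(t)$, each $(\mathcal X_t,\mathrm{dist}_t)$ is a complete separable metric space, and $\nu_{x|s}$ are Borel probability measures on $\mathcal X_s$ with $\nu_{x|\mathfrak t(x)}=\delta_x$, such that: (i) for $s<t$ in $I$, $T\ge0$ and measurable $u_s:\mathcal X_s\to[0,1]$, where if $T>0$ we require $u_s=\Phi\circ f_s$ with $f_s$ $T^{-1/2}$-Lipschitz, the function $u_t(x)=\int u_s\,d\nu_{x|s}$ on $\mathcal X_t$ is either constant or of the form $\Phi\circ f_t$ with $f_t$ $(t-s+T)^{-1/2}$-Lipschitz; (ii)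 $\nu_{x|t_1}=\int_{\mathcal X_{t_2}}\nu_{y|t_1}\,d\nu_{x|t_2}(y)$ for $t_1\le t_2\le t_3$ in $I$, $x\in\mathcal X_{t_3}$. A conjugate heat flow on $\mathcal X$ over $I'\subset I$ is a family of probability measures $\mu_t$ on $\mathcal X_t$, $t\in I'$, with $\mu_s=\int_{\mathcal X_t}\nu_{x|s}\,d\mu_t(x)$ for $s\le t$. A metric flow pair over $I$ is $(\mathcal X,(\mu_t)_{t\in I'})$ with $I'\subset I$, $|I\setminus I'|=0$, $\mathcal X$ a metric flow over $I'$ and $(\mu_t)$ a conjugate heat flow with $\mathrm{supp}\,\mu_t=\mathcal X_t$ (if the support is smaller, the time-slices are replaced by the supports). Two metric flow pairs are isometric if there is a bijection preserving times, distances, kernels and the conjugate heat flow (after discarding a null set of times). $H$-concentration. For probability measures on a metric space $(X,d)$ let $\mathrm{Var}(\mu_1,\mu_2)=\int\int d^2(x_1,x_2)\,d\mu_1(x_1)d\mu_2(x_2)$. $\mathcal X$ is $H$-concentrated if $\mathrm{Var}(\nu_{x_1|s},\nu_{x_2|s})\le \mathrm{dist}_t^2(x_1,x_2)+H(t-s)$ for all $s\le t$ in $I$ and $x_1,x_2\in\mathcal X_t$. $\mathbb F$-distance. Let $(\mathcal X^j,(\mu^j_t)_{t\in I'^{,j}})$, $j=1,2$, be metric flow pairs over $I$. A correspondence over $I$ consists of metric spaces $(Z_t,\mathrm{dist}^{Z_t})_{t\in I}$, subsets $I''^{,j}\subset I\cap I'^{,j}$ and isometric embeddings $\varphi^j_t:\mathcal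 X^j_t\to Z_t$, $t\in I''^{,j}$. Then $\mathrm{dist}_{\mathbb F}$ is the infimum of $r>0$ such that there are a correspondence, a measurable $E\subset I$ with $I\setminus E\subset I''^{,1}\cap I''^{,2}$, $|E|\le r^2$, and couplings $q_t$ of $\mu^1_t,\mu^2_t$ ($t\in I\setminus E$) with $\int \mathrm{dist}^{Z_s}_{W_1}\big((\varphi^1_s)_*\nu^1_{x_1|s},(\varphi^2_s)_*\nu^2_{x_2|s}\big)dq_t(x_1,x_2)\le r$ for all $s\le t$ in $I\setminus E$; here $\mathrm{dist}_{W_1}$ is the $W_1$-Wasserstein distance. Rescaling. For $t_0\in\mathbb R$, $\lambda>0$ and a metric flow $\mathcal X$ over $I$, $\mathcal X^{-t_0,\lambda}$ is the metric flow over $\lambda^2(I-t_0)$ with time-slices $\mathcal X^{-t_0,\lambda}_t=\mathcal X_{\lambda^{-2}t+t_0}$, distances $\lambda\,\mathrm{dist}_{\lambda^{-2}t+t_0}$, and kernels $\nu_{y|s}^{-t_0,\lambda}=\nu_{y|\lambda^{-2}s+t_0}$; similarly $\mu_t^{-t_0,\lambda}=\mu_{\lambda^{-2}t+t_0}$ for conjugate heat flows. A subscript $[-T,0]$ denotes restriction to times in $[-T,0]$. Tangent flows at infinity. For $x_0\in\mathcal X_{t_0}$, a metric flow pair $(\mathcal X^\infty,(\nu^\infty_{x_{\max}|t})_{t\in I'^{,\infty}})$ over $(-\infty,0]$ is a tangent flow at infinity based at $x_0$ if there is a sequence $\lambda_j\searrow0$ such that for every $T<\infty$ the $\mathbb F$-distance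 (over $[-T,0]$) between $\big(\mathcal X^{-t_0,\lambda_j}_{[-T,0]},(\nu^{-t_0,\lambda_j}_{x_0|t})_{t\in\lambda_j^2(I-t_0)\cap[-T,0]}\big)$ and $\big(\mathcal X^\infty_{[-T,0]},(\nu^\infty_{x_{\max}|t})_{t\in I'^{,\infty}\cap[-T,0]}\big)$ tends to $0$ as $j\to\infty$. $\mathcal T^\infty_{x_0}$ is the set of all tangent flows at infinity based at $x_0$. *)

(* Defs.v *)
From HB Require Import structures.
From mathcomp Require Import all_boot all_order all_algebra.
From mathcomp Require Import all_classical all_reals all_analysis.

Set Implicit Arguments.
Unset Strict Implicit.
Unset Printing Implicit Defensive.

Import Order.TTheory GRing.Theory Num.Theory.
Import numFieldNormedType.Exports.

Local Open Scope classical_set_scope.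
Local Open Scope ring_scope.

(* Pointed metric spaces: the library's measurable spaces have to be pointed. *)
#[short(type="pmetricType")]
HB.structure Definition PointedMetric (R : numDomainType) :=
  {T of PseudoPointedMetric R T & Metric R T}.

Notation borel T := (g_sigma_algebraType (@open T)).
Notation borel_probability T R := (probability (borel T) R).

(* The metric space (T, l * dist). Its uniform structure, hence its Borel
   sigma-algebra, is by definition that of T. *)
Definition scaled (R : realType) (l : {posnum R}) (T : Type) : Type := T.

Section scaled.
Context (R : realType) (l : {posnum R}) (T : pmetricType R).

HB.instance Definition _ := PointedUniform.copy (scaled l T) T.

Let sball (x : scaled l T) (e : R) : set (scaled l T) :=
  @ball R T x (e / l%:num).

Let sball_center x (e : R) : 0 < e -> sball x e x.
Proof. by move=> e0; apply: ballxx; rewrite divr_gt0. Qed.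

Let sball_sym x y (e : R) : sball x e y -> sball y e x.
Proof. exact: ball_sym. Qed.

Let sball_triangle x y z (e1 e2 : R) :
  sball x e1 y -> sball y e2 z -> sball x (e1 + e2) z.
Proof. by rewrite /sball mulrDl; exact: ball_triangle. Qed.

Let sentourageE : @entourage (scaled l T) = entourage_ sball.
Proof.
rewrite [LHS](_ : _ = @entourage T)// -entourage_ballE; apply/seteqP; split.
  move=> A [e /= e0 eA]; exists (e * l%:num); first by rewrite /= mulr_gt0.
  by move=> xy; rewrite /= /sball mulfK//; exact: eA.
by move=> A [e /= e0 eA]; exists (e / l%:num) => //=; rewrite divr_gt0.
Qed.

HB.instance Definition _ := Uniform_isPseudoMetric.Build R (scaled l T)
  sball_center sball_sym sball_triangle sentourageE.

Let sdist (x y : scaled l T) : R := l%:num * @mdist R T x y.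

Let sdist_ge0 x y : 0 <= sdist x y.
Proof. by rewrite mulr_ge0// mdist_ge0. Qed.

Let sdist_positivity x y : sdist x y = 0 -> x = y.
Proof.
by move=> /eqP; rewrite mulf_eq0 gt_eqF//= => /eqP; exact: mdist_positivity.
Qed.

Let sballE x d : @ball R (scaled l T) x d = [set y | sdist x y < d].
Proof.
by rewrite [LHS](@ballEmdist R T); apply/seteqP; split=> y /=;
  rewrite ltr_pdivlMr// mulrC.
Qed.

HB.instance Definition _ := PseudoMetric_isMetric.Build R (scaled l T)
  sdist_ge0 sdist_positivity sballE.

End scaled.

Section metric_measure.
Context {R : realType}.
Implicit Types T Z : pmetricType R.

Definition complete_set T (A : set T) :=
  forall F : set_system T, ProperFilter F -> F A -> cauchy F ->
    exists2 x, A x & F --> x.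

Definition separable_set T (A : set T) :=
  exists D : set T, [/\ countable D, D `<=` A & A `<=` closure D].

Definition lipschitz_in T (A : set T) (k : R) (f : T -> R) :=
  forall x y, A x -> A y -> `|f x - f y| <= k * mdist x y.

Definition isometric_in T Z (A : set T) (f : T -> Z) :=
  forall x y, A x -> A y -> mdist (f x) (f y) = mdist x y.

Definition supp T (mu : borel_probability T R) : set T :=
  [set x | forall U : set T, open_nbhs x U -> (0 < mu U)%E].

Definition mutual_variance T (mu1 mu2 : borel_probability T R) : \bar R :=
  (\int[mu1]_x1 \int[mu2]_x2 ((@mdist R T x1 x2) ^+ 2)%:E)%E.

(* Push-forward of mu, concentrated on A, by a map that matters only on A. *)
Definition push_in T Z (mu : borel_probability T R) (A : set T) (f : T -> Z) :
    set (borel Z) -> \bar R :=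
  fun B => mu (A `&` f @^-1` B).

Definition coupling T1 T2 (mu1 : set (borel T1) -> \bar R)
    (mu2 : set (borel T2) -> \bar R)
    (q : probability (borel T1 * borel T2)%type R) :=
  (forall A : set (borel T1), measurable A -> q (A `*` setT) = mu1 A) /\
  (forall B : set (borel T2), measurable B -> q (setT `*` B) = mu2 B).

Definition wasserstein1 Z (mu1 mu2 : set (borel Z) -> \bar R) : \bar R :=
  ereal_inf [set (\int[q]_z (@mdist R Z z.1 z.2)%:E)%E |
    q in [set q : probability (borel Z * borel Z)%type R | coupling mu1 mu2 q]].

End metric_measure.

Definition heat_profile (R : realType) (Phi : R -> R) :=
  [/\ forall x, 0 < Phi x < 1,
      forall x : R, is_derive x (1 : R) Phi
        (expR (- x ^+ 2 / 4) / Num.sqrt (4 * pi)),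
      Phi x @[x --> -oo] --> (0 : R) &
      Phi x @[x --> +oo] --> (1 : R)].

(* The time-slice X_t is the metric subspace [slice t] of [ambient t]; it may be
   empty or smaller than [ambient t], which is not part of the mathematical
   object. Likewise [hker x s] is a Borel measure on [ambient s] that
   [metric_flow] requires to be concentrated on [slice s], and only the times of
   a given I matter. The set X of the literature is the disjoint union of the
   slices. *)
Record flow (R : realType) := Flow {
  ambient : R -> pmetricType R ;
  slice : forall t, set (ambient t) ;
  hker : forall t, ambient t -> forall s, borel_probability (ambient s) R }.
Arguments ambient {R} f t.
Arguments slice {R} f t _.
Arguments hker {R} f {t} x s.

Section metric_flows.
Context {R : realType}.
Implicit Types (X : flow R) (I : set R) (Phi : R -> R).

Definition heat_regularity Phi I X := forall s t T : R,
  I s -> I t -> s < t -> 0 <= T ->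
  forall u : ambient X s -> R,
    measurable_fun (slice X s : set (borel (ambient X s))) u ->
    (forall y, slice X s y -> 0 <= u y <= 1) ->
    (0 < T -> exists2 f, lipschitz_in (slice X s) (Num.sqrt T)^-1 f &
      forall y, slice X s y -> u y = Phi (f y)) ->
  let v (x : ambient X t) := (\int[hker X x s]_(y in slice X s) (u y)%:E)%E in
  (exists c : R, forall x, slice X t x -> v x = c%:E) \/
  (exists2 f, lipschitz_in (slice X t) (Num.sqrt (t - s + T))^-1 f &
    forall x, slice X t x -> v x = (Phi (f x))%:E).

Definition reproduction I X := forall t1 t2 t3 : R,
  I t1 -> I t2 -> I t3 -> t1 <= t2 -> t2 <= t3 ->
  forall x : ambient X t3, slice X t3 x ->
  forall A : set (borel (ambient X t1)), measurable A ->
    hker X x t1 A = (\int[hker X x t2]_(y in slice X t2) hker X y t1 A)%E.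

Definition metric_flow Phi I X :=
  [/\ forall t, I t -> complete_set (slice X t) /\ separable_set (slice X t),
      forall s t (x : ambient X t), I s -> I t -> s <= t -> slice X t x ->
        hker X x s (slice X s) = 1%E,
      forall t (x : ambient X t), I t -> slice X t x ->
        forall A : set (borel (ambient X t)), measurable A ->
          hker X x t A = \d_(x : borel (ambient X t)) A,
      heat_regularity Phi I X &
      reproduction I X].

Definition concentrated (H : R) I X := forall s t : R, I s -> I t -> s <= t ->
  forall x1 x2 : ambient X t, slice X t x1 -> slice X t x2 ->
  (mutual_variance (hker X x1 s) (hker X x2 s) <=
     (mdist x1 x2 ^+ 2 + H * (t - s))%:E)%E.

Definition conjugate_heat_flow I X
    (mu : forall t, borel_probability (ambient X t) R) :=
  (forall t, I t -> mu t (slice X t) = 1%E) /\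
  (forall s t, I s -> I t -> s <= t ->
    forall A : set (borel (ambient X s)), measurable A ->
      mu s A = (\int[mu t]_(x in slice X t) hker X x s A)%E).

Definition rescale X (t0 : R) (l : {posnum R}) : flow R :=
  let time t := t / l%:num ^+ 2 + t0 in
  @Flow R (fun t => scaled l (ambient X (time t)))
    (fun t => slice X (time t))
    (fun t x s => hker X (x : ambient X (time t)) (time s)).

End metric_flows.

(* [ptimes] is the time set I' of the pair. *)
Record flow_pair (R : realType) := FlowPair {
  pflow : flow R ;
  ptimes : set R ;
  pmeas : forall t, borel_probability (ambient pflow t) R }.
Arguments pflow {R} f.
Arguments ptimes {R} f _.
Arguments pmeas {R} f t.

Section flow_pairs.
Context {R : realType}.
Implicit Types (X : flow R) (P Q : flow_pair R) (I : set R) (Phi : R -> R).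

Local Notation pslice P t := (slice (pflow P) t).
Local Notation pspace P t := (ambient (pflow P) t).

Definition metric_flow_pair Phi I P :=
  [/\ ptimes P `<=` I,
      (@lebesgue_measure R).-negligible (I `\` ptimes P),
      metric_flow Phi (ptimes P) (pflow P),
      conjugate_heat_flow (ptimes P) (pmeas P) &
      forall t, ptimes P t -> supp (pmeas P t) = pslice P t].

Definition restrict_pair P I : flow_pair R :=
  @FlowPair R (pflow P) (ptimes P `&` I) (pmeas P).

Definition support_pair P : flow_pair R :=
  @FlowPair R
    (@Flow R (ambient (pflow P)) (fun t => pslice P t `&` supp (pmeas P t))
       (fun t x s => hker (pflow P) x s))
    (ptimes P) (pmeas P).

Definition isometric_pairs P Q := exists (N : set R)
    (psi : forall t, pspace P t -> pspace Q t),
  [/\ (@lebesgue_measure R).-negligible N,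
      ptimes P `\` N = ptimes Q `\` N,
      forall t, (ptimes P `\` N) t ->
        set_bij (pslice P t) (pslice Q t) (psi t) /\
        isometric_in (pslice P t) (psi t),
      forall s t, (ptimes P `\` N) s -> (ptimes P `\` N) t -> s <= t ->
        forall x, pslice P t x ->
        forall A : set (borel (pspace Q s)), measurable A ->
          hker (pflow Q) (psi t x) s A =
            push_in (hker (pflow P) x s) (pslice P s) (psi s) A &
      forall t, (ptimes P `\` N) t ->
        forall A : set (borel (pspace Q t)), measurable A ->
          pmeas Q t A = push_in (pmeas P t) (pslice P t) (psi t) A].

Record correspondence I P Q := Correspondence {
  cspace : R -> pmetricType R ;
  cdom1 : set R ;
  cdom2 : set R ;
  cemb1 : forall t, pspace P t -> cspace t ;
  cemb2 : forall t, pspace Q t -> cspace t ;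
  cdom1_sub : cdom1 `<=` I `&` ptimes P ;
  cdom2_sub : cdom2 `<=` I `&` ptimes Q ;
  cemb1_isometric : forall t, cdom1 t -> isometric_in (pslice P t) (@cemb1 t) ;
  cemb2_isometric : forall t, cdom2 t -> isometric_in (pslice Q t) (@cemb2 t) }.
Arguments cspace {I P Q} c t.
Arguments cdom1 {I P Q} c _.
Arguments cdom2 {I P Q} c _.
Arguments cemb1 {I P Q} c t _.
Arguments cemb2 {I P Q} c t _.

Definition F_close I P Q (r : R) :=
  exists (C : correspondence I P Q) (E : set R)
    (q : forall t,
       probability (borel (pspace P t) * borel (pspace Q t))%type R),
  [/\ measurable E /\ E `<=` I,
      I `\` E `<=` cdom1 C `&` cdom2 C,
      (lebesgue_measure E <= (r ^+ 2)%:E)%E,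
      forall t, (I `\` E) t -> coupling (pmeas P t) (pmeas Q t) (q t) &
      forall s t, (I `\` E) s -> (I `\` E) t -> s <= t ->
        (\int[q t]_(x in pslice P t `*` pslice Q t)
           wasserstein1
             (push_in (hker (pflow P) x.1 s) (pslice P s) (cemb1 C s))
             (push_in (hker (pflow Q) x.2 s) (pslice Q s) (cemb2 C s))
         <= r%:E)%E].

Definition F_dist I P Q : \bar R :=
  ereal_inf [set r%:E | r in [set r : R | 0 < r /\ F_close I P Q r]].

Definition rescaled_pair X I (t0 : R) (x0 : ambient X t0) (l : {posnum R})
    (T : R) : flow_pair R :=
  support_pair (@FlowPair R (rescale X t0 l)
    ([set l%:num ^+ 2 * (t - t0) | t in I] `&` `[- T, 0])
    (fun t => hker X x0 (t / l%:num ^+ 2 + t0))).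

Definition tangent_flows_at_infinity Phi I X (t0 : R) (x0 : ambient X t0) :
    set (flow_pair R) :=
  [set P | metric_flow_pair Phi `]-oo, 0] P /\
    (exists x_max : pspace P 0, [/\ ptimes P 0, pslice P 0 x_max &
       forall t, ptimes P t ->
         forall A : set (borel (pspace P t)), measurable A ->
           pmeas P t A = hker (pflow P) x_max t A]) /\
    (exists l : nat -> {posnum R},
       [/\ nonincreasing_seq (fun j => (l j)%:num),
           (l j)%:num @[j --> \oo] --> (0 : R) &
           forall T : R, 0 < T ->
             F_dist `[- T, 0]
               (rescaled_pair I x0 (l j) T)
               (restrict_pair P `[- T, 0]) @[j --> \oo] --> 0%E])].

Definition same_up_to_isometry (A B : set (flow_pair R)) :=
  (forall P, A P -> exists2 Q, B Q & isometric_pairs P Q) /\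
  (forall Q, B Q -> exists2 P, A P & isometric_pairs P Q).

End flow_pairs.

(* Main.v *)
Require Import Defs.
From HB Require Import structures.
From mathcomp Require Import all_boot all_order all_algebra.
From mathcomp Require Import all_classical all_reals all_analysis.
From mathcomp Require Import measurable_realfun lra.

Set Implicit Arguments.
Unset Strict Implicit.
Unset Printing Implicit Defensive.

Import Order.TTheory GRing.Theory Num.Theory.
Import numFieldNormedType.Exports.

Local Open Scope classical_set_scope.
Local Open Scope ring_scope.

(** Blowing down a flow makes the distance of two base points and the difference of their
    times disappear. The proof shows that a tangent flow at infinity based at [x0] is,
    as the very same pair and for the same scales, a tangent flow at infinity based
    at [y0]: at a small scale [l] the two rescaled pairs are so close that each may
    replace the other in an [F]-closeness ([F_close_transfer]). For this the pairs are
    compared in two steps, with the square [Theta] of the scale as a parameter.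

    Change of the base point ([base_change_asymptotic]). At a fixed time below both base
    points the two heat kernels have a finite mutual variance, which after scaling is
    of order [Theta]. Between that time and a scaled time below [- sig] there is an actual
    time of order [1 / Theta]. By heat regularity the heat kernels at two points of
    distance [d] differ by at most [d / Num.sqrt t] in total variation after the time
    [t], so that the two conjugate heat flows become close in total variation. Their
    variance stays bounded by concentration, so they are coupled at small mean distance
    ([total_variation_coupling]). Heat kernels at nearby points are close in the
    Wasserstein sense ([kernel_coupling]).

    Change of the origin of time ([shift_asymptotic]). The two pairs consist of the same
    flow and the same conjugate heat flow at times that differ by a fixed amount,
    which is of order [Theta] after scaling. The variance of a conjugate heat flow, plus
    a linear function of time, is monotone ([variance_evolves]) and bounded, so that it
    increases noticeably during a short time only at few times ([small_increments]).
    At the other times the heat kernel moves pairs of points with almost no change of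
    their distance ([distance_fluctuation]). To turn this into an almost isometry
    between the slices one needs a lower bound for the mass of most balls
    ([exists_almost_isometry]), and it has to be independent of the scale: it comes from
    a Harnack property ([ball_mass]), itself a consequence of heat regularity since [Phi]
    is positive.

    Ambient spaces may be nonseparable, with a distance that is not jointly measurable.
    The comparison therefore takes place on separable models ([model]), made of the
    points that carry the heat kernels; by mutual absolute continuity
    ([hker_null_later]) these are the same points for all base points. The
    triangle inequality for Wasserstein distances in an arbitrary correspondence
    ([glue_couplings], [bridge_wasserstein]) still has to deal with lower integrals. *)

(** * Integration of nonnegative functions *)

Section integrals.
Local Open Scope ereal_scope.
Context {R : realType}.

Import HBNNSimple.

(** The integral of a nonnegative function is the supremum of the integrals of
    the simple functions below it, measurable or not. *)
Lemma le_integral_ge0 d (T : measurableType d) (mu : {measure set T -> \bar R})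
    (f g : T -> \bar R) : (forall x, 0 <= f x) -> (forall x, f x <= g x) ->
  \int[mu]_x f x <= \int[mu]_x g x.
Proof.
move=> f0 fg; rewrite !ge0_integralTE//; last by move=> x; exact: le_trans (fg x).
apply: ge_ereal_sup => _ [h /= hf <-]; apply: ereal_sup_ubound.
by exists h => //= x; exact: le_trans (hf x) (fg x).
Qed.

Lemma integralDT d (T : measurableType d) (mu : {measure set T -> \bar R})
    (f g : T -> \bar R) : measurable_fun [set: T] f -> (forall x, 0 <= f x) ->
  measurable_fun [set: T] g -> (forall x, 0 <= g x) ->
  \int[mu]_x (f x + g x) = \int[mu]_x f x + \int[mu]_x g x.
Proof. by move=> mf f0 mg g0; rewrite ge0_integralD. Qed.

Lemma integralZT d (T : measurableType d) (mu : {measure set T -> \bar R})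
    (k : R) (f : T -> \bar R) : (0 <= k)%R ->
  measurable_fun [set: T] f -> (forall x, 0 <= f x) ->
  \int[mu]_x (k%:E * f x) = k%:E * \int[mu]_x f x.
Proof. by move=> k0 mf f0; rewrite ge0_integralZl. Qed.

Lemma integral_cstT d (T : measurableType d) (P : probability T R) (c : \bar R) :
  \int[P]_x c = c.
Proof.
apply: eq_trans (integral_cst P measurableT c) _.
by rewrite [X in _ * X]probability_setT mule1.
Qed.

Lemma integral_indicT d (T : measurableType d) (mu : {measure set T -> \bar R}) A :
  measurable A -> \int[mu]_x (\1_A x)%:E = mu A.
Proof. by move=> mA; rewrite integral_indic// setIT. Qed.

Lemma measurable_indicE d (T : measurableType d) (A : set T) : measurable A ->
  measurable_fun setT (fun x => (\1_A x : R)%:E).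
Proof. by move=> mA; apply/measurable_EFinP; exact: measurable_indic. Qed.

Lemma integral_le_cst d (T : measurableType d) (P : probability T R)
    (f : T -> \bar R) (c : \bar R) : (forall x, 0 <= f x) ->
  (forall x, f x <= c) -> \int[P]_x f x <= c.
Proof.
move=> f0 fc; have <- : \int[P]_x (cst c x) = c.
  by rewrite integral_cst// [X in _ * X]probability_setT mule1.
exact: le_integral_ge0.
Qed.

Lemma exists_le_integral d (T : measurableType d) (P : probability T R)
    (f : T -> \bar R) (c : \bar R) : (forall x, 0 <= f x) -> 
  \int[P]_x f x < c -> exists x, f x < c.
Proof.
move=> f0 fc; apply: contrapT => /forallNP nf.
have c0 : 0 <= c by rewrite (le_trans _ (ltW fc))// integral_ge0.
suff : c <= \int[P]_x f x by rewrite leNgt fc.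
have <- : \int[P]_x (cst c x) = c.
  by rewrite integral_cst// [X in _ * X]probability_setT mule1.
by apply: le_integral_ge0 => // x; rewrite leNgt; exact/negP/nf.
Qed.

(** Push-forwards are stated with an existential quantifier: the bundled measure
    never appears in a term, where unification would have to unfold it. *)
Lemma exists_push d1 d2 (X : measurableType d1) (Y : measurableType d2)
    (P : probability X R) (g : X -> Y) : measurable_fun setT g ->
  exists Q : probability Y R, (forall A, Q A = P (g @^-1` A)) /\
    forall f : Y -> \bar R, measurable_fun [set: Y] f -> (forall y, 0 <= f y) ->
      \int[Q]_y f y = \int[P]_x f (g x).
Proof.
move=> mg; pose G : {mfun X >-> Y} :=
  HB.pack g (isMeasurableFun.Build _ _ _ _ _ mg).
exists (distribution P G); split => // f mf f0.
by rewrite ge0_integral_distribution.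
Qed.

Section kernels.
Context d1 d2 (X : measurableType d1) (Y : measurableType d2).

(** A condition on a plain family of probabilities, so that no bundled kernel has to
    be built for each family. *)
Definition kernel_like (k : X -> probability Y R) :=
  forall A, measurable A -> measurable_fun setT (fun x => k x A).

Variable k : X -> probability Y R.
Hypothesis mk : kernel_like k.

Let kf of kernel_like k : X -> {measure set Y -> \bar R} := k.
Let mkf : forall U, measurable U -> measurable_fun [set: X] (kf mk ^~ U).
Proof. exact: mk. Qed.
HB.instance Definition _ := isKernel.Build _ _ X Y R (kf mk) mkf.
Let kf1 x : kf mk x setT = 1. Proof. exact: probability_setT. Qed.
HB.instance Definition _ := Kernel_isProbability.Build _ _ X Y R (kf mk) kf1.

Lemma measurable_kernel_integral (f : X * Y -> \bar R) :
  (forall z, 0 <= f z) -> measurable_fun setT f ->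
  measurable_fun setT (fun x => \int[k x]_y f (x, y)).
Proof.
move=> f0 mf; exact: (measurable_fun_integral_sfinite_kernel f (kf mk)).
Qed.

Lemma measurable_kernel_integral1 (f : Y -> \bar R) :
  (forall z, 0 <= f z) -> measurable_fun setT f ->
  measurable_fun setT (fun x => \int[k x]_y f y).
Proof.
move=> f0 mf; apply: (measurable_kernel_integral (f := f \o snd)).
  by move=> z; exact: f0.
exact: (measurableT_comp mf measurable_snd).
Qed.

Lemma measurable_kernel_xsection (A : set (X * Y)) : measurable A ->
  measurable_fun setT (fun x => k x (xsection A x)).
Proof.
move=> mA; apply: (@measurable_fun_xsection_finite_kernel _ _ _ _ _ (kf mk)).
by rewrite inE.
Qed.
End kernels.

Lemma measurable_mean d1 d2 (X : measurableType d1) (Y : measurableType d2)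
    (P : probability Y R) (f : X * Y -> \bar R) : (forall z, 0 <= f z) ->
  measurable_fun [set: X * Y] f ->
  measurable_fun [set: X] (fun x => \int[P]_y f (x, y)).
Proof.
have mk : kernel_like (fun _ : X => P) by move=> A mA; exact: measurable_cst.
exact: (measurable_kernel_integral mk).
Qed.

Section kprod.
Context d1 d2 (X : measurableType d1) (Y : measurableType d2).
Variables (P : probability X R) (k : X -> probability Y R).
Hypothesis mk : kernel_like k.

Let kp of kernel_like k := fun A : set (X * Y) => \int[P]_x k x (xsection A x).

Let kp0 : kp mk set0 = 0.
Proof.
rewrite /kp (eq_integral (cst 0)) ?integral0// => y _.
by rewrite xsection0 measure0.
Qed.

Let kp_ge0 A : 0 <= kp mk A. Proof. exact: integral_ge0. Qed.

Let kp_sigma_additive : semi_sigma_additive (kp mk).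
Proof.
move=> U mU tU mUU; rewrite [X in _ --> X](_ : _ =
  \int[P]_x (\sum_(n <oo) k x (xsection (U n) x))); last first.
  apply: eq_integral => V _; rewrite xsection_bigcup.
  apply/esym/cvg_lim => //; apply: measure_semi_sigma_additive.
  - by move=> n; exact: measurable_xsection.
  - exact: trivIset_xsection.
  - by apply: bigcup_measurable => n _; exact: measurable_xsection.
apply/cvg_closeP; split.
  by apply: is_cvg_nneseries => n _ _; exact: integral_ge0.
rewrite closeE// integral_nneseries// => n.
exact: measurable_kernel_xsection.
Qed.

HB.instance Definition _ := isMeasure.Build _ _ R (kp mk) kp0 kp_ge0
  kp_sigma_additive.

Let kp1 : kp mk setT = 1.
Proof.
rewrite /kp (eq_integral (cst 1)).
  by rewrite integral_cst// mul1e; exact: probability_setT.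
by move=> x _; rewrite -setXTT in_xsectionX ?inE//; exact: probability_setT.
Qed.

HB.instance Definition _ := Measure_isProbability.Build _ _ _ (kp mk) kp1.

(** The measure of [A] is the mean of [k x] of the section of [A] at [x]; the formula
    for integrals follows from that for indicator functions by approximation. *)
Lemma exists_kprod : exists Q : probability (X * Y)%type R,
  forall f : X * Y -> \bar R, measurable_fun [set: X * Y] f -> (forall z, 0 <= f z) ->
    \int[Q]_z f z = \int[P]_x \int[k x]_y f (x, y).
Proof.
exists (kp mk) => f mf f0.
pose f_ := nnsfun_approx measurableT mf.
have mf_ n x : measurable_fun setT (fun y => (f_ n (x, y))%:E).
  by apply/measurable_EFinP; apply: measurableT_comp.
have ndf n m z : (n <= m)%N -> (f_ n z)%:E <= (f_ m z)%:E.
  by move=> nm; rewrite lee_fin; exact/lefP/nd_nnsfun_approx.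
have mint n : measurable_fun setT (fun x => \int[k x]_y (f_ n (x, y))%:E).
  apply: (measurable_kernel_integral mk (f := EFin \o f_ n)).
    by move=> z; rewrite lee_fin.
  exact/measurable_EFinP.
transitivity (\int[kp mk]_z (lim ((f_ n z)%:E @[n --> \oo]))).
  by apply/eq_integral => z _; apply/esym/cvg_lim => //=; exact: cvg_nnsfun_approx.
rewrite monotone_convergence//; last 3 first.
- by move=> n; exact/measurable_EFinP.
- by move=> n z _; rewrite lee_fin.
- by move=> z _ a b ab; exact: ndf.
transitivity (\int[P]_x (lim ((\int[k x]_y (f_ n (x, y))%:E) @[n --> \oo]))); last first.
  apply: eq_integral => x _; rewrite -monotone_convergence//; last 2 first.
  - by move=> n z _; rewrite lee_fin.
  - by move=> z _ a b ab; exact: ndf.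
  by apply: eq_integral => y _; apply/cvg_lim => //=; exact: cvg_nnsfun_approx.
rewrite monotone_convergence//; last 2 first.
- by move=> n x _; apply: integral_ge0 => y _; rewrite lee_fin.
- move=> x _ a b ab; apply: le_integral_ge0 => y; first by rewrite lee_fin.
  exact: ndf.
congr (lim _); congr (_ @ \oo); apply/funext => n /=.
under eq_integral do rewrite fimfunE -fsumEFin//.
rewrite ge0_integral_fsum//; last 2 first.
- by move=> r; exact/measurable_EFinP/measurableT_comp.
- by move=> r z _; rewrite EFinM nnfun_muleindic_ge0.
have mp r : measurable (f_ n @^-1` [set r]).
  by [].
transitivity (\int[P]_x \sum_(r \in range (f_ n))
    r%:E * k x (xsection (f_ n @^-1` [set r]) x)).
  rewrite ge0_integral_fsum//; last 2 first.
  - move=> r; apply: measurable_funeM; exact: measurable_kernel_xsection.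
  - move=> r x _; have [r0|r0] := leP 0%R r; first by rewrite mule_ge0.
    by rewrite preimage_nnfun0// xsection0 measure0 mule0.
  apply: eq_fsbigr => r _.
  rewrite (integralZl_indic _ (fun r => f_ n @^-1` [set r]))//; last first.
    by move=> r0; rewrite preimage_nnfun0.
  rewrite integral_indic// setIT.
  have [r0|r0] := leP 0%R r.
    by rewrite ge0_integralZl//; exact: measurable_kernel_xsection.
  rewrite preimage_nnfun0// measure0 mule0 integral0_eq// => x _.
  by rewrite xsection0 measure0 mule0.
apply: eq_integral => x _.
under [RHS]eq_integral do rewrite fimfunE -fsumEFin//.
rewrite ge0_integral_fsum//; last 2 first.
- move=> r; apply/measurable_EFinP/measurableT_comp => //.
  exact: measurableT_comp.
- by move=> r z _; rewrite EFinM nnfun_muleindic_ge0.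
apply: eq_fsbigr => r _.
transitivity (\int[k x]_y (r * \1_(xsection (f_ n @^-1` [set r]) x) y)%:E).
  rewrite (integralZl_indic _ (fun r => xsection (f_ n @^-1` [set r]) x))//.
  - by rewrite integral_indic// ?setIT//; exact: measurable_xsection.
  - by move=> r0; rewrite preimage_nnfun0// xsection0.
  - exact: measurable_xsection.
by apply: eq_integral => y _; rewrite !indicE mem_xsection.
Qed.

End kprod.

Lemma integral_mixture d1 d2 (X : measurableType d1) (Y : measurableType d2)
    (P : probability X R) (k : X -> probability Y R) (Q : probability Y R) :
  kernel_like k -> (forall A, measurable A -> Q A = \int[P]_x k x A) ->
  forall f : Y -> \bar R, measurable_fun [set: Y] f -> (forall y, 0 <= f y) ->
    \int[Q]_y f y = \int[P]_x \int[k x]_y f y.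
Proof.
move=> mk QE f mf f0; have [S SE] := exists_kprod P mk.
have [S2 [S2E S2I]] := exists_push S (measurable_snd (T1 := X) (T2 := Y)).
rewrite (eq_measure_integral S2).
  by rewrite S2I// SE//; exact: (measurableT_comp mf measurable_snd).
move=> A mA _; apply: eq_trans (QE _ mA) _; apply: esym.
apply: eq_trans (S2E _) _.
have mB : measurable (@snd X Y @^-1` A).
  by rewrite -(setTI (_ @^-1` _)); exact: measurable_snd.
transitivity (\int[S]_z (\1_(@snd X Y @^-1` A) z)%:E).
  by rewrite integral_indic// setIT.
rewrite SE; last 2 first.
- by apply/measurable_EFinP; exact: measurable_indic.
- by move=> z; rewrite lee_fin.
apply: eq_integral => x _.
transitivity (\int[k x]_y (\1_A y)%:E); last by rewrite integral_indic// setIT.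
by apply: eq_integral => y _; rewrite !indicE.
Qed.

End integrals.

(** * Borel sets of metric spaces *)

Section borel_metric.
Context {R : realType}.
Implicit Types T Z : pmetricType R.

Definition separable_space T :=
  exists a : nat -> T, forall x (e : R), 0 < e -> exists n, mdist x (a n) < e.

Lemma borel_open T (A : set T) : open A -> measurable (A : set (borel T)).
Proof. by move=> oA; exact: sub_sigma_algebra. Qed.

Lemma borel_closed T (A : set T) : closed A -> measurable (A : set (borel T)).
Proof.
move=> cA; rewrite -[A](@setCK T); apply: measurableC; apply: borel_open.
exact: closed_openC.
Qed.

Lemma open_mdistP T (A : set T) :
  (forall x, A x -> exists2 e : R, 0 < e & forall y, mdist x y < e -> A y) ->
  open A.
Proof.
move=> h; rewrite openE => x /h[e e0 eA].
by apply/nbhs_ballP; exists e => // y; rewrite ballEmdist; exact: eA.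
Qed.

Lemma mdist_tri T (y x z : T) : mdist x z <= mdist x y + mdist y z.
Proof. exact: metric_triangle. Qed.

Lemma mdistC T (x y : T) : mdist x y = mdist y x.
Proof. exact: metric_sym. Qed.

Lemma measurable_ltP d (Y : measurableType d) (f : Y -> R) :
  (forall r, measurable [set y | f y < r]) -> measurable_fun setT f.
Proof.
move=> h; apply: (measurability _ (RGenInftyO.measurableE R)).
move=> _ [_ [r ->] <-]; rewrite setTI; exact: h.
Qed.

Lemma measurable_lip T (f : borel T -> R) :
  (forall x y : T, f x <= f y + mdist x y) -> measurable_fun setT f.
Proof.
move=> h; apply: measurable_ltP => r; apply: borel_open.
apply: open_mdistP => x /= fr; exists (r - f x); first by rewrite subr_gt0.
by move=> y xy; have := h y x; rewrite mdistC /=; lra.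
Qed.

Lemma measurable_mdistl T (a : T) :
  measurable_fun setT (fun x : borel T => @mdist R T x a).
Proof.
by apply: measurable_lip => x y; rewrite addrC; exact: mdist_tri.
Qed.

(** A function that is 1-Lipschitz in each variable, on a product with a
    separable first factor, is a countable infimum of sums
    [mdist x (a n) + c (a n) y] of functions of one variable; this is why it is
    measurable for the product of the Borel sigma-algebras. *)
Lemma measurable_lip2 T Z (c : T -> Z -> R) : separable_space T ->
  (forall x x' y, c x y <= mdist x x' + c x' y) ->
  (forall x y y', c x y <= c x y' + mdist y' y) ->
  measurable_fun setT (fun z : borel T * borel Z => c z.1 z.2).
Proof.
move=> [a sa] h1 h2; apply: measurable_ltP => r.
rewrite (_ : [set _ | _] = \bigcup_n
    [set z : borel T * borel Z | @mdist R T z.1 (a n) + c (a n) z.2 < r]).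
  apply: bigcup_measurable => n _.
  have mf : measurable_fun setT (fun z : borel T * borel Z =>
      @mdist R T z.1 (a n) + c (a n) z.2).
    apply: measurable_funD.
      exact: (measurableT_comp (measurable_mdistl (a n)) measurable_fst).
    have mc : measurable_fun setT (c (a n) : borel Z -> R).
      by apply: measurable_lip => x y; rewrite mdistC; exact: h2.
    exact: (measurableT_comp mc measurable_snd).
  have := mf measurableT _ (measurable_itv `]-oo, r[).
  by rewrite setTI.
apply/seteqP; split => z /=; last first.
  by move=> [n _ /=]; have := h1 z.1 (a n) z.2; lra.
move=> cr; have e0 : 0 < (r - c z.1 z.2) / 2 by rewrite divr_gt0// subr_gt0.
have [n nz] := sa z.1 _ e0; exists n => //=.
by have := h1 (a n) z.1 z.2; rewrite (mdistC (a n)); lra.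
Qed.

Lemma measurable_mdist T : separable_space T ->
  measurable_fun setT (fun z : borel T * borel T => @mdist R T z.1 z.2).
Proof.
move=> sT; apply: (@measurable_lip2 T T (fun x y => mdist x y)) => // x y z.
  exact: mdist_tri.
exact: mdist_tri.
Qed.

End borel_metric.

(** * Couplings *)

Section approximate_disintegration.
Local Open Scope ereal_scope.
Context {R : realType} (T : pmetricType R) d (Y : measurableType d).
Variables (Q : probability (borel T * Y)%type R) (P : probability (borel T) R).
Hypothesis QP : forall A : set (borel T), measurable A -> Q (A `*` setT) = P A.

(** Conditioning on the cells of a countable partition into small Borel sets takes
    the place of disintegration, at the price of the error [rho]. On a null
    cell the kernel is a Dirac mass, so that the support condition holds at every
    point. *)
Lemma approximate_disintegration (y0 : Y) (rho : R) :
  separable_space T -> (0 < rho)%R ->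
  exists k : borel T -> probability (borel T * Y)%type R,
  [/\ kernel_like k,
      forall f : borel T * Y -> \bar R, measurable_fun setT f ->
        (forall z, 0 <= f z) -> \int[Q]_z f z = \int[P]_x \int[k x]_z f z &
      forall x, k x [set z | (@mdist R T x z.1 < rho)%R] = 1].
Proof.
move=> [a sa] rho0.
pose F n : set (borel T) := [set x | (@mdist R T x (a n) < rho / 2)%R].
have mF n : measurable (F n).
  have := measurable_mdistl (a n) measurableT (measurable_itv `]-oo, (rho / 2)%R[).
  by rewrite setTI.
pose B := seqDU F.
have mB n : measurable (B n).
  apply: measurableD => //; apply: bigsetU_measurable => i _; exact: mF.
have BT : \bigcup_n B n = setT.
  rewrite -[LHS]seqDU_bigcup_eq; apply/seteqP; split => // x _.
  have [|n nx] := sa x (rho / 2)%R; first by rewrite divr_gt0.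
  by exists n.
have tB : trivIset setT B := @trivIset_seqDU _ F.
have idx x : {n | B n x}.
  by apply: cid; have [n _ Bnx] : (\bigcup_n B n) x; [rewrite BT|exists n].
have idxE n x : B n x -> sval (idx x) = n.
  move=> Bnx; apply: (tB) => //; exists x; split => //; exact: svalP (idx x).
have mBY n : measurable (B n `*` [set: Y]) by exact: measurableX.
pose k (x : borel T) : probability (borel T * Y)%type R :=
  mnormalize (mrestr Q (mBY (sval (idx x)))) (\d_(x, y0)).
have kE n x A : B n x -> k x A = if P (B n) == 0 then \d_(x, y0) A
    else Q (A `&` (B n `*` setT)) * (fine (P (B n)))^-1%:E.
  move=> Bnx; rewrite /k /= /mnormalize (idxE _ _ Bnx).
  change ((if (Q (setT `&` (B n `*` setT)) == 0)
      || (Q (setT `&` (B n `*` setT)) == +oo)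
    then (fun U => \d_(x, y0) U)
    else (fun U => Q (U `&` (B n `*` setT)) *
      (fine (Q (setT `&` (B n `*` setT))))^-1%:E)) A =
    if P (B n) == 0 then \d_(x, y0) A
    else Q (A `&` (B n `*` setT)) * (fine (P (B n)))^-1%:E).
  rewrite setTI QP//; case: ifPn => [/orP[->//|]|].
    by move=> /eqP Poo; have := probability_le1 P (mB n); rewrite Poo.
  by rewrite negb_or => /andP[/negbTE ->].
have mk : kernel_like k.
  move=> A mA; rewrite -BT; apply/measurable_fun_bigcup => // n.
  have [Pn0|Pn0] := eqVneq (P (B n)) 0.
    apply: (eq_measurable_fun (fun x => (\1_(ysection A y0) x)%:E)).
      move=> x /[!inE] Bnx; rewrite (kE n)// Pn0 eqxx diracE indicE.
      by rewrite mem_ysection.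
    apply: measurable_funTS; apply/measurable_EFinP; apply: measurable_indic.
    exact: measurable_ysection.
  apply: (eq_measurable_fun (cst
    (Q (A `&` (B n `*` setT)) * (fine (P (B n)))^-1%:E))).
    by move=> x /[!inE] Bnx; rewrite (kE n)// (negbTE Pn0).
  exact: measurable_cst.
exists k; split => //.
- apply: integral_mixture => // A mA; apply: esym.
  have -> : \int[P]_x k x A = \int[P]_(x in \bigcup_n B n) k x A by rewrite BT.
  rewrite ge0_integral_bigcup//; last first.
    by rewrite BT; exact: mk.
  transitivity (\sum_(n <oo) Q (A `&` (B n `*` setT))).
    apply: eq_eseriesr => n _.
    have [Pn0|Pn0] := eqVneq (P (B n)) 0.
      rewrite (_ : Q _ = 0).
        apply: null_set_integral => //; apply: measurable_funTS; exact: mk.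
      apply/eqP; rewrite eq_le measure_ge0 andbT -Pn0 -QP//.
      by apply: le_measure; rewrite ?inE//; exact: measurableI.
    rewrite (eq_integral (cst
      (Q (A `&` (B n `*` setT)) * (fine (P (B n)))^-1%:E))).
      rewrite integral_cst// -muleA -[X in _ * (_ * X)](@fineK _ (P (B n))).
        by rewrite -EFinM mulVf ?mule1// fine_eq0// fin_num_measure.
      exact: fin_num_measure.
    by move=> x /[!inE] Bnx; rewrite (kE n)// (negbTE Pn0).
  have mAB n : measurable (A `&` (B n `*` [set: Y])) by exact: measurableI.
  transitivity (Q (\bigcup_n (A `&` (B n `*` [set: Y])))); last first.
    by rewrite -setI_bigcupr -setX_bigcupl BT setXTT setIT.
  apply: cvg_lim => //; apply: measure_semi_sigma_additive => //.
    apply/trivIset_setIl/trivIsetP => i j _ _ ij.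
    have /trivIsetP/(_ i j Logic.I Logic.I ij) Bij := tB.
    by rewrite -setXI Bij set0X.
  exact: bigcup_measurable.
- move=> x; have Bnx := svalP (idx x); set n := sval (idx x) in Bnx.
  rewrite (kE n)//; case: ifPn => Pn0.
    by rewrite diracE mem_set//= mdistxx.
  rewrite (_ : _ `&` _ = B n `*` setT).
    rewrite QP// -[X in X * _](@fineK _ (P (B n))) ?fin_num_measure//.
    by rewrite -EFinM divff// fine_eq0// fin_num_measure.
  apply/seteqP; split => [z []//|z [Bz _]]; split => //=.
  have [Fx _] : F n x /\ True by split => //; case: Bnx.
  have [Fz _] : F n z.1 /\ True by split => //; case: Bz.
  by have := mdist_tri (a n) (x : T) z.1; rewrite (mdistC (a n)); move: Fx Fz;
    rewrite /F /=; lra.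
Qed.

End approximate_disintegration.

Section glue.
Local Open Scope ereal_scope.
Context {R : realType}.

Import HBNNSimple.

Lemma integral_le_simple d (T : measurableType d) (mu : {measure set T -> \bar R})
    (f : T -> \bar R) (c : \bar R) : (forall x, 0 <= f x) ->
  (forall h : T -> R, measurable_fun setT h -> (forall x, (0 <= h x)%R) ->
    (forall x, (h x)%:E <= f x) -> \int[mu]_x (h x)%:E <= c) ->
  \int[mu]_x f x <= c.
Proof.
move=> f0 hc; rewrite ge0_integralTE//; apply: ge_ereal_sup => _ [h /= hf <-].
by rewrite -integralT_nnsfun; apply: hc.
Qed.

Lemma probability_full d (T : measurableType d) (P : probability T R)
    (A : set T) : measurable A -> P A = 1 -> P (~` A) = 0.
Proof.
move=> mA PA; have := probability_setC P mA; rewrite PA subee//.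
Qed.

Lemma le_maxe_subD (h : R) (b : \bar R) : 0 <= b ->
  h%:E <= maxe 0 (h%:E - b) + b.
Proof.
case: b => [b| |] //= b0; last by rewrite addey ?leey// gt_eqF// lt_max ltNy0.
by rewrite -leeBlDr// le_max lexx orbT.
Qed.

Lemma maxe_sub_le (h : R) (b c : \bar R) : 0 <= b -> 0 <= c ->
  h%:E <= b + c -> maxe 0 (h%:E - b) <= c.
Proof.
case: b => [b b0|_|//] c0 hbc; rewrite ge_max c0 andTb.
  by rewrite leeBlDl.
exact: leNye.
Qed.

Lemma integral_le_full d (T : measurableType d) (P : probability T R)
    (f : T -> \bar R) (A : set T) (c : \bar R) : measurable A -> P A = 1 ->
  measurable_fun setT f -> (forall x, 0 <= f x) -> 0 <= c ->
  (forall x, A x -> f x <= c) -> \int[P]_x f x <= c.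
Proof.
move=> mA PA mf f0 c0 fc.
have <- : \int[P]_x (cst c x) = c.
  by rewrite integral_cst// [X in _ * X]probability_setT mule1.
apply: ae_ge0_le_integral => //; exists (~` A); split.
- exact: measurableC.
- exact: probability_full.
- by apply: subsetC => x Ax _; exact: fc.
Qed.

(** Two couplings with a common marginal are glued along it up to an error
    [rho]: the pairs [(x, z)] and [(x', y)] that are put together satisfy
    [mdist x x' < rho]. The functions [W] and [W'] may fail to be measurable;
    their integrals are then lower integrals, and the estimate survives since it
    is obtained by integrating out [(x', y)] given [(x, z)]. *)
Lemma glue_couplings (T : pmetricType R) d1 (Y : measurableType d1) d2
    (Z : measurableType d2) (P : probability (borel T) R)
    (Q : probability (borel T * Y)%type R) (q : probability (borel T * Z)%type R)
    (rho : R) :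
  separable_space T -> (0 < rho)%R ->
  (forall A : set (borel T), measurable A -> Q (A `*` setT) = P A) ->
  (forall A : set (borel T), measurable A -> q (A `*` setT) = P A) ->
  exists q' : probability (Y * Z)%type R,
  [/\ forall A, measurable A -> q' (A `*` setT) = Q (setT `*` A),
      forall A, measurable A -> q' (setT `*` A) = q (setT `*` A) &
      forall (M : T -> Y -> \bar R) (W : T -> Z -> \bar R)
        (W' : Y -> Z -> \bar R) (w : R), (0 <= w)%R ->
        (forall x y, 0 <= M x y) -> (forall x z, 0 <= W x z) ->
        (forall y z, 0 <= W' y z) ->
        measurable_fun setT (fun u : borel T * Y => M u.1 u.2) ->
        (forall x x' y z, (mdist x x' < rho)%R ->
          W' y z <= M x' y + w%:E + W x z) ->
        \int[q']_u W' u.1 u.2 <=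
          \int[Q]_u M u.1 u.2 + w%:E + \int[q]_u W u.1 u.2].
Proof.
move=> sT rho0 QP qP.
have [y0 _] : exists y0 : Y, True.
  apply: contrapT => /forallNP nY.
  have : Q setT = 0.
    rewrite (_ : setT = set0) ?measure0//; apply/seteqP; split => // -[x y] _.
    exact: (nY y).
  by move=> Q0; have := probability_setT Q; rewrite Q0 => /eqP; rewrite eq_sym onee_eq0.
have [k [mk Qk k1]] := approximate_disintegration QP y0 sT rho0.
pose k' (xz : borel T * Z) := k xz.1.
have mk' : kernel_like k'.
  by move=> A mA; exact: (measurableT_comp (mk A mA) measurable_fst).
have [S SE] := exists_kprod q mk'.
pose g (u : (borel T * Z) * (borel T * Y)) := (u.2.2, u.1.2).
have mg : measurable_fun setT g.
  apply/measurable_fun_pair => /=.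
    exact: (measurableT_comp measurable_snd measurable_snd).
  exact: (measurableT_comp measurable_snd measurable_fst).
have [q' [q'E q'I]] := exists_push S mg.
have qI (f : borel T * Y -> \bar R) : measurable_fun setT f ->
    (forall z, 0 <= f z) -> \int[q]_u \int[k u.1]_z f z = \int[Q]_z f z.
  move=> mf f0; rewrite Qk//.
  have [q1 [q1E q1I]] := exists_push q (@measurable_fst _ _ (borel T) Z).
  rewrite -[LHS](q1I (fun x => \int[k x]_z f z)); last 2 first.
  - exact: measurable_kernel_integral1.
  - by move=> x; exact: integral_ge0.
  apply: eq_measure_integral => A mA _; apply: eq_trans (q1E _) _.
  apply: eq_trans _ (qP _ mA); congr (q _).
  by apply/seteqP; split => [[x z] //|[x z] []].
have q'I2 (f : Y * Z -> \bar R) : measurable_fun setT f ->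
    (forall u, 0 <= f u) ->
    \int[q']_u f u = \int[q]_u \int[k u.1]_z f (z.2, u.2).
  move=> mf f0; rewrite q'I//; apply: (SE (f \o g)).
    exact: (measurableT_comp mf mg).
  by move=> v; exact: f0.
have ind (mu : probability (Y * Z)%type R) (A : set (Y * Z)) :
    measurable A -> mu A = \int[mu]_u (\1_A u)%:E.
  by move=> mA; rewrite integral_indic// setIT.
have mind d' (V : measurableType d') (A : set V) : measurable A ->
    measurable_fun setT (fun u => (\1_A u : R)%:E).
  by move=> mA; apply/measurable_EFinP; exact: measurable_indic.
exists q'; split.
- move=> A mA; have mA' : measurable (A `*` [set: Z]) by exact: measurableX.
  have mA'' : measurable ([set: borel T] `*` A) by exact: measurableX.
  rewrite ind// q'I2//; last exact: mind.
  transitivity (\int[Q]_u (\1_([set: borel T] `*` A) u)%:E); last first.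
    by rewrite integral_indic// setIT.
  apply: eq_trans _ (qI _ (mind _ _ _ mA'') _); last first.
    by move=> u; rewrite lee_fin.
  apply: eq_integral => u _; apply: eq_integral => z _; rewrite !indicE.
  by rewrite !in_setX !in_setT /= ?andbT.
- move=> A mA; have mA' : measurable ([set: Y] `*` A) by exact: measurableX.
  have mA'' : measurable ([set: borel T] `*` A) by exact: measurableX.
  rewrite ind// q'I2//; last exact: mind.
  transitivity (\int[q]_u (\1_([set: borel T] `*` A) u)%:E); last first.
    by rewrite integral_indic// setIT.
  apply: eq_integral => u _.
  rewrite (eq_integral (cst (\1_([set: borel T] `*` A) u)%:E)).
    by rewrite integral_cst// [X in _ * X]probability_setT mule1.
  move=> z _; rewrite /= !indicE.
  by rewrite !in_setX !in_setT.
- move=> M W W' w w0 M0 W0 W'0 mM MW.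
  (* [G], the excess of a simple function below [W'] over [M + w], is measurable, and
     its mean under the conditional law of [(x', y)] is at most [W x z]. *)
  apply: integral_le_simple => // h mh h0 hW.
  have mhE : measurable_fun setT (EFin \o h) by exact/measurable_EFinP.
  rewrite (q'I2 (EFin \o h))//.
  pose G (v : (borel T * Z) * (borel T * Y)) :=
    maxe 0 ((h (v.2.2, v.1.2))%:E - (M v.2.1 v.2.2 + w%:E)).
  have mM2 : measurable_fun setT (fun v : (borel T * Z) * (borel T * Y) =>
      M v.2.1 v.2.2 + w%:E).
    apply: emeasurable_funD => //.
    exact: (measurableT_comp mM measurable_snd).
  have mG : measurable_fun setT G.
    apply: measurable_maxe => //; apply: emeasurable_funB => //.
    exact: (measurableT_comp mhE mg).
  have G0 v : 0 <= G v by rewrite /G le_max lexx.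
  have mGu u : measurable_fun setT (fun z => G (u, z)).
    exact: (measurableT_comp mG (measurable_pair1 u)).
  have hG u z : (h (z.2, u.2))%:E <= G (u, z) + (M z.1 z.2 + w%:E).
    by apply: le_maxe_subD; rewrite adde_ge0// lee_fin.
  have mMw : measurable_fun setT (fun z : borel T * Y => M z.1 z.2 + w%:E).
    exact: emeasurable_funD.
  have Mw0 (z : borel T * Y) : 0 <= M z.1 z.2 + w%:E.
    by rewrite adde_ge0// lee_fin.
  apply: (@le_trans _ _ (\int[q]_u (\int[k u.1]_z G (u, z) +
      \int[k u.1]_z (M z.1 z.2 + w%:E)))).
    apply: le_integral_ge0 => u; first by apply: integral_ge0 => z _; rewrite lee_fin.
    rewrite -ge0_integralD//; apply: le_integral_ge0 => z; first by rewrite lee_fin.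
    exact: hG.
  rewrite ge0_integralD//; last 4 first.
  - by move=> u _; exact: integral_ge0.
  - exact: (measurable_kernel_integral mk').
  - by move=> u _; exact: integral_ge0.
  - apply: (measurable_kernel_integral1 mk') => //.
  rewrite addeC; apply: leeD.
    rewrite qI// ge0_integralD//.
    have -> : \int[Q]_x w%:E = w%:E; last by [].
    by rewrite (integral_cst Q measurableT w%:E) [X in _ * X]probability_setT mule1.
  apply: le_integral_ge0 => u; first exact: integral_ge0.
  apply: (@integral_le_full _ _ (k u.1) (fun z => G (u, z)) [set z | (@mdist R T u.1 z.1 < rho)%R]) => //.
    have := measurableT_comp (measurable_mdistl (u.1 : T)) (@measurable_fst _ _ (borel T) Y).
    move=> /(_ measurableT _ (measurable_itv `]-oo, rho[)); rewrite setTI.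
    congr measurable; apply/seteqP; split => z /=; rewrite in_itv /= mdistC//.
  move=> z /= uz; apply: maxe_sub_le => //.
  exact: le_trans (hW _) (MW _ _ _ _ uz).
Qed.

End glue.

Section total_variation_coupling.
Local Open Scope ereal_scope.
Context {R : realType} d (T : measurableType d).
Variables (P1 P2 : probability T R) (tau : R).

Let nu : {charge set T -> \bar R} :=
  cadd (charge_of_finite_measure P1) (cscale (-1) (charge_of_finite_measure P2)).

Let nuE A : nu A = P1 A - P2 A.
Proof. change (P1 A + (-1)%:E * P2 A = P1 A - P2 A).
by rewrite EFinN mulN1e. Qed.

(** The Hahn decomposition of [P1 - P2]: on [D], where [P1] is the larger one, and
    on [N] the smaller of the two measures is their common part; [jp] and [jn] are the
    excesses of [P1] and of [P2] over it. *)
Lemma exists_hahn_parts :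
  exists D N : set T, exists jp jn : {finite_measure set T -> \bar R},
  [/\ [/\ measurable D, measurable N, D `|` N = setT & D `&` N = set0],
      forall A, measurable A -> P1 A = P2 (A `&` D) + P1 (A `&` N) + jp A,
      forall A, measurable A -> P2 A = P2 (A `&` D) + P1 (A `&` N) + jn A,
      jp setT = P1 D - P2 D & jn setT = jp setT].
Proof.
have [D [N h]] := Hahn_decomposition nu.
have [[mD _] [mN _] DN DN0] := h.
pose jp : {finite_measure set T -> \bar R} := jordan_pos h.
pose jn : {finite_measure set T -> \bar R} := jordan_neg h.
exists D, N, jp, jn.
have jpE A : measurable A -> jp A = P1 (A `&` D) - P2 (A `&` D).
  move=> mA; rewrite /jp /= jordan_posE cjordan_posE /crestr0 mem_set//.
  exact: nuE.
have jnE A : measurable A -> jn A = P2 (A `&` N) - P1 (A `&` N).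
  move=> mA; rewrite /jn /= jordan_negE cjordan_negE /crestr0 mem_set//.
  rewrite /crestr nuE fin_num_oppeB ?fin_num_measure//; first by rewrite addeC.
  exact: measurableI.
have split (P : probability T R) A : measurable A ->
    P A = P (A `&` D) + P (A `&` N).
  move=> mA; rewrite -measureU//.
  - by rewrite -setIUr DN setIT.
  - exact: measurableI.
  - exact: measurableI.
  - by rewrite setIACA DN0 setI0.
have fin (P : probability T R) A : measurable A -> P A \is a fin_num.
  by move=> mA; exact: fin_num_measure.
split => //.
- move=> A mA; rewrite (split P1)// jpE//.
  have := fin P1 _ (measurableI _ _ mA mD); have := fin P2 _ (measurableI _ _ mA mD).
  have := fin P1 _ (measurableI _ _ mA mN).
  move: (P1 (A `&` D)) (P2 (A `&` D)) (P1 (A `&` N)).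
  move=> [x| |] [y| |] [z| |] //= _ _ _.
  by rewrite -!EFinD; congr EFin; lra.
- move=> A mA; rewrite (split P2)// jnE//.
  have := fin P1 _ (measurableI _ _ mA mN); have := fin P2 _ (measurableI _ _ mA mD).
  have := fin P2 _ (measurableI _ _ mA mN).
  move: (P2 (A `&` D)) (P2 (A `&` N)) (P1 (A `&` N)).
  move=> [x| |] [y| |] [z| |] //= _ _ _.
  by rewrite -!EFinD; congr EFin; lra.
- by rewrite jpE// setTI.
- rewrite jpE// jnE// !setTI.
  have := split P1 _ measurableT; have := split P2 _ measurableT.
  rewrite !setTI.
  have -> : P1 setT = 1 by exact: probability_setT.
  have -> : P2 setT = 1 by exact: probability_setT.
  have := fin P1 _ mN; have := fin P1 _ mD; have := fin P2 _ mN; have := fin P2 _ mD.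
  move: (P2 D) (P2 N) (P1 D) (P1 N).
  move=> [x| |] [y| |] [z| |] [t| |] //= _ _ _ _.
  rewrite -!EFinD => -[h1] [h2]; congr EFin; lra.
Qed.

Lemma exists_push_measure d1 d2 (X : measurableType d1) (Y : measurableType d2)
    (m : {measure set X -> \bar R}) (g : X -> Y) : measurable_fun setT g ->
  exists Q : {measure set Y -> \bar R}, (forall A, Q A = m (g @^-1` A)) /\
    forall f : Y -> \bar R, measurable_fun [set: Y] f -> (forall y, 0 <= f y) ->
      \int[Q]_y f y = \int[m]_x f (g x).
Proof.
move=> mg; unshelve refine (ex_intro _ (pushforward m g : {measure set Y -> \bar R}) _).
  exact: mg.
by split => // f mf f0; rewrite ge0_integral_pushforward.
Qed.

(** The common part of the two measures stays on the diagonal and the two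
    remainders, which have mass at most [tau] and are dominated by [P1] and by
    [P2], are coupled independently. The cost is therefore small as soon as it
    is bounded by a constant plus uniformly integrable terms in each variable. *)
Lemma total_variation_coupling :
  (forall A, measurable A -> P1 A <= P2 A + tau%:E) ->
  exists q : probability (T * T)%type R,
  [/\ forall A, measurable A -> q (A `*` setT) = P1 A,
      forall A, measurable A -> q (setT `*` A) = P2 A &
      forall (f : T * T -> \bar R) (F : R) (g h : T -> \bar R),
        measurable_fun setT f -> (forall z, 0 <= f z) ->
        (forall x, f (x, x) = 0) -> (0 <= F)%R ->
        measurable_fun setT g -> (forall x, 0 <= g x) ->
        measurable_fun setT h -> (forall x, 0 <= h x) ->
        (forall x y, f (x, y) <= F%:E + g x + h y) ->
        \int[q]_z f z <= (F * tau)%:E + \int[P1]_x g x + \int[P2]_x h x].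
Proof.
move=> Ptau.
have [D [N [jp [jn [[mD mN DN DN0] P1E P2E jpT jnT]]]]] := exists_hahn_parts.
pose a := fine (jp setT).
have aE : jp setT = a%:E by rewrite /a fineK// fin_num_measure.
have a0 : (0 <= a)%R by rewrite /a fine_ge0.
have atau : (a <= tau)%R.
  rewrite -lee_fin -aE jpT leeBlDl ?fin_num_measure//; exact: Ptau.
pose diag (x : T) := (x, x).
have mdiag : measurable_fun setT diag by exact/measurable_fun_pair.
pose m : {measure set T -> \bar R} := measure_add (mrestr P2 mD) (mrestr P1 mN).
have [pm [pmE pmI]] := exists_push_measure m mdiag.
have ai0 : (0 <= a^-1)%R by rewrite invr_ge0.
pose q0 : {measure set (T * T)%type -> \bar R} :=
  measure_add pm (mscale (NngNum ai0) (jp \x jn)).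
have q0E U : measurable U -> q0 U = P2 (diag @^-1` U `&` D) + P1 (diag @^-1` U `&` N) +
    a^-1%:E * (jp \x jn) U.
  move=> mU; apply: eq_trans (measure_addE _ _ _) _; congr (_ + _).
  by apply: eq_trans (pmE _) _; exact: measure_addE.
have jple (A : set T) : measurable A -> jp A <= a%:E.
  by move=> mA; rewrite -aE; apply: le_measure; rewrite ?inE.
have jnle (A : set T) : measurable A -> jn A <= a%:E.
  by move=> mA; rewrite -aE -jnT; apply: le_measure; rewrite ?inE.
have fixup (x : \bar R) : 0 <= x -> x <= a%:E -> a^-1%:E * (x * a%:E) = x.
  case: x => [x| |]//; rewrite ?lee_fin => x0 xa; rewrite -!EFinM; congr EFin.
  have [A0|an0] := eqVneq a 0%R; first by rewrite A0 invr0 in xa *; lra.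
  by rewrite mulrCA mulVf// mulr1.
have q01 A : measurable A -> q0 (A `*` setT) = P1 A.
  move=> mA; rewrite q0E; last exact: measurableX.
  rewrite product_measure1E// [X in _ * (_ * X)](_ : _ = a%:E); last by rewrite -aE -jnT.
  rewrite fixup ?jple// [RHS]P1E//; congr (P2 _ + P1 _ + _).
  - by apply/seteqP; split => x /= => [[[? _] ?]//|[? ?]].
  - by apply/seteqP; split => x /= => [[[? _] ?]//|[? ?]].
have q02 A : measurable A -> q0 (setT `*` A) = P2 A.
  move=> mA; rewrite q0E; last exact: measurableX.
  rewrite product_measure1E// [X in _ * (X * _)]aE.
  rewrite [X in _ * X]muleC fixup ?jnle// [RHS]P2E//; congr (P2 _ + P1 _ + _).
  - by apply/seteqP; split => x /= => [[[_ ?] ?]//|[? ?]].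
  - by apply/seteqP; split => x /= => [[[_ ?] ?]//|[? ?]].
have q0T : q0 setT = 1.
  by rewrite -setXTT q01//; exact: probability_setT.
pose q : probability (T * T)%type R :=
  HB.pack (Measure.sort q0) (Measure_isProbability.Build _ _ _ q0 q0T).
exists q; split => // f F g h mf f0 fd F0 mg g0 mh h0 fF.
have -> : \int[q]_z f z = a^-1%:E * \int[jp]_x \int[jn]_y f (x, y).
  rewrite [LHS](ge0_integral_measure_add _ _ measurableT)//.
  rewrite pmI// (eq_integral (cst 0)); last first.
    by move=> x _; rewrite /= fd.
  by rewrite integral0 add0e ge0_integral_mscale// fubini_tonelli1.
have jpP1 A : measurable A -> jp A <= P1 A.
  by move=> mA; rewrite [leRHS]P1E// leeDr// adde_ge0.
have jnP2 A : measurable A -> jn A <= P2 A.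
  by move=> mA; rewrite [leRHS]P2E// leeDr// adde_ge0.
have jnT' : jn setT = a%:E by rewrite jnT aE.
have le1 x : \int[jn]_y f (x, y) <= (F%:E + g x) * a%:E + \int[P2]_y h y.
  apply: (@le_trans _ _ (\int[jn]_y ((F%:E + g x) + h y))).
    by apply: le_integral_ge0 => // y; exact: fF.
  rewrite ge0_integralD//; last first.
    by move=> y _; rewrite adde_ge0// lee_fin.
  have -> : \int[jn]_y (F%:E + g x) = (F%:E + g x) * a%:E.
    apply: eq_trans (integral_cst jn measurableT (F%:E + g x)) _.
    by congr (_ * _); exact: jnT'.
  rewrite leeD2l//.
  exact: ge0_le_measure_integral.
apply: (@le_trans _ _ (a^-1%:E * \int[jp]_x ((F%:E + g x) * a%:E + \int[P2]_y h y))).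
  apply: lee_wpmul2l; first by rewrite lee_fin.
  by apply: le_integral_ge0 => // x; exact: integral_ge0.
have [A0|a1] := eqVneq a 0%R.
  rewrite A0 invr0 mul0e; apply: adde_ge0; last exact: integral_ge0.
  apply: adde_ge0; last exact: integral_ge0.
  by rewrite lee_fin mulr_ge0//; exact: le_trans atau.
have mFg : measurable_fun setT (fun x => F%:E + g x) by exact: emeasurable_funD.
have Fg0 x : 0 <= F%:E + g x by rewrite adde_ge0// lee_fin.
have -> : \int[jp]_x ((F%:E + g x) * a%:E + \int[P2]_y h y) =
    a%:E * (\int[jp]_x (F%:E + g x) + \int[P2]_y h y).
  rewrite ge0_integralD//; last 3 first.
  - by move=> x _; rewrite mule_ge0// lee_fin.
  - exact: emeasurable_funM.
  - by move=> x _; exact: integral_ge0.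
  rewrite ge0_integralZr//.
  have -> : \int[jp]_x (\int[P2]_y h y) = a%:E * \int[P2]_y h y.
    apply: eq_trans (integral_cst jp measurableT _) _.
    by rewrite muleC; congr (_ * _).
  rewrite [RHS]ge0_muleDr; [|by apply: integral_ge0|by apply: integral_ge0].
  by congr (_ + _); exact: muleC.
rewrite muleA -EFinM mulVf// mul1e leeD2r// ge0_integralD//.
apply: leeD; last exact: ge0_le_measure_integral.
have -> : \int[jp]_x F%:E = (F * a)%:E.
  apply: eq_trans (integral_cst jp measurableT F%:E) _.
  by rewrite EFinM; congr (_ * _).
by rewrite lee_fin ler_wpM2l.
Qed.

End total_variation_coupling.

Section mean_distance.
Local Open Scope ereal_scope.
Context {R : realType}.
Implicit Types T : pmetricType R.

Lemma exists_prod d1 d2 (X : measurableType d1) (Y : measurableType d2)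
    (P : probability X R) (Q : probability Y R) :
  exists q : probability (X * Y)%type R,
  [/\ forall A, measurable A -> q (A `*` setT) = P A,
      forall A, measurable A -> q (setT `*` A) = Q A &
      forall f : X * Y -> \bar R, measurable_fun [set: X * Y] f ->
        (forall z, 0 <= f z) -> \int[q]_z f z = \int[P]_x \int[Q]_y f (x, y)].
Proof.
have mk : kernel_like (fun _ : X => Q) by move=> A mA; exact: measurable_cst.
have [q qE] := exists_kprod P mk; exists q.
have ind d (V : measurableType d) (mu : probability V R) A : measurable A ->
    mu A = \int[mu]_x (\1_A x)%:E.
  by move=> mA; rewrite integral_indic// setIT.
split => // A mA.
- have mA' : measurable (A `*` [set: Y]) by exact: measurableX.
  rewrite ind// qE//; last by apply/measurable_EFinP; exact: measurable_indic.
  rewrite ind//; apply: eq_integral => x _.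
  rewrite (eq_integral (cst (\1_A x)%:E)).
    by rewrite integral_cst// [X in _ * X]probability_setT mule1.
  by move=> y _; rewrite !indicE in_setX in_setT andbT.
- have mA' : measurable ([set: X] `*` A) by exact: measurableX.
  rewrite ind// qE//; last by apply/measurable_EFinP; exact: measurable_indic.
  rewrite (eq_integral (cst (Q A))).
    by rewrite integral_cst// [X in _ * X]probability_setT mule1.
  move=> x _; rewrite [RHS]ind//; apply: eq_integral => y _.
  by rewrite !indicE in_setX in_setT.
Qed.

Lemma measurable_mdist2 T : separable_space T ->
  measurable_fun setT (fun z : borel T * borel T => ((@mdist R T z.1 z.2) ^+ 2)%:E).
Proof.
move=> sT; apply/measurable_EFinP; apply: measurable_funX.
exact: measurable_mdist.
Qed.

Lemma measurable_mdistE T : separable_space T ->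
  measurable_fun setT (fun z : borel T * borel T => (@mdist R T z.1 z.2)%:E).
Proof. by move=> sT; apply/measurable_EFinP; exact: measurable_mdist. Qed.

Lemma measurable_mdist2l T (p : T) :
  measurable_fun setT (fun x : borel T => ((@mdist R T x p) ^+ 2)%:E).
Proof.
by apply/measurable_EFinP; apply: measurable_funX; exact: measurable_mdistl.
Qed.

Lemma le_half_add_sqr (k d : R) : (0 < k)%R ->
  (d <= k / 2 + k^-1 / 2 * d ^+ 2)%R.
Proof.
move=> k0; rewrite -(ler_pM2l k0) mulrDr !mulrA divff ?gt_eqF// mul1r.
by have := sqr_ge0 (k - d); rewrite expr2; nra.
Qed.

(** Cauchy-Schwarz, by integrating [d <= k / 2 + d ^+ 2 / (2 k)]. *)
Lemma mean_dist_le T (P Q : borel_probability T R) (k : R) :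
  separable_space T -> (0 < k)%R -> mutual_variance P Q <= (k ^+ 2)%:E ->
  \int[P]_x \int[Q]_y (@mdist R T x y)%:E <= k%:E.
Proof.
move=> sT k0 V.
have [q [_ _ qE]] := exists_prod P Q.
rewrite -(qE (fun z => (@mdist R T z.1 z.2)%:E)); last 2 first.
- exact: measurable_mdistE.
- by move=> z; rewrite lee_fin mdist_ge0.
apply: (@le_trans _ _ (\int[q]_z ((k / 2)%:E +
    (k^-1 / 2)%:E * ((@mdist R T z.1 z.2) ^+ 2)%:E))).
  apply: le_integral_ge0 => z; first by rewrite lee_fin mdist_ge0.
  by rewrite -EFinM -EFinD lee_fin le_half_add_sqr.
have k2 : (0 <= k^-1 / 2)%R by rewrite divr_ge0// invr_ge0 ltW.
have m2 := measurable_mdist2 sT.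
have d2_0 (z : borel T * borel T) : 0 <= ((@mdist R T z.1 z.2) ^+ 2)%:E.
  by rewrite lee_fin sqr_ge0.
rewrite integralDT//; last 3 first.
- by move=> z; rewrite lee_fin divr_ge0// ltW.
- exact: measurable_funeM.
- by move=> z; rewrite mule_ge0// lee_fin.
rewrite integral_cstT integralZT// qE//.
apply: (@le_trans _ _ ((k / 2)%:E + (k^-1 / 2)%:E * (k ^+ 2)%:E)).
  by rewrite leeD2l// lee_wpmul2l.
rewrite -EFinM -EFinD lee_fin expr2 mulrAC mulrA mulVf ?gt_eqF//; lra.
Qed.

End mean_distance.

(** * Flows with separable slices *)

Section regular_flows.
Local Open Scope ereal_scope.
Context {R : realType}.

(** The consequences of the axioms of a metric flow on which the comparison
    rests, for a flow whose slices are whole separable spaces. The factor [Theta]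
    is the ratio between the squares of distances and the times: it is the square
    of the scale when only distances are rescaled. *)
Record regular_flow (b Theta H : R) (c : R -> R) (Z : flow R) : Prop := {
  regular_separable : forall u, (u < b)%R -> separable_space (ambient Z u) ;
  regular_dirac : forall u (x : ambient Z u), (u < b)%R ->
    forall A : set (borel (ambient Z u)), measurable A ->
    hker Z x u A = \d_(x : borel (ambient Z u)) A ;
  regular_kernel : forall s u, (s <= u)%R -> (u < b)%R ->
    kernel_like (fun x : borel (ambient Z u) => hker Z (x : ambient Z u) s) ;
  regular_reproduction : forall t1 t2 t3, (t1 <= t2)%R -> (t2 <= t3)%R ->
    (t3 < b)%R -> forall x : ambient Z t3,
    forall A : set (borel (ambient Z t1)), measurable A ->
    hker Z x t1 A = \int[hker Z x t2]_y hker Z (y : ambient Z t2) t1 A ;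
  regular_variation : forall s u, (s < u)%R -> (u < b)%R ->
    forall x y : ambient Z u,
    forall A : set (borel (ambient Z s)), measurable A ->
    hker Z x s A <= hker Z y s A + (mdist x y / Num.sqrt (Theta * (u - s)))%:E ;
  regular_harnack : forall s u, (s < u)%R -> (u < b)%R ->
    forall x y : ambient Z u,
    forall (A : set (borel (ambient Z s))) (K : R), measurable A ->
    2^-1%:E <= hker Z x s A -> (mdist x y <= K * Num.sqrt (Theta * (u - s)))%R ->
    (c K)%:E <= hker Z y s A ;
  regular_concentrated : forall s u, (s <= u)%R -> (u < b)%R ->
    forall x y : ambient Z u,
    mutual_variance (hker Z x s) (hker Z y s) <=
      (mdist x y ^+ 2 + Theta * H * (u - s))%:E }.

Context (b Theta H : R) (c : R -> R) (Z : flow R).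
Hypothesis Theta0 : (0 < Theta)%R.
Hypothesis H0 : (0 <= H)%R.
Hypothesis rZ : regular_flow b Theta H c Z.

Local Notation prob t := (borel_probability (ambient Z t) R).

Definition evolves s u (P : prob u) (Q : prob s) :=
  forall A : set (borel (ambient Z s)), measurable A ->
  Q A = \int[P]_x hker Z (x : ambient Z u) s A.

Lemma integral_evolves s u (P : prob u) (Q : prob s) : (s <= u)%R -> (u < b)%R ->
  evolves P Q -> forall f : borel (ambient Z s) -> \bar R,
  measurable_fun setT f -> (forall y, 0 <= f y) ->
  \int[Q]_y f y = \int[P]_x \int[hker Z (x : ambient Z u) s]_y f y.
Proof.
by move=> su ub PQ f mf f0; apply: integral_mixture => //; exact: (regular_kernel rZ).
Qed.

Lemma evolves_kernel r s u (x : ambient Z u) : (r <= s)%R -> (s <= u)%R ->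
  (u < b)%R -> evolves (hker Z x s) (hker Z x r).
Proof. by move=> rs su ub A mA; exact: (regular_reproduction rZ). Qed.

Lemma mutual_varianceE (T : pmetricType R) (P Q : borel_probability T R) : mutual_variance P Q =
  \int[P]_x \int[Q]_y ((@mdist R T x y) ^+ 2)%:E.
Proof. by []. Qed.

Lemma measurable_mean2 (T : pmetricType R) (P : borel_probability T R) :
  separable_space T ->
  measurable_fun setT (fun y : borel T => \int[P]_x ((@mdist R T y x) ^+ 2)%:E).
Proof.
move=> sT; apply: (measurable_mean P
  (f := fun z : borel T * borel T => ((@mdist R T z.1 z.2) ^+ 2)%:E)).
  by move=> z; rewrite lee_fin sqr_ge0.
exact: measurable_mdist2.
Qed.

Lemma mean2_ge0 (T : pmetricType R) (P : borel_probability T R) (y : T) :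
  0 <= \int[P]_x ((@mdist R T y x) ^+ 2)%:E.
Proof. by apply: integral_ge0 => x _; rewrite lee_fin sqr_ge0. Qed.

Lemma integral_evolves2 s u (P P' : prob u) (Q Q' : prob s) :
  (s <= u)%R -> (u < b)%R -> evolves P Q -> evolves P' Q' ->
  forall f : borel (ambient Z s) * borel (ambient Z s) -> \bar R,
  measurable_fun setT f -> (forall z, 0 <= f z) ->
  \int[Q]_y \int[Q']_y' f (y, y') = \int[P]_x \int[P']_x'
    \int[hker Z (x : ambient Z u) s]_y \int[hker Z (x' : ambient Z u) s]_y' f (y, y').
Proof.
move=> su ub PQ PQ' f mf f0.
pose k (x : borel (ambient Z u)) := hker Z (x : ambient Z u) s.
have mk : kernel_like k by exact: regular_kernel rZ _ _ su ub.
have mQ' : kernel_like (fun _ : borel (ambient Z s) => Q').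
  by move=> A mA; exact: measurable_cst.
rewrite (integral_evolves su ub PQ); first last.
- by move=> y; apply: integral_ge0.
- exact: (measurable_kernel_integral mQ').
apply: eq_integral => x _.
pose g (z : borel (ambient Z s) * borel (ambient Z u)) :=
  \int[k z.2]_y' f (z.1, y').
have mg : measurable_fun setT g.
  have mk2 : kernel_like
      (fun z : borel (ambient Z s) * borel (ambient Z u) => k z.2).
    by move=> A mA; exact: (measurableT_comp (mk A mA) measurable_snd).
  apply: (measurable_kernel_integral mk2 (f := fun w => f (w.1.1, w.2))) => //.
  apply: (measurableT_comp mf); apply/measurable_fun_pair => /=.
    exact: (measurableT_comp measurable_fst measurable_fst).
  exact: measurable_snd.
have g0 z : 0 <= g z by exact: integral_ge0.
rewrite -[RHS](@fubini_tonelli _ _ _ _ _ (k x) P' g mg g0).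
apply: eq_integral => y _; rewrite (integral_evolves su ub PQ')//.
exact: (measurableT_comp mf (measurable_pair1 y)).
Qed.

Lemma evolves_dirac s u (y : ambient Z u) : (s <= u)%R -> (u < b)%R ->
  evolves (\d_(y : borel (ambient Z u)) : prob u) (hker Z y s).
Proof.
move=> su ub A mA; rewrite integral_dirac//; last first.
  exact: (regular_kernel rZ su ub mA).
by rewrite diracT mul1e.
Qed.

(** Concentration for the heat kernels at points passes to all measures by integrating
    over pairs of points. *)
Lemma variance_evolves s u (P P' : prob u) (Q Q' : prob s) : (s <= u)%R ->
  (u < b)%R -> evolves P Q -> evolves P' Q' ->
  mutual_variance Q Q' <= mutual_variance P P' + (Theta * H * (u - s))%:E.
Proof.
move=> su ub PQ PQ'.
have sb : (s < b)%R by exact: le_lt_trans ub.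
have sepu := regular_separable rZ ub; have seps := regular_separable rZ sb.
have k0 : (0 <= Theta * H * (u - s))%R.
  by rewrite !mulr_ge0// ?subr_ge0// ltW.
have [q [_ _ qE]] := exists_prod P P'.
have d0 (z : borel (ambient Z u) * borel (ambient Z u)) :
    0 <= ((@mdist R (ambient Z u) z.1 z.2) ^+ 2)%:E by rewrite lee_fin sqr_ge0.
have m2 := measurable_mdist2 sepu.
have -> : mutual_variance P P' + (Theta * H * (u - s))%:E = \int[P]_x \int[P']_x'
    (((@mdist R (ambient Z u) x x') ^+ 2)%:E + (Theta * H * (u - s))%:E).
  rewrite -(qE (fun z => ((@mdist R _ z.1 z.2) ^+ 2)%:E +
    (Theta * H * (u - s))%:E)).
  - rewrite (integralDT _ m2 d0)// integral_cstT; congr (_ + _).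
    by rewrite (qE (fun z => ((@mdist R _ z.1 z.2) ^+ 2)%:E)).
  - by apply: emeasurable_funD => //.
  - by move=> z; rewrite adde_ge0// lee_fin.
rewrite mutual_varianceE (integral_evolves2 su ub PQ PQ'
  (f := fun z => ((@mdist R _ z.1 z.2) ^+ 2)%:E)); last 2 first.
- exact: measurable_mdist2.
- by move=> z; rewrite lee_fin sqr_ge0.
apply: le_integral_ge0 => x.
  apply: integral_ge0 => x' _; apply: integral_ge0 => y _.
  by apply: integral_ge0 => y' _; rewrite lee_fin sqr_ge0.
apply: le_integral_ge0 => x'.
  by apply: integral_ge0 => y _; apply: integral_ge0 => y' _; rewrite lee_fin sqr_ge0.
exact: regular_concentrated rZ _ _ su ub x x'.
Qed.

End regular_flows.

(** * Equicontinuity of heat kernels *)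

Section kernel_coupling.
Local Open Scope ereal_scope.
Context {R : realType} (b Theta H : R) (c : R -> R) (Z : flow R).
Hypothesis Theta0 : (0 < Theta)%R.
Hypothesis H0 : (0 <= H)%R.
Hypothesis rZ : regular_flow b Theta H c Z.

Local Notation prob t := (borel_probability (ambient Z t) R).

Lemma mdist_sqr_split (T : pmetricType R) (p x y : T) (K : R) : (0 < K)%R ->
  (mdist x y <= K / 2 + K^-1 * mdist p x ^+ 2 + K^-1 * mdist p y ^+ 2)%R.
Proof.
move=> K0; apply: le_trans (le_half_add_sqr _ K0) _.
have Ki : (0 <= K^-1)%R by rewrite invr_ge0 ltW.
rewrite -addrA lerD2l -mulrDr -mulrA ler_wpM2l//.
have := mdist_tri p x y; rewrite (mdistC x p) => h.
have d2 : (mdist x y ^+ 2 <= (mdist p x + mdist p y) ^+ 2)%R.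
  by rewrite ler_pXn2r// nnegrE ?addr_ge0 ?mdist_ge0.
rewrite sqrrD in d2; have := sqr_ge0 (mdist p x - mdist p y); rewrite sqrrB.
by lra.
Qed.

(** The bound for the distance between the heat kernels at two points at distance [d]:
    [h + d] for short times, and for times above [r] a total variation of
    [d / Num.sqrt r], which a coupling pays at distances up to about [K], plus the cost
    of the points that lie farther away. *)
Definition modulus (h r K L d : R) : R :=
  (h + d + (K / 2 * (d / Num.sqrt r) + (d ^+ 2 + L) / K))%R.

Lemma modulus_ge (h r K L d : R) : (0 <= h)%R -> (0 < K)%R -> (0 <= L)%R ->
  (0 <= d)%R -> [/\ (0 <= modulus h r K L d)%R, (d + h <= modulus h r K L d)%R,
    (d / Num.sqrt r <= 2 / K * modulus h r K L d)%R &
    (d ^+ 2 <= K * modulus h r K L d)%R].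
Proof.
move=> h0 K0 L0 d0; have Ki : (0 < K^-1)%R by rewrite invr_gt0.
have e0 : (0 <= d / Num.sqrt r)%R by rewrite divr_ge0// sqrtr_ge0.
have e1 : (0 <= K / 2 * (d / Num.sqrt r))%R by rewrite mulr_ge0// divr_ge0// ltW.
have e2 : (0 <= (d ^+ 2 + L) / K)%R by rewrite divr_ge0 ?addr_ge0 ?sqr_ge0// ltW.
rewrite /modulus; split; [lra|lra| |].
  have E : (d / Num.sqrt r = 2 / K * (K / 2 * (d / Num.sqrt r)))%R.
    by rewrite [RHS]mulrA -(invf_div 2 K) mulfV ?mul1r// gt_eqF// divr_gt0.
  have K2 : (0 <= 2 / K)%R by rewrite divr_ge0// ltW.
  by rewrite {1}E ler_wpM2l//; lra.
have E : (d ^+ 2 = K * (d ^+ 2 / K))%R by rewrite mulrC divfK// gt_eqF.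
rewrite {1}E; apply: ler_wpM2l; [exact: ltW|move: e2; rewrite !mulrDl].
have : (0 <= L / K)%R by rewrite divr_ge0// ltW.
by lra.
Qed.

Lemma measurable_modulus (T : pmetricType R) (h r K L : R) (y : T) :
  measurable_fun setT (fun x : borel T => (modulus h r K L (@mdist R T x y))%:E).
Proof.
apply/measurable_EFinP; have md := measurable_mdistl y.
rewrite /modulus; apply: measurable_funD; first exact: measurable_funD.
apply: measurable_funD; first by do 2 apply: measurable_funM => //.
by apply: measurable_funM => //; apply: measurable_funD => //; exact: measurable_funX.
Qed.

(** Either [u - s] is so small that both measures are concentrated near their
    centres at scale [h], and the independent coupling is good enough; or it is
    not, and then heat kernel measures based at nearby points are close in total
    variation. *)
Lemma kernel_coupling s u (alpha : prob u) (y : ambient Z u) (Q : prob s)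
    (h r K T : R) : (s <= u)%R -> (u < b)%R -> evolves alpha Q ->
  (0 < h)%R -> (0 < r)%R -> (0 < K)%R -> (H * r <= h ^+ 2)%R ->
  (Theta * (u - s) <= T)%R ->
  exists q, coupling Q (hker Z y s) q /\
    \int[q]_z (@mdist R (ambient Z s) z.1 z.2)%:E <=
    \int[alpha]_x (modulus h r K (2 * H * T + 1) (@mdist R (ambient Z u) x y))%:E.
Proof.
move=> su ub aQ h0 r0 K0 Hr uT.
have sb : (s < b)%R by exact: le_lt_trans ub.
have sepu := regular_separable rZ ub; have seps := regular_separable rZ sb.
set nu := hker Z y s; set L := (2 * H * T + 1)%R.
have us0 : (0 <= Theta * (u - s))%R by rewrite mulr_ge0 ?subr_ge0// ltW.
have T0 : (0 <= T)%R by exact: le_trans uT.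
have L0 : (0 <= L)%R by rewrite addr_ge0// !mulr_ge0.
have modP (x : ambient Z u) := @modulus_ge h r K L (mdist x y) (ltW h0) K0 L0 (mdist_ge0 x y).
have mod0 (x : ambient Z u) : 0 <= (modulus h r K L (mdist x y))%:E.
  by rewrite lee_fin; case: (modP x).
have mmod := @measurable_modulus (ambient Z u) h r K L y.
set C := \int[alpha]_x _.
have [q [q1 q2 qE]] := exists_prod Q nu.
have mds := measurable_mdistE seps.
have ds0 (z : borel (ambient Z s) * borel (ambient Z s)) :
    0 <= (@mdist R (ambient Z s) z.1 z.2)%:E by rewrite lee_fin mdist_ge0.
have conc (x : ambient Z u) : mutual_variance (hker Z x s) nu <=
    (mdist x y ^+ 2 + Theta * H * (u - s))%:E.
  exact: regular_concentrated rZ _ _ su ub x y.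
have [near|far] := leP (Theta * (u - s))%R r.
  exists q; split=> //; rewrite qE//.
  rewrite (integral_evolves rZ su ub aQ (f := fun y0 => \int[nu]_y1
    (@mdist R (ambient Z s) y0 y1)%:E)); first last.
  - by move=> z; apply: integral_ge0 => z' _; exact: (ds0 (z, z')).
  - exact: (measurable_mean nu ds0 mds).
  apply: le_integral_ge0 => x.
    by apply: integral_ge0 => z _; apply: integral_ge0 => z' _; exact: (ds0 (z, z')).
  have k0 : (0 < mdist (x : ambient Z u) y + h)%R by rewrite ltr_wpDl// mdist_ge0.
  apply: (@le_trans _ _ (mdist (x : ambient Z u) y + h)%:E); last first.
    by rewrite lee_fin; case: (modP x).
  apply: mean_dist_le => //; apply: le_trans (conc _) _.
  rewrite lee_fin sqrrD -[leRHS]addrA lerD2l.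
  have : (Theta * H * (u - s) <= H * r)%R.
    by rewrite [(Theta * H)%R]mulrC -mulrA ler_wpM2l.
  have : (0 <= mdist (x : ambient Z u) y * h *+ 2)%R.
    by rewrite mulrn_wge0// mulr_ge0// ?mdist_ge0// ltW.
  by lra.
have [Coo|] := eqVneq C +oo; first by exists q; split => //; rewrite Coo leey.
rewrite -ltey => Cfin.
have lt_su : (s < u)%R.
  by rewrite -subr_gt0 -(pmulr_rgt0 _ Theta0); exact: lt_trans far.
have mdu := measurable_mdistl y.
have mdr : measurable_fun setT (fun x : borel (ambient Z u) =>
    (@mdist R (ambient Z u) x y / Num.sqrt r)%:E).
  by apply/measurable_EFinP; apply: measurable_funM.
have mdu2 := measurable_mdist2l y.
have dr0 (x : borel (ambient Z u)) : 0 <= (@mdist R (ambient Z u) x y / Num.sqrt r)%:E.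
  by rewrite lee_fin divr_ge0 ?mdist_ge0 ?sqrtr_ge0.
have du20 (x : borel (ambient Z u)) : 0 <= ((@mdist R (ambient Z u) x y) ^+ 2)%:E.
  by rewrite lee_fin sqr_ge0.
pose A := \int[alpha]_x (@mdist R (ambient Z u) x y / Num.sqrt r)%:E.
pose B := \int[alpha]_x ((@mdist R (ambient Z u) x y) ^+ 2)%:E.
have A0 : 0 <= A by exact: integral_ge0.
have B0 : 0 <= B by exact: integral_ge0.
have K2 : (0 <= 2 / K)%R by rewrite divr_ge0// ltW.
have K1 : (0 <= K)%R by exact: ltW.
have Afin : A \is a fin_num.
  rewrite ge0_fin_numE//; apply: (@le_lt_trans _ _ ((2 / K)%:E * C)).
    rewrite -integralZT//.
    by apply: le_integral_ge0 => // x; rewrite -EFinM lee_fin; case: (modP x).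
  by rewrite lte_mul_pinfty// lee_fin.
have Bfin : B \is a fin_num.
  rewrite ge0_fin_numE//; apply: (@le_lt_trans _ _ (K%:E * C)).
    rewrite -integralZT//.
    by apply: le_integral_ge0 => // x; rewrite -EFinM lee_fin; case: (modP x).
  by rewrite lte_mul_pinfty// lee_fin.
have tv (U : set (borel (ambient Z s))) : measurable U ->
    Q U <= nu U + (fine A)%:E.
  move=> mU; rewrite fineK// aQ//.
  have -> : nu U + A = \int[alpha]_x (nu U + (mdist (x : ambient Z u) y / Num.sqrt r)%:E).
    by rewrite integralDT// integral_cstT.
  apply: le_integral_ge0 => x; first exact: measure_ge0.
  apply: le_trans (regular_variation rZ lt_su ub _ y mU) _.
  rewrite leeD2l// lee_fin ler_wpM2l ?mdist_ge0// lef_pV2 ?posrE ?sqrtr_gt0//.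
    by rewrite ler_sqrt ltW// (lt_trans r0).
  exact: lt_trans far.
have [q' [q'1 q'2 q'E]] := total_variation_coupling tv.
exists q'; split=> //.
have dird : evolves (\d_(y : borel (ambient Z u)) : prob u) nu.
  exact: (evolves_dirac rZ y su ub).
have V1 : mutual_variance nu Q <= B + (Theta * H * (u - s))%:E.
  apply: le_trans (variance_evolves Theta0 H0 rZ su ub dird aQ) _.
  rewrite leeD2r// mutual_varianceE integral_dirac//; last first.
    exact: measurable_mean2.
  rewrite diracT mul1e le_eqVlt; apply/orP; left; apply/eqP.
  by apply: eq_integral => x _; rewrite mdistC.
have V2 : mutual_variance nu nu <= (Theta * H * (u - s))%:E.
  by apply: le_trans (conc _) _; rewrite mdistxx expr0n add0r.
pose f (p : borel (ambient Z s)) := \int[nu]_x ((@mdist R (ambient Z s) p x) ^+ 2)%:E +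
   \int[Q]_x ((@mdist R (ambient Z s) p x) ^+ 2)%:E.
have mm (P : prob s) : measurable_fun setT (fun p : borel (ambient Z s) =>
    \int[P]_x ((@mdist R (ambient Z s) p x) ^+ 2)%:E).
  exact: measurable_mean2.
have mm0 (P : prob s) (p : borel (ambient Z s)) :
    0 <= \int[P]_x ((@mdist R (ambient Z s) p x) ^+ 2)%:E.
  by apply: integral_ge0 => x _; rewrite lee_fin sqr_ge0.
have [p fp] : exists p, f p < B + L%:E.
  apply: (exists_le_integral (P := nu)); first by move=> p; rewrite adde_ge0.
  rewrite /f integralDT//.
  apply: (@le_lt_trans _ _ (B + (2 * H * T)%:E)).
    apply: (@le_trans _ _ ((Theta * H * (u - s))%:E + (B + (Theta * H * (u - s))%:E))).
      exact: leeD.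
    rewrite addeCA leeD2l// -EFinD lee_fin.
    have HT : (Theta * H * (u - s) <= H * T)%R.
      by rewrite [(Theta * H)%R]mulrC -mulrA ler_wpM2l.
    by rewrite -[leRHS]mulrA mulr_natl mulr2n; exact: lerD.
  by rewrite -(fineK Bfin) -!EFinD lte_fin ltrD2l /L ltrDl.
have mps : measurable_fun setT (fun x : borel (ambient Z s) =>
    K^-1%:E * ((@mdist R (ambient Z s) p x) ^+ 2)%:E).
  apply: measurable_funeM; rewrite (_ : (fun x => _) = (fun x : borel (ambient Z s) =>
    ((@mdist R (ambient Z s) x p) ^+ 2)%:E)); first exact: measurable_mdist2l.
  by apply/funext => x; rewrite mdistC.
have ps0 (x : borel (ambient Z s)) : 0 <= K^-1%:E * ((@mdist R (ambient Z s) p x) ^+ 2)%:E.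
  by rewrite -EFinM lee_fin mulr_ge0 ?sqr_ge0// invr_ge0 ltW.
apply: le_trans (q'E _ (K / 2)%R _ _ mds ds0 _ _ mps ps0 mps ps0 _) _.
- by move=> x; rewrite mdistxx.
- by rewrite divr_ge0// ltW.
- by move=> x x'; rewrite -!EFinM -!EFinD lee_fin; exact: mdist_sqr_split.
have sq0 (x : borel (ambient Z s)) : 0 <= ((@mdist R (ambient Z s) p x) ^+ 2)%:E.
  by rewrite lee_fin sqr_ge0.
have msq : measurable_fun setT (fun x : borel (ambient Z s) =>
    ((@mdist R (ambient Z s) p x) ^+ 2)%:E).
  rewrite (_ : (fun x => _) = (fun x : borel (ambient Z s) =>
    ((@mdist R (ambient Z s) x p) ^+ 2)%:E)); first exact: measurable_mdist2l.
  by apply/funext => x; rewrite mdistC.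
have Ki : (0 <= K^-1)%R by rewrite invr_ge0 ltW.
rewrite !integralZT// -addeA -ge0_muleDr//; [|exact: mm0|exact: mm0].
rewrite EFinM fineK//.
apply: (@le_trans _ _ ((K / 2)%:E * A + K^-1%:E * (B + L%:E))).
  apply: leeD2l; apply: lee_wpmul2l; first by rewrite lee_fin.
  by have := ltW fp; rewrite /f [X in X <= _]addeC.
have K20 : (0 <= K / 2)%R by rewrite divr_ge0// ltW.
rewrite /A /B -[L%:E](integral_cstT alpha) -integralDT//.
have mdL : measurable_fun setT (fun x : borel (ambient Z u) =>
    ((@mdist R (ambient Z u) x y) ^+ 2)%:E + L%:E) by exact: emeasurable_funD.
have dL0 (x : borel (ambient Z u)) :
    0 <= ((@mdist R (ambient Z u) x y) ^+ 2)%:E + L%:E.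
  by rewrite adde_ge0// lee_fin.
rewrite -!integralZT// -integralDT//; last 4 first.
- by apply: measurable_funeM.
- by move=> x; rewrite mule_ge0.
- by apply: measurable_funeM.
- by move=> x; rewrite mule_ge0.
apply: le_integral_ge0 => x; first by rewrite adde_ge0// mule_ge0.
rewrite -!EFinM -!EFinD lee_fin /modulus [(K^-1 * _)%R]mulrC lerDr.
by rewrite addr_ge0 ?mdist_ge0// ltW.
Qed.

End kernel_coupling.

(** * Bridges and almost isometries *)

Section bridge.
Context {R : realType}.
Implicit Types X Y : pmetricType R.

(** The distance between points of two spaces when the pairs of a relation are
    declared to be at distance [eta] of each other. *)
Definition bridge X Y (rel : X -> Y -> Prop) (eta : R) (x : X) (y : Y) : R :=
  inf [set r | exists x' y', rel x' y' /\ r = mdist x x' + eta + mdist y' y].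

Definition almost_isometry X Y (rel : X -> Y -> Prop) (eta : R) :=
  [/\ 0 < eta, exists x y, rel x y &
    forall x y x' y', rel x y -> rel x' y' ->
      `|mdist x x' - mdist y y'| <= 2 * eta].

Section bridge_theory.
Context X Y (rel : X -> Y -> Prop) (eta : R).
Hypothesis arel : almost_isometry rel eta.
Local Notation B := (bridge rel eta).

Let bridge_has_inf x y : has_inf
  [set r | exists x' y', rel x' y' /\ r = mdist x x' + eta + mdist y' y].
Proof.
have [eta0 [x0 [y0 r0]] _] := arel; split.
  by exists (mdist x x0 + eta + mdist y0 y), x0, y0.
exists 0 => _ [x' [y' [_ ->]]].
by rewrite !addr_ge0 ?mdist_ge0// ltW.
Qed.

Lemma bridge_le x y x' y' : rel x' y' -> B x y <= mdist x x' + eta + mdist y' y.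
Proof.
move=> r'; apply: ge_inf; first by have [] := bridge_has_inf x y.
by exists x', y'.
Qed.

Lemma bridge_ge x y m :
  (forall x' y', rel x' y' -> m <= mdist x x' + eta + mdist y' y) -> m <= B x y.
Proof.
move=> h; apply: lb_le_inf; first by have [] := bridge_has_inf x y.
by move=> _ [x' [y' [r' ->]]]; exact: h.
Qed.

Lemma bridge_gt0 x y : 0 < B x y.
Proof.
have [eta0 _ _] := arel; apply: lt_le_trans eta0 _; apply: bridge_ge => x' y' _.
by have := mdist_ge0 x x'; have := mdist_ge0 y' y; lra.
Qed.

Lemma bridge_lip x x' y y' : B x y <= mdist x x' + B x' y' + mdist y' y.
Proof.
rewrite addrC -lerBlDl -lerBlDl; apply: bridge_ge => x1 y1 r1.
have := bridge_le x y r1; have := mdist_tri x' x x1; have := mdist_tri y' y1 y.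
by lra.
Qed.

Lemma bridge_lipl x x' y : B x y <= mdist x x' + B x' y.
Proof. by have := bridge_lip x x' y y; rewrite mdistxx addr0. Qed.

Lemma bridge_lipr x y y' : B x y <= B x y' + mdist y' y.
Proof. by have := bridge_lip x x y y'; rewrite mdistxx add0r. Qed.

Lemma bridge_tril x x' y : mdist x x' <= B x y + B x' y.
Proof.
have [_ _ h] := arel.
rewrite -lerBlDl; apply: bridge_ge => x2 y2 r2; rewrite lerBlDl -lerBlDr.
apply: bridge_ge => x1 y1 r1.
have := h _ _ _ _ r1 r2; rewrite ler_norml => /andP[_ d12].
have := mdist_tri x1 x x'; have := mdist_tri x2 x1 x'; have := mdist_tri y y1 y2.
by rewrite (mdistC x' x2) (mdistC y y2); lra.
Qed.

Lemma bridge_trir x y y' : mdist y y' <= B x y + B x y'.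
Proof.
have [_ _ h] := arel.
rewrite -lerBlDl; apply: bridge_ge => x2 y2 r2; rewrite lerBlDl -lerBlDr.
apply: bridge_ge => x1 y1 r1.
have := h _ _ _ _ r1 r2; rewrite ler_norml => /andP[d12 _].
have := mdist_tri y1 y y'; have := mdist_tri y2 y1 y'; have := mdist_tri x x1 x2.
by rewrite (mdistC y y1) (mdistC x1 x); lra.
Qed.

Lemma measurable_bridge : separable_space X ->
  measurable_fun setT (fun z : borel X * borel Y => (B z.1 z.2)%:E).
Proof.
move=> sX; apply/measurable_EFinP; apply: measurable_lip2 => //.
  exact: bridge_lipl.
exact: bridge_lipr.
Qed.

End bridge_theory.

Local Open Scope ereal_scope.

Lemma mul_measure_le_integral d (T : measurableType d)
    (mu : {measure set T -> \bar R}) (f : T -> \bar R) (A : set T) (t : R) :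
  measurable A -> (0 <= t)%R -> (forall x, 0 <= f x) ->
  (forall x, A x -> t%:E <= f x) -> t%:E * mu A <= \int[mu]_x f x.
Proof.
move=> mA t0 f0 tf; rewrite -integral_indicT//.
have i0 x : 0 <= (\1_A x : R)%:E by rewrite lee_fin.
rewrite -(integralZT _ t0 (measurable_indicE mA) i0).
apply: le_integral_ge0 => x; first by rewrite mule_ge0// lee_fin.
rewrite indicE; case: (boolP (x \in A)) => [/[!inE]/tf|]; first by rewrite mule1.
by rewrite mule0.
Qed.

(** Two measured spaces whose distances agree in mean under a coupling are close
    in the sense of Gromov and Prokhorov, provided that most balls of radius
    [eta] have mass at least [m]. Without such a lower bound this fails: [n] and
    [2 n] points at mutual distance 1 have almost the same distribution of
    distances. *)
Lemma exists_almost_isometry X Y (P : borel_probability X R)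
    (Q : probability (borel X * borel Y)%type R) (eta m delta C k : R) :
  separable_space X -> separable_space Y ->
  (forall A : set (borel X), measurable A -> Q (A `*` setT) = P A) ->
  (0 < eta)%R -> (eta <= 4^-1)%R -> (0 < m)%R -> (0 < k)%R ->
  (delta <= eta * (eta * m / 2))%R ->
  \int[Q]_z \int[Q]_z' (`|@mdist R X z.1 z'.1 - @mdist R Y z.2 z'.2|)%:E
    <= delta%:E ->
  P [set x | P [set x' | (@mdist R X x x' < eta)%R] < m%:E] <= eta%:E ->
  \int[Q]_z \int[Q]_z' ((@mdist R X z.1 z'.1) ^+ 2 + (@mdist R Y z.2 z'.2) ^+ 2)%:E
    <= C%:E ->
  exists rel, almost_isometry rel (2 * eta)%R /\
    \int[Q]_z (bridge rel (2 * eta) (z.1 : X) (z.2 : Y))%:E <=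
      (2 * eta + k * (2 * eta) + k^-1 * (2 * C + 1))%:E.
Proof.
move=> sX sY QP eta0 eta4 m0 k0 hdelta hE hP hV.
pose W := (borel X * borel Y)%type.
have mdX : measurable_fun setT (fun v : W * W => @mdist R X v.1.1 v.2.1).
  have mg : measurable_fun setT (fun v : W * W => (v.1.1, v.2.1)).
    apply/measurable_fun_pair => /=.
      exact: (measurableT_comp measurable_fst measurable_fst).
    exact: (measurableT_comp measurable_fst measurable_snd).
  exact: (measurableT_comp (measurable_mdist sX) mg).
have mdY : measurable_fun setT (fun v : W * W => @mdist R Y v.1.2 v.2.2).
  have mg : measurable_fun setT (fun v : W * W => (v.1.2, v.2.2)).
    apply/measurable_fun_pair => /=.
      exact: (measurableT_comp measurable_snd measurable_fst).
    exact: (measurableT_comp measurable_snd measurable_snd).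
  exact: (measurableT_comp (measurable_mdist sY) mg).
pose dis (v : W * W) : \bar R :=
  (`|@mdist R X v.1.1 v.2.1 - @mdist R Y v.1.2 v.2.2|)%:E.
pose sq (v : W * W) : \bar R :=
  ((@mdist R X v.1.1 v.2.1) ^+ 2 + (@mdist R Y v.1.2 v.2.2) ^+ 2)%:E.
have mdis : measurable_fun setT dis.
  have mB := measurable_funB mdX mdY.
  by apply/measurable_EFinP; exact: (measurableT_comp (@normr_measurable R setT) mB).
have msq : measurable_fun setT sq.
  by apply/measurable_EFinP; apply: measurable_funD; exact: measurable_funX.
have dis0 v : 0 <= dis v by rewrite lee_fin.
have sq0 v : 0 <= sq v by rewrite lee_fin addr_ge0// sqr_ge0.
pose E (z : W) := \int[Q]_z' dis (z, z').
pose D (z : W) := \int[Q]_z' sq (z, z').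
have mE : measurable_fun setT E by exact: (measurable_mean Q dis0 mdis).
have mD : measurable_fun setT D by exact: (measurable_mean Q sq0 msq).
have E0 z : 0 <= E z by exact: integral_ge0.
have D0 z : 0 <= D z by exact: integral_ge0.
pose bal (x : X) : set (borel X) := [set x' | (@mdist R X x x' < eta)%R].
have mbal x : measurable (bal x).
  have := measurable_mdistl x measurableT (measurable_itv `]-oo, eta[).
  by rewrite setTI; congr measurable; apply/seteqP; split => y /=;
    rewrite in_itv /= mdistC.
have mP : measurable_fun setT (fun x : borel X => P (bal x)).
  rewrite (_ : (fun x => _) = (fun x : borel X => \int[P]_x'
    (\1_[set v : borel X * borel X | (@mdist R X v.1 v.2 < eta)%R] (x, x'))%:E)).
    apply: (measurable_mean P (f := fun v => (\1_[set v : borel X * borel X |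
      (@mdist R X v.1 v.2 < eta)%R] v)%:E)); first by move=> z; rewrite lee_fin.
    apply: measurable_indicE.
    by have := measurable_mdist sX measurableT (measurable_itv `]-oo, eta[);
      rewrite setTI.
  apply/funext => x; transitivity (\int[P]_x' (\1_(bal x) x')%:E).
    by rewrite integral_indicT.
  by apply: eq_integral => x' _; rewrite !indicE; congr (_%:R%:E);
    congr nat_of_bool; apply/idP/idP; rewrite !inE.
pose bad1 : set W := [set z | (eta * m / 2)%:E < E z].
pose bad2 : set W := [set z | P (bal z.1) < m%:E].
(* Pairs are related when they are typical for the coupling: distances from [x] and
   from [y] agree in mean, and [x] does not lie in a thin part of the space. *)
pose rel (x : X) (y : Y) := E (x, y) <= (eta * m / 2)%:E /\ m%:E <= P (bal x).
have mbad1 : measurable bad1.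
  by have := mE measurableT _ (emeasurable_itv `](eta * m / 2)%:E, +oo[);
    rewrite setTI; congr measurable; apply/seteqP; split => z /=;
    rewrite in_itv /= andbT.
have mbad2X : measurable [set x : borel X | P (bal x) < m%:E].
  by have := mP measurableT _ (emeasurable_itv `]-oo, m%:E[);
    rewrite setTI; congr measurable; apply/seteqP; split => z /=;
    rewrite in_itv.
have bad2E : bad2 = [set x : borel X | P (bal x) < m%:E] `*` setT.
  by apply/seteqP; split => [z//|z []].
have mbad2 : measurable bad2 by rewrite bad2E; exact: measurableX.
have t0 : (0 < eta * m / 2)%R by rewrite divr_gt0// mulr_gt0.
have Qbad1 : Q bad1 <= eta%:E.
  rewrite -(@lee_pmul2l _ (eta * m / 2)%:E)//.
  apply: le_trans (mul_measure_le_integral Q mbad1 (ltW t0) E0 _) _.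
    by move=> z /ltW.
  by apply: le_trans hE _; rewrite -EFinM lee_fin mulrC.
have Qbad2 : Q bad2 <= eta%:E by rewrite bad2E QP.
pose bad := bad1 `|` bad2.
have mbad : measurable bad by exact: measurableU.
have relP z : ~ bad z -> rel z.1 z.2.
  case: z => x y /not_orP[/negP b1 /negP b2].
  by split; rewrite leNgt.
have Qbad : Q bad <= (2 * eta)%:E.
  apply: (@le_trans _ _ (Q bad1 + Q bad2)); first exact: measureU2.
  by rewrite mulr_natl mulr2n EFinD; exact: leeD.
have C0 : (0 <= C)%R.
  by rewrite -lee_fin; apply: le_trans hV; apply: integral_ge0 => z _; exact: D0.
have Qgood : 2^-1%:E <= Q (~` bad).
  rewrite (probability_setC Q mbad).
  have : Q bad \is a fin_num by exact: fin_num_measure.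
  move: Qbad; case: (Q bad) => // r; rewrite lee_fin => rle _.
  by rewrite -EFinB lee_fin; lra.
have mgood : measurable (~` bad) by exact: measurableC.
(* A centre [zs] in the good set controls the bridge at the bad pairs. *)
have [zs [bs Ds]] : exists z, ~ bad z /\ D z <= (2 * C + 1)%:E.
  apply: contrapT => /forallNP h.
  have C20 : (0 <= 2 * C + 1)%R by lra.
  have : (2 * C + 1)%:E * Q (~` bad) <= C%:E.
    apply: le_trans (mul_measure_le_integral Q mgood C20 D0 _) hV.
    by move=> z bz; have /not_andP[//|/negP] := h z; rewrite -ltNge => /ltW.
  apply/negP; rewrite -ltNge; apply: lt_le_trans (lee_wpmul2l _ Qgood).
    by rewrite -EFinM lte_fin; lra.
  by rewrite lee_fin.
have rels := relP _ bs.
have arel : almost_isometry rel (2 * eta).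
  split; [by rewrite mulr_gt0|by exists zs.1, zs.2|].
  move=> x1 y1 x2 y2 [e1 b1] [e2 b2].
  have mB : measurable (bal x2 `*` [set: borel Y]) by exact: measurableX.
  have QB : m%:E <= Q (bal x2 `*` setT) by rewrite QP.
  pose f (z' : W) := dis ((x1, y1), z') + dis ((x2, y2), z').
  have mdz z : measurable_fun setT (fun z' => dis (z, z')).
    exact: (measurableT_comp mdis (measurable_pair1 z)).
  have If : \int[Q]_z' f z' <= (eta * m)%:E.
    rewrite integralDT//; apply: le_trans (leeD e1 e2) _.
    by rewrite -EFinD lee_fin; lra.
  have f0 z' : 0 <= f z' by rewrite adde_ge0.
  (* Both distortions are small at some point of the ball around [x2], whose mass is
     at least [m]. *)
  have [z' [Bz' fz']] : exists z', (bal x2 `*` setT) z' /\ f z' <= (2 * eta)%:E.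
    apply: contrapT => /forallNP h.
    have et0 : (0 <= 2 * eta)%R by lra.
    have : (2 * eta)%:E * Q (bal x2 `*` setT) <= (eta * m)%:E.
      apply: le_trans (mul_measure_le_integral Q mB et0 f0 _) If.
      by move=> z bz; have /not_andP[//|/negP] := h z; rewrite -ltNge => /ltW.
    apply/negP; rewrite -ltNge; apply: lt_le_trans (lee_wpmul2l _ QB).
      rewrite -EFinM lte_fin; have := mulr_gt0 eta0 m0; lra.
    by rewrite lee_fin.
  have [Bx _] : (mdist x2 (z'.1 : X) < eta)%R /\ True by case: Bz'.
  move: fz'; rewrite /f /dis -EFinD lee_fin /=.
  have := mdist_tri (z'.1 : X) x1 x2; have := mdist_tri x2 x1 (z'.1 : X).
  have := mdist_tri (z'.2 : Y) y1 y2; have := mdist_tri y2 y1 (z'.2 : Y).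
  rewrite (mdistC (z'.1 : X) x2) (mdistC (z'.2 : Y) y2).
  move: (mdist x1 z'.1) (mdist y1 z'.2) (mdist x2 z'.1) (mdist y2 z'.2) Bx.
  move: (mdist x1 x2) (mdist y1 y2) => a b' p1 r1 p2 r2 Bx t1 t2 t3 t4.
  have := ler_norm (p1 - r1); have := ler_norm (p2 - r2).
  have := lerNnormlW (lexx `|p1 - r1|%R); have := lerNnormlW (lexx `|p2 - r2|%R).
  clear - Bx t1 t2 t3 t4; rewrite ler_norml; lra.
exists rel; split => //.
have b0 (z : W) : 0 <= (bridge rel (2 * eta) (z.1 : X) (z.2 : Y))%:E.
  by rewrite lee_fin ltW// bridge_gt0.
pose S (z : W) := (k^-1)%:E * sq (zs, z).
have msz : measurable_fun setT (fun z => sq (zs, z)).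
  exact: (measurableT_comp msq (measurable_pair1 zs)).
have Ki : (0 <= k^-1)%R by rewrite invr_ge0 ltW.
have S0 z : 0 <= S z by rewrite mule_ge0.
have mS : measurable_fun setT S by exact: measurable_funeM.
have ind0 (z : W) : 0 <= (\1_bad z : R)%:E by rewrite lee_fin.
have mind := measurable_indicE mbad (R := R).
have mkind : measurable_fun setT (fun z => k%:E * (\1_bad z)%:E) by exact: measurable_funeM.
have kind0 (z : W) : 0 <= k%:E * (\1_bad z)%:E.
  by rewrite mule_ge0// lee_fin ltW.
apply: (@le_trans _ _ (\int[Q]_z ((2 * eta)%:E + (k%:E * (\1_bad z)%:E + S z)))).
  apply: le_integral_ge0 => // z; case: (pselect (bad z)) => [bz|/relP rz].
    rewrite indicE mem_set// mule1 /S /sq -EFinM -!EFinD lee_fin.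
    have := bridge_le arel (z.1 : X) (z.2 : Y) rels.
    rewrite (mdistC (z.1 : X)) mulrDr.
    have := le_half_add_sqr (@mdist R X zs.1 z.1) k0.
    have := le_half_add_sqr (@mdist R Y zs.2 z.2) k0.
    have := mulr_ge0 Ki (sqr_ge0 (@mdist R X zs.1 z.1)).
    have := mulr_ge0 Ki (sqr_ge0 (@mdist R Y zs.2 z.2)).
    by clear; rewrite ![(k^-1 / 2 * _)%R]mulrAC /=; lra.
  apply: (@le_trans _ _ (2 * eta)%:E); last by rewrite leeDl// adde_ge0.
  rewrite lee_fin; have := bridge_le arel (z.1 : X) (z.2 : Y) rz.
  by rewrite !mdistxx add0r addr0.
rewrite integralDT//; last 3 first.
- by move=> z; rewrite lee_fin mulr_ge0// ltW.
- exact: emeasurable_funD.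
- by move=> z; rewrite adde_ge0.
rewrite integral_cstT integralDT// !integralZT//; last exact: ltW.
have -> : (2 * eta + k * (2 * eta) + k^-1 * (2 * C + 1))%:E = (2 * eta)%:E +
    (k%:E * (2 * eta)%:E + k^-1%:E * (2 * C + 1)%:E).
  by rewrite -!EFinM -!EFinD addrA.
rewrite integral_indicT// leeD2l//; apply: leeD; apply: lee_wpmul2l => //.
by rewrite lee_fin ltW.
Qed.

End bridge.

(** * Transport by the heat kernel *)

Section fluctuation.
Local Open Scope ereal_scope.
Context {R : realType}.

(** Two concentrated measures look like two points: the distance between independent
    points has variance at most [4 * e]. Hence it is close in mean square to the number
    [a] that bounds its second moment, up to the defect
    [a ^+ 2 - mutual_variance P P']. *)
Lemma distance_fluctuation (T : pmetricType R) (P P' : borel_probability T R)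
    (a e : R) : separable_space T -> (0 <= a)%R ->
  mutual_variance P P < e%:E -> mutual_variance P' P' < e%:E ->
  mutual_variance P P' <= (a ^+ 2 + e)%:E ->
  \int[P]_x \int[P']_y ((a - @mdist R T x y) ^+ 2)%:E + mutual_variance P P' <=
    (a ^+ 2 + 8 * e)%:E.
Proof.
move=> sT a0 VP VP' VPP'.
have [q [q1 q2 qE]] := exists_prod P P'.
pose W := (borel T * borel T)%type.
pose X (z : W) : R := @mdist R T z.1 z.2.
have mX : measurable_fun setT X by exact: measurable_mdist.
have X0 z : (0 <= X z)%R by exact: mdist_ge0.
have mXE : measurable_fun setT (EFin \o X) by exact/measurable_EFinP.
have mX2 : measurable_fun setT (fun z => (X z ^+ 2)%:E) by exact: measurable_mdist2.
have X20 z : 0 <= (X z ^+ 2)%:E by rewrite lee_fin sqr_ge0.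
have XE0 z : 0 <= (X z)%:E by rewrite lee_fin.
have mI r : measurable_fun setT (fun z => ((r - X z) ^+ 2)%:E).
  by apply/measurable_EFinP; apply: measurable_funX; exact: measurable_funB.
have I0 r z : 0 <= ((r - X z) ^+ 2)%:E by rewrite lee_fin sqr_ge0.
rewrite mutual_varianceE in VPP' *.
rewrite -(qE (fun z => (X z ^+ 2)%:E) mX2 X20) in VPP' *.
rewrite -(qE (fun z => ((a - X z) ^+ 2)%:E) (mI a) (I0 a)).
have e0 : (0 < e)%R.
  rewrite -lte_fin; apply: le_lt_trans VP; rewrite mutual_varianceE.
  by apply: integral_ge0 => x _; exact: mean2_ge0.
set v' := \int[q]_z (X z ^+ 2)%:E in VPP' *.
have v'0 : 0 <= v' by exact: integral_ge0.
have v'fin : v' \is a fin_num by rewrite ge0_fin_numE// (le_lt_trans VPP')// ltry.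
set m' := \int[q]_z (X z)%:E.
have m'0 : 0 <= m' by exact: integral_ge0.
have m'fin : m' \is a fin_num.
  rewrite ge0_fin_numE//; apply: (@le_lt_trans _ _ (1 + v')).
    rewrite -[X in X + _](integral_cstT q) /v' -integralDT//.
    apply: le_integral_ge0 => // z; rewrite -EFinD lee_fin.
    by have := le_half_add_sqr (X z) ltr01; rewrite invr1; have := sqr_ge0 (X z); lra.
  by rewrite lte_add_pinfty ?ltry// -ge0_fin_numE.
pose v := fine v'; pose m := fine m'.
have vE : v' = v%:E by rewrite fineK.
have mE : m' = m%:E by rewrite fineK.
have IE r : (0 <= r)%R -> \int[q]_z ((r - X z) ^+ 2)%:E + (2 * r * m)%:E =
    (r ^+ 2 + v)%:E.
  move=> r0; have r20 : (0 <= 2 * r)%R by rewrite mulr_ge0.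
  rewrite EFinM -mE -(integralZT q r20 mXE XE0) -integralDT//; last 2 first.
  - exact: measurable_funeM.
  - by move=> z; rewrite mule_ge0// lee_fin.
  rewrite EFinD -vE -[X in X + _](integral_cstT q) /v' -integralDT//.
    apply: eq_integral => z _; rewrite -EFinM -!EFinD; congr EFin.
    by rewrite sqrrB; lra.
  by move=> _; rewrite lee_fin sqr_ge0.
have IfinE r : (0 <= r)%R ->
    \int[q]_z ((r - X z) ^+ 2)%:E = (r ^+ 2 + v - 2 * r * m)%:E.
  move=> r0; have := IE _ r0; case: (\int[q]_z _) => [i| |]//.
  by rewrite -EFinD => -[<-]; rewrite addrK.
have m0 : (0 <= m)%R by rewrite -lee_fin -mE.
have jensen : (m ^+ 2 <= v)%R.
  have : 0 <= \int[q]_z ((m - X z) ^+ 2)%:E by exact: integral_ge0.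
  by rewrite IfinE// lee_fin expr2; lra.
have mean2C (Q : borel_probability T R) : mutual_variance Q Q < e%:E ->
    exists w : T, \int[Q]_x ((@mdist R T w x) ^+ 2)%:E < e%:E.
  by move=> VQ; apply: (exists_le_integral (P := Q)) => // w; exact: mean2_ge0.
(* The distance of the centres [w0] and [w0'] is within [2 * Num.sqrt e] of the random
   distance in mean square, hence the variance of the latter is at most [4 * e]. *)
have [w0 hw] := mean2C _ VP; have [w0' hw'] := mean2C _ VP'.
pose r0 := mdist w0 w0'.
have var : (r0 ^+ 2 + v - 2 * r0 * m <= 4 * e)%R.
  rewrite -lee_fin -IfinE ?mdist_ge0// qE//.
  apply: (@le_trans _ _ (\int[P]_x \int[P']_y (2%:E * ((@mdist R T w0 x) ^+ 2)%:E +
      2%:E * ((@mdist R T w0' y) ^+ 2)%:E))).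
    apply: le_integral_ge0 => x; first by apply: integral_ge0 => y _; exact: (I0 _ (x, y)).
    apply: le_integral_ge0 => y; first exact: (I0 _ (x, y)).
    rewrite -!EFinM -EFinD lee_fin /X /=.
    have t1 := mdist_tri (x : T) w0 w0'; have t2 := mdist_tri (y : T) (x : T) w0'.
    have t3 := mdist_tri w0 (x : T) (y : T); have t4 := mdist_tri w0' w0 (y : T).
    rewrite (mdistC (y : T)) in t2; rewrite (mdistC (x : T) w0) in t3.
    rewrite /r0; move: (mdist w0 w0') (mdist (x : T) y) (mdist w0 (x : T))
      (mdist w0' (y : T)) (mdist_ge0 w0 (x : T)) (mdist_ge0 w0' (y : T))
      (mdist (x : T) w0') (mdist w0 (y : T)) t1 t2 t3 t4 => A B C D C0 D0 E F t1 t2 t3 t4.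
    have h : (`|A - B| <= C + D)%R by rewrite ler_norml; lra.
    have h2 : ((A - B) ^+ 2 <= (C + D) ^+ 2)%R.
      by rewrite -real_normK ?num_real// ler_pXn2r// nnegrE// addr_ge0.
    have := sqr_ge0 (C - D); rewrite sqrrB; rewrite [leRHS]sqrrD in h2; lra.
  have mw (w : T) : measurable_fun setT (fun x : borel T => ((@mdist R T w x) ^+ 2)%:E).
    rewrite (_ : (fun x => _) = (fun x : borel T => ((@mdist R T x w) ^+ 2)%:E)).
      exact: measurable_mdist2l.
    by apply/funext => x; rewrite mdistC.
  have w20 (w : T) (x : borel T) : 0 <= 2%:E * ((@mdist R T w x) ^+ 2)%:E.
    by rewrite mule_ge0// lee_fin sqr_ge0.
  have mw2 (w : T) : measurable_fun setT
    (fun x : borel T => 2%:E * ((@mdist R T w x) ^+ 2)%:E) by exact: measurable_funeM.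
  have sqw (w : T) (x : borel T) : 0 <= ((@mdist R T w x) ^+ 2)%:E.
    by rewrite lee_fin sqr_ge0.
  have -> : \int[P]_x \int[P']_y (2%:E * ((@mdist R T w0 x) ^+ 2)%:E +
      2%:E * ((@mdist R T w0' y) ^+ 2)%:E) =
    2%:E * \int[P]_x ((@mdist R T w0 x) ^+ 2)%:E +
    2%:E * \int[P']_y ((@mdist R T w0' y) ^+ 2)%:E.
    under eq_integral do rewrite integralDT// integral_cstT.
    rewrite integralDT//; last by move=> _; exact: integral_ge0.
    by rewrite integral_cstT !integralZT.
  have -> : (4 * e)%:E = 2%:E * e%:E + 2%:E * e%:E.
    by rewrite -!EFinM -EFinD; congr EFin; clear; lra.
  apply: leeD; apply: lee_wpmul2l => //; exact: ltW.
rewrite IfinE// vE -EFinD lee_fin; rewrite vE lee_fin in VPP'.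
have [ma|am] := leP m a.
  have h1 : (v <= 4 * e + m ^+ 2)%R.
    by have := sqr_ge0 (r0 - m); rewrite sqrrB; lra.
  have : (m * m <= a * m)%R by rewrite ler_wpM2r.
  by rewrite expr2 in h1; lra.
have : (a * a <= a * m)%R by rewrite ler_wpM2l// ltW.
by rewrite expr2 in VPP'; rewrite expr2; lra.
Qed.

End fluctuation.

Section ball_mass.
Local Open Scope ereal_scope.
Context {R : realType} (b Theta H : R) (c : R -> R) (Z : flow R).
Hypothesis Theta0 : (0 < Theta)%R.
Hypothesis H0 : (0 <= H)%R.
Hypothesis c0 : forall K, (0 < c K)%R.
Hypothesis rZ : regular_flow b Theta H c Z.

Local Notation prob t := (borel_probability (ambient Z t) R).

Lemma measurable_open_ball (T : pmetricType R) (x : T) (e : R) :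
  measurable ([set x' | (mdist x x' < e)%R] : set (borel T)).
Proof.
have := measurable_mdistl x measurableT (measurable_itv `]-oo, e[).
by rewrite setTI; congr measurable; apply/seteqP; split => y /=;
  rewrite in_itv /= mdistC.
Qed.

Lemma measurable_ball_measure (T : pmetricType R) (P : borel_probability T R)
    (e : R) : separable_space T ->
  measurable_fun setT (fun x : borel T => P [set x' | (@mdist R T x x' < e)%R]).
Proof.
move=> sT; rewrite (_ : (fun x => _) = (fun x : borel T => \int[P]_x'
    (\1_[set v : borel T * borel T | (@mdist R T v.1 v.2 < e)%R] (x, x'))%:E)).
  apply: (measurable_mean P (f := fun v => (\1_[set v : borel T * borel T |
    (@mdist R T v.1 v.2 < e)%R] v)%:E)); first by move=> z; rewrite lee_fin.
  apply: measurable_indicE.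
  by have := measurable_mdist sT measurableT (measurable_itv `]-oo, e[);
    rewrite setTI.
apply/funext => x.
transitivity (\int[P]_x' (\1_[set x' | (@mdist R T x x' < e)%R] x')%:E).
  by rewrite integral_indicT//; exact: measurable_open_ball.
by apply: eq_integral => x' _; rewrite !indicE; congr (_%:R%:E);
  congr nat_of_bool; apply/idP/idP; rewrite !inE.
Qed.

Lemma measurable_sublevel d (T : measurableType d) (f : T -> \bar R) (m : \bar R) :
  measurable_fun setT f -> measurable [set x | f x < m].
Proof.
move=> mf; have := mf measurableT _ (emeasurable_itv `]-oo, m[).
by rewrite setTI; congr measurable; apply/seteqP; split => z /=; rewrite in_itv.
Qed.

(** Most balls have a mass that is bounded below only in terms of their radius:
    a typical point of [Z_u] is typical for the heat kernel of some point [x] of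
    a slightly later slice, near which that kernel is concentrated, and by the
    Harnack property the kernels of all points at a bounded distance of [x] charge
    the same ball. *)
Lemma ball_mass u u' (mu : prob u) (mu' : prob u') (K eta V : R) :
  (u < u')%R -> (u' < b)%R -> evolves mu' mu -> (0 < K)%R -> (0 < eta)%R ->
  mutual_variance mu' mu' <= V%:E ->
  mu [set z | mu [set z' | (@mdist R (ambient Z u) z z' < eta)%R] < (c K / 2)%:E]
  <= (V / (K ^+ 2 * (Theta * (u' - u)) / 2) +
      Theta * H * (u' - u) / (eta ^+ 2 / 2))%:E.
Proof.
move=> uu' u'b ev K0 eta0 hV.
have ub := lt_trans uu' u'b.
have sepu := regular_separable rZ ub; have sepu' := regular_separable rZ u'b.
set s := (Theta * (u' - u))%R.
have s0 : (0 < s)%R by rewrite mulr_gt0// subr_gt0.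
set M := (K ^+ 2 * s / 2)%R.
have M0 : (0 < M)%R by rewrite divr_gt0// mulr_gt0// exprn_gt0.
pose bal (z : ambient Z u) : set (borel (ambient Z u)) := [set z' | (mdist z z' < eta)%R].
pose Bd : set (borel (ambient Z u)) := [set z | mu (bal z) < (c K / 2)%:E].
rewrite -/Bd.
have mBd : measurable Bd.
  exact: measurable_sublevel (measurable_ball_measure _ _ sepu).
pose ker (x : borel (ambient Z u')) := hker Z (x : ambient Z u') u.
pose f (x : borel (ambient Z u')) := \int[mu']_y ((@mdist R (ambient Z u') x y) ^+ 2)%:E.
have mf : measurable_fun setT f by exact: measurable_mean2.
have f0 x : 0 <= f x by exact: mean2_ge0.
have markov (T : pmetricType R) (P : borel_probability T R) (x : T) (t : R) :
    (0 < t)%R -> \int[P]_y ((@mdist R T x y) ^+ 2)%:E <= (t / 2)%:E ->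
    2^-1%:E <= P [set y | (mdist x y ^+ 2 < t)%R].
  move=> t0 h.
  have mA : measurable ([set y | (mdist x y ^+ 2 < t)%R] : set (borel T)).
    have := measurable_mdist2l x measurableT (emeasurable_itv `]-oo, t%:E[).
    by rewrite setTI; congr measurable; apply/seteqP; split => y /=;
      rewrite in_itv /= mdistC.
  have sq0 (y : borel T) : 0 <= ((@mdist R T x y) ^+ 2)%:E by rewrite lee_fin sqr_ge0.
  have far : t%:E * P (~` [set y | (mdist x y ^+ 2 < t)%R]) <= (t / 2)%:E.
    apply: le_trans (mul_measure_le_integral P (measurableC mA) (ltW t0) sq0 _) h.
    by move=> y /= /negP; rewrite -leNgt lee_fin.
  move: far; rewrite (probability_setC P mA).
  have : P [set y | (mdist x y ^+ 2 < t)%R] \is a fin_num by exact: fin_num_measure.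
  case: (P _) => // r _.
  rewrite -EFinB -EFinM !lee_fin mulrBr mulr1 => h2.
  rewrite -(ler_pM2l t0); by move: h2; lra.
have key x : ker x Bd <= (M^-1)%:E * f x + (s * H / (eta ^+ 2 / 2))%:E.
  have e20 : (0 < eta ^+ 2 / 2)%R by rewrite divr_gt0// exprn_gt0.
  have sH0 : (0 <= s * H / (eta ^+ 2 / 2))%R.
    by rewrite divr_ge0 ?(ltW e20)// mulr_ge0// ltW.
  (* Points [x] that are far from most points of the slice are few, and there the
     trivial bound 1 is used. *)
  have [fM|fM] := leP (f x) M%:E; last first.
    apply: (@le_trans _ _ 1); first exact: probability_le1.
    apply: (@le_trans _ _ ((M^-1)%:E * f x)); last by rewrite leeDl// lee_fin.
    rewrite -[leLHS](_ : (M^-1)%:E * M%:E = 1); last first.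
      by rewrite -EFinM mulVf// gt_eqF.
    by apply: lee_wpmul2l (ltW fM); rewrite lee_fin invr_ge0 ltW.
  apply: (@le_trans _ _ (s * H / (eta ^+ 2 / 2))%:E); last first.
    by rewrite leeDr// mule_ge0// lee_fin invr_ge0 ltW.
  pose g (z : borel (ambient Z u)) :=
    \int[ker x]_z' ((@mdist R (ambient Z u) z z') ^+ 2)%:E.
  have g0 z : 0 <= g z by exact: mean2_ge0.
  have gI : \int[ker x]_z g z <= (s * H)%:E.
    apply: le_trans (regular_concentrated rZ (ltW uu') u'b x x) _.
    by rewrite mdistxx expr0n add0r lee_fin mulrAC.
  have : (eta ^+ 2 / 2)%:E * ker x Bd <= (s * H)%:E; last first.
    have : ker x Bd \is a fin_num by exact: fin_num_measure.
    case: (ker x Bd) => // r _; rewrite -EFinM !lee_fin => h.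
    by rewrite ler_pdivlMr// mulrC.
  apply: le_trans (mul_measure_le_integral (ker x) mBd (ltW e20) g0 _) gI.
  move=> z Bz; rewrite leNgt; apply/negP => gz.
  have half : 2^-1%:E <= ker x (bal z).
    have := markov _ (ker x) z _ (exprn_gt0 2 eta0) (ltW gz).
    move/le_trans; apply; rewrite (_ : [set y | _] = bal z)//.
    by apply/seteqP; split => y /=; rewrite ltr_pXn2r// nnegrE ?mdist_ge0// ltW.
  have near : 2^-1%:E <= mu' [set y | (@mdist R (ambient Z u') x y ^+ 2 < M * 2)%R].
    apply: markov; first by rewrite mulr_gt0.
    by rewrite mulfK ?pnatr_eq0.
  have : (c K / 2)%:E <= mu (bal z); last by rewrite leNgt Bz.
  rewrite ev; last exact: measurable_open_ball.
  apply: (@le_trans _ _ ((c K)%:E * mu'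
      [set y | (@mdist R (ambient Z u') x y ^+ 2 < M * 2)%R])).
    by rewrite EFinM lee_wpmul2l// lee_fin ltW.
  apply: mul_measure_le_integral => //.
  - have := measurable_mdist2l x measurableT (emeasurable_itv `]-oo, (M * 2)%:E[).
    by rewrite setTI; congr measurable; apply/seteqP; split => y /=;
      rewrite in_itv /= mdistC.
  - exact: ltW.
  - move=> y /= xy; apply: (regular_harnack rZ uu' u'b _ half).
      exact: measurable_open_ball.
    rewrite -(ler_pXn2r (n := 2))// ?nnegrE ?mdist_ge0 ?mulr_ge0 ?sqrtr_ge0 ?(ltW K0)//.
    rewrite exprMn sqr_sqrtr ?(ltW s0)//; apply: ltW; apply: lt_le_trans xy _.
    by rewrite /M divfK.
rewrite ev//.
apply: (@le_trans _ _ (\int[mu']_x ((M^-1)%:E * f x + (s * H / (eta ^+ 2 / 2))%:E))).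
  by apply: le_integral_ge0 => x; [exact: measure_ge0|exact: key].
have Mi : (0 <= M^-1)%R by rewrite invr_ge0 ltW.
rewrite integralDT//; last 3 first.
- exact: measurable_funeM.
- by move=> x; rewrite mule_ge0.
- move=> _; rewrite lee_fin divr_ge0//; first by rewrite mulr_ge0// ltW.
  by rewrite divr_ge0// sqr_ge0.
rewrite integral_cstT integralZT// EFinD; apply: leeD.
  rewrite (_ : V / _ = M^-1 * V)%R; last by rewrite mulrC.
  by rewrite EFinM lee_wpmul2l.
by rewrite lee_fin /s [(Theta * _ * H)%R]mulrAC.
Qed.

End ball_mass.

Section shift_bridge.
Local Open Scope ereal_scope.
Context {R : realType} (b Theta H : R) (c : R -> R) (Z : flow R).
Hypothesis Theta0 : (0 < Theta)%R.
Hypothesis H0 : (0 <= H)%R.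
Hypothesis rZ : regular_flow b Theta H c Z.

Local Notation prob t := (borel_probability (ambient Z t) R).

Lemma integral_kprod2 d1 d2 (X : measurableType d1) (Y : measurableType d2)
    (P : probability X R) (k : X -> probability Y R)
    (Q : probability (X * Y)%type R) : kernel_like k ->
  (forall f : X * Y -> \bar R, measurable_fun [set: X * Y] f ->
    (forall z, 0 <= f z) -> \int[Q]_z f z = \int[P]_x \int[k x]_y f (x, y)) ->
  forall f : (X * Y) * (X * Y) -> \bar R, measurable_fun setT f ->
    (forall v, 0 <= f v) ->
    \int[Q]_z \int[Q]_z' f (z, z') =
    \int[P]_x \int[P]_x' \int[k x]_y \int[k x']_y' f ((x, y), (x', y')).
Proof.
move=> mk QE f mf f0.
rewrite QE; last 2 first.
- exact: measurable_mean.
- by move=> z; exact: integral_ge0.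
apply: eq_integral => x _.
pose g (w : Y * X) := \int[k w.2]_y' f ((x, w.1), (w.2, y')).
have mk2 : kernel_like (fun w : Y * X => k w.2).
  by move=> A mA; exact: (measurableT_comp (mk A mA) measurable_snd).
have mg : measurable_fun setT g.
  apply: (measurable_kernel_integral mk2
    (f := fun v : (Y * X) * Y => f ((x, v.1.1), (v.1.2, v.2)))) => //.
  apply: (measurableT_comp mf); apply/measurable_fun_pair => /=.
    apply/measurable_fun_pair => //=.
    exact: (measurableT_comp measurable_fst measurable_fst).
  apply/measurable_fun_pair => //=.
  exact: (measurableT_comp measurable_snd measurable_fst).
have g0 w : 0 <= g w by exact: integral_ge0.
rewrite -[RHS](@fubini_tonelli _ _ _ _ _ (k x) P g mg g0).
apply: eq_integral => y _; rewrite QE//.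
exact: (measurableT_comp mf (measurable_pair1 (x, y))).
Qed.

Lemma measurable_kernel2 d1 d2 (X : measurableType d1) (Y : measurableType d2)
    (k : X -> probability Y R) : kernel_like k ->
  forall f : (X * Y) * (X * Y) -> \bar R, measurable_fun setT f ->
    (forall v, 0 <= f v) -> measurable_fun setT (fun u : X * X =>
      \int[k u.1]_y \int[k u.2]_y' f ((u.1, y), (u.2, y'))).
Proof.
move=> mk f mf f0.
have mk1 : kernel_like (fun u : X * X => k u.1).
  by move=> A mA; exact: (measurableT_comp (mk A mA) measurable_fst).
have mk2 : kernel_like (fun w : (X * X) * Y => k w.1.2).
  move=> A mA.
  exact: (measurableT_comp (measurableT_comp (mk A mA) measurable_snd) measurable_fst).
apply: (measurable_kernel_integral mk1 (f := fun w : (X * X) * Y =>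
  \int[k w.1.2]_y' f ((w.1.1, w.2), (w.1.2, y')))).
  by move=> w; exact: integral_ge0.
apply: (measurable_kernel_integral mk2 (f := fun w : ((X * X) * Y) * Y =>
  f ((w.1.1.1, w.1.2), (w.1.1.2, w.2)))) => //.
have m1 := @measurable_fst _ _ ((X * X) * Y)%type Y.
have m11 := measurableT_comp (@measurable_fst _ _ (X * X)%type Y) m1.
apply: (measurableT_comp mf); apply/measurable_fun_pair => /=.
  apply/measurable_fun_pair => /=.
    exact: (measurableT_comp measurable_fst m11).
  exact: (measurableT_comp measurable_snd m1).
apply/measurable_fun_pair => /=; last exact: measurable_snd.
exact: (measurableT_comp measurable_snd m11).
Qed.

(** At a time at which the variance of a conjugate heat flow does not drop, the
    heat kernel transports its two slices onto each other almost isometrically. *)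
Lemma exists_shift_bridge s u (mu : prob u) (mu' : prob s)
    (e eta m d0 V k kap : R) :
  (s <= u)%R -> (u < b)%R -> evolves mu mu' ->
  (Theta * H * (u - s) < e)%R ->
  mutual_variance mu mu <= V%:E ->
  mutual_variance mu mu <= mutual_variance mu' mu' + d0%:E ->
  (0 < eta)%R -> (eta <= 4^-1)%R -> (0 < m)%R -> (0 < k)%R -> (0 < kap)%R ->
  mu [set z | mu [set z' | (@mdist R (ambient Z u) z z' < eta)%R] < m%:E] <= eta%:E ->
  (kap / 2 + kap^-1 / 2 * (d0 + 8 * e) <= eta * (eta * m / 2))%R ->
  exists rel, almost_isometry rel (2 * eta)%R /\
    \int[mu]_z \int[hker Z (z : ambient Z u) s]_w
        (bridge rel (2 * eta) (z : ambient Z u) (w : ambient Z s))%:E <=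
      (2 * eta + k * (2 * eta) + k^-1 * (2 * (2 * V + e) + 1))%:E.
Proof.
move=> su ub ev he hV hd eta0 eta4 m0 k0 kap0 hm hdelta.
have sb : (s < b)%R by exact: le_lt_trans ub.
have sepu := regular_separable rZ ub; have seps := regular_separable rZ sb.
pose ker (x : borel (ambient Z u)) := hker Z (x : ambient Z u) s.
have mk : kernel_like ker by exact: (regular_kernel rZ su ub).
have [Q QE] := exists_kprod mu mk.
have e0 : (0 <= Theta * H * (u - s))%R by rewrite !mulr_ge0// ?subr_ge0// ltW.
have Qmu (A : set (borel (ambient Z u))) : measurable A -> Q (A `*` setT) = mu A.
  move=> mA; have mA' : measurable (A `*` [set: borel (ambient Z s)]) by exact: measurableX.
  rewrite -[LHS]integral_indicT// QE//; last exact: measurable_indicE.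
  rewrite -[RHS]integral_indicT//; apply: eq_integral => x _.
  rewrite (eq_integral (cst (\1_A x)%:E)) ?integral_cstT//.
  by move=> y _; rewrite /= !indicE in_setX in_setT andbT.
pose dX x x' := @mdist R (ambient Z u) x x'.
pose dY y y' := @mdist R (ambient Z s) y y'.
pose W := (borel (ambient Z u) * borel (ambient Z s))%type.
have mdX : measurable_fun setT (fun v : W * W => dX v.1.1 v.2.1).
  have mg : measurable_fun setT (fun v : W * W => (v.1.1, v.2.1)).
    apply/measurable_fun_pair => /=.
      exact: (measurableT_comp measurable_fst measurable_fst).
    exact: (measurableT_comp measurable_fst measurable_snd).
  exact: (measurableT_comp (measurable_mdist sepu) mg).
have mdY : measurable_fun setT (fun v : W * W => dY v.1.2 v.2.2).
  have mg : measurable_fun setT (fun v : W * W => (v.1.2, v.2.2)).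
    apply/measurable_fun_pair => /=.
      exact: (measurableT_comp measurable_snd measurable_fst).
    exact: (measurableT_comp measurable_snd measurable_snd).
  exact: (measurableT_comp (measurable_mdist seps) mg).
have conc (x x' : ambient Z u) : mutual_variance (ker x) (ker x') <= (dX x x' ^+ 2 + e)%:E.
  apply: le_trans (regular_concentrated rZ su ub x x') _.
  by rewrite lee_fin lerD2l ltW.
have conc0 (x : ambient Z u) : mutual_variance (ker x) (ker x) < e%:E.
  apply: le_lt_trans (regular_concentrated rZ su ub x x) _.
  by rewrite mdistxx expr0n add0r lte_fin.
have Vfin : mutual_variance mu' mu' \is a fin_num.
  rewrite ge0_fin_numE; last first.
    by rewrite mutual_varianceE; apply: integral_ge0 => x _; exact: mean2_ge0.
  apply: le_lt_trans (variance_evolves Theta0 H0 rZ su ub ev ev) _.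
  by apply: le_lt_trans (leeD2r _ hV) _; rewrite -EFinD ltry.
have msq : measurable_fun setT (fun v : W * W => ((dX v.1.1 v.2.1 - dY v.1.2 v.2.2) ^+ 2)%:E).
  by apply/measurable_EFinP; apply: measurable_funX; exact: measurable_funB.
have sq0 (v : W * W) : 0 <= ((dX v.1.1 v.2.1 - dY v.1.2 v.2.2) ^+ 2)%:E.
  by rewrite lee_fin sqr_ge0.
have m2u := measurable_mdist2 sepu; have m2s := measurable_mdist2 seps.
pose I := \int[Q]_z \int[Q]_z' ((dX z.1 z'.1 - dY z.2 z'.2) ^+ 2)%:E.
have I0 : 0 <= I by apply: integral_ge0 => z _; apply: integral_ge0 => z' _; exact: (sq0 (z, z')).
(* Integrating [distance_fluctuation] over independent pairs of points, the variance of
   [mu] bounds that of [mu'] plus the distortion. *)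
have II : I <= (d0 + 8 * e)%:E.
  rewrite -(@leeD2lE _ (mutual_variance mu' mu'))// addeC.
  apply: (@le_trans _ _ (mutual_variance mu mu + (8 * e)%:E)); last first.
    by rewrite EFinD addeA leeD2r.
  rewrite /I (integral_kprod2 mk QE msq sq0).
  rewrite [mutual_variance mu' mu']mutual_varianceE (integral_evolves2 rZ su ub ev ev
    (f := fun z => ((@mdist R (ambient Z s) z.1 z.2) ^+ 2)%:E) m2s); last first.
    by move=> z; rewrite lee_fin sqr_ge0.
  have [q [_ _ qE]] := exists_prod mu mu.
  pose A (v : borel (ambient Z u) * borel (ambient Z u)) :=
    \int[ker v.1]_y \int[ker v.2]_y' ((dX v.1 v.2 - dY y y') ^+ 2)%:E.
  pose B (v : borel (ambient Z u) * borel (ambient Z u)) :=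
    \int[ker v.1]_y \int[ker v.2]_y' ((dY y y') ^+ 2)%:E.
  have mA : measurable_fun setT A by exact: (measurable_kernel2 mk msq sq0).
  have mY2 : measurable_fun setT (fun v : W * W => ((dY v.1.2 v.2.2) ^+ 2)%:E).
    by apply/measurable_EFinP; exact: measurable_funX.
  have Y20 (v : W * W) : 0 <= ((dY v.1.2 v.2.2) ^+ 2)%:E by rewrite lee_fin sqr_ge0.
  have mB : measurable_fun setT B by exact: (measurable_kernel2 mk mY2 Y20).
  have A0 v : 0 <= A v.
    by apply: integral_ge0 => y _; apply: integral_ge0 => y' _; rewrite lee_fin sqr_ge0.
  have B0 v : 0 <= B v.
    by apply: integral_ge0 => y _; apply: integral_ge0 => y' _; rewrite lee_fin sqr_ge0.
  rewrite [X in X + _](_ : _ = \int[q]_v A v); last first.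
    by apply: esym; exact: (qE A mA A0).
  rewrite [X in _ + X](_ : _ = \int[q]_v B v); last first.
    by apply: esym; exact: (qE B mB B0).
  have m2u0 (v : borel (ambient Z u) * borel (ambient Z u)) :
    0 <= ((@mdist R (ambient Z u) v.1 v.2) ^+ 2)%:E by rewrite lee_fin sqr_ge0.
  rewrite mutual_varianceE -(qE (fun v => ((@mdist R (ambient Z u) v.1 v.2) ^+ 2)%:E)
    m2u m2u0).
  have e80 : (0 <= 8 * e)%R by rewrite mulr_ge0// (le_trans e0)// ltW.
  rewrite [leRHS](_ : _ = \int[q]_v (((@mdist R (ambient Z u) v.1 v.2) ^+ 2)%:E +
    (8 * e)%:E)); last by rewrite integralDT// integral_cstT.
  rewrite [leLHS](_ : _ = \int[q]_v (A v + B v)); last first.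
    by apply: esym; exact: (integralDT q mA A0 mB B0).
  apply: le_integral_ge0 => v; first by rewrite adde_ge0.
  rewrite -EFinD; apply: distance_fluctuation => //; exact: mdist_ge0.
have hE : \int[Q]_z \int[Q]_z' (`|dX z.1 z'.1 - dY z.2 z'.2|)%:E <=
    (kap / 2 + kap^-1 / 2 * (d0 + 8 * e))%:E.
  have kap20 : (0 <= kap^-1 / 2)%R by rewrite divr_ge0// invr_ge0 ltW.
  pose sqf (v : W * W) := ((dX v.1.1 v.2.1 - dY v.1.2 v.2.2) ^+ 2)%:E.
  have msqz z : measurable_fun setT (fun z' => sqf (z, z')).
    exact: (measurableT_comp msq (measurable_pair1 z)).
  apply: (@le_trans _ _ (\int[Q]_z \int[Q]_z' ((kap / 2)%:E +
      (kap^-1 / 2)%:E * sqf (z, z')))).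
    apply: le_integral_ge0 => z; first by apply: integral_ge0 => z' _; rewrite lee_fin.
    apply: le_integral_ge0 => z'; first by rewrite lee_fin.
    rewrite /sqf -EFinM -EFinD lee_fin -real_normK ?num_real//.
    exact: le_half_add_sqr.
  have kap2 : 0 <= (kap / 2)%:E by rewrite lee_fin divr_ge0// ltW.
  have kk (z : W) : \int[Q]_z' ((kap / 2)%:E + (kap^-1 / 2)%:E * sqf (z, z')) =
      (kap / 2)%:E + (kap^-1 / 2)%:E * \int[Q]_z' sqf (z, z').
    have mz : measurable_fun setT (fun z' => (kap^-1 / 2)%:E * sqf (z, z')).
      exact: measurable_funeM.
    have kz z' : 0 <= (kap^-1 / 2)%:E * sqf (z, z').
      by rewrite mule_ge0// lee_fin sqr_ge0.
    rewrite integralDT// integral_cstT integralZT// => z'.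
    by rewrite lee_fin sqr_ge0.
  under eq_integral do rewrite kk.
  have mJ : measurable_fun setT (fun z => \int[Q]_z' sqf (z, z')).
    by apply: measurable_mean => // v; rewrite lee_fin sqr_ge0.
  have J0 z : 0 <= \int[Q]_z' sqf (z, z').
    by apply: integral_ge0 => z' _; rewrite lee_fin sqr_ge0.
  have mkJ : measurable_fun setT (fun z => (kap^-1 / 2)%:E * \int[Q]_z' sqf (z, z')).
    exact: measurable_funeM.
  have kJ0 z : 0 <= (kap^-1 / 2)%:E * \int[Q]_z' sqf (z, z') by rewrite mule_ge0.
  rewrite integralDT// integral_cstT integralZT//.
  by rewrite EFinD leeD2l// [leRHS]EFinM lee_wpmul2l.
have hV2 : \int[Q]_z \int[Q]_z' ((dX z.1 z'.1) ^+ 2 + (dY z.2 z'.2) ^+ 2)%:E <=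
    (2 * V + e)%:E.
  rewrite (integral_kprod2 mk QE
    (f := fun v => ((dX v.1.1 v.2.1) ^+ 2 + (dY v.1.2 v.2.2) ^+ 2)%:E)); last 2 first.
  - by apply/measurable_EFinP; apply: measurable_funD; exact: measurable_funX.
  - by move=> v; rewrite lee_fin addr_ge0// sqr_ge0.
  apply: (@le_trans _ _ (\int[mu]_x \int[mu]_x' (2%:E *
      ((@mdist R (ambient Z u) x x') ^+ 2)%:E + e%:E))).
    apply: le_integral_ge0 => x.
      apply: integral_ge0 => x' _; apply: integral_ge0 => y _; apply: integral_ge0 => y' _.
      by rewrite lee_fin addr_ge0// sqr_ge0.
    apply: le_integral_ge0 => x'.
      apply: integral_ge0 => y _; apply: integral_ge0 => y' _.
      by rewrite lee_fin addr_ge0// sqr_ge0.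
    have [q [_ _ qE]] := exists_prod (ker x) (ker x').
    have dyy0 (v : borel (ambient Z s) * borel (ambient Z s)) :
      0 <= ((dY v.1 v.2) ^+ 2)%:E by rewrite lee_fin sqr_ge0.
    rewrite -(qE (fun v => ((dX x x') ^+ 2 + (dY v.1 v.2) ^+ 2)%:E)); last 2 first.
    - apply/measurable_EFinP; apply: measurable_funD => //.
      by apply: measurable_funX; exact: measurable_mdist.
    - by move=> v; rewrite lee_fin addr_ge0// sqr_ge0.
    under eq_integral do rewrite EFinD.
    rewrite integralDT//; last by move=> ?; rewrite lee_fin sqr_ge0.
    rewrite integral_cstT qE//.
    apply: (@le_trans _ _ ((dX x x' ^+ 2)%:E + (dX x x' ^+ 2 + e)%:E)).
      by rewrite leeD2l//; exact: conc.
    by rewrite -EFinM -!EFinD lee_fin mulr_natl mulr2n addrA.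
  have [q [_ _ qE]] := exists_prod mu mu.
  have m2u0 (v : borel (ambient Z u) * borel (ambient Z u)) :
    0 <= ((@mdist R (ambient Z u) v.1 v.2) ^+ 2)%:E by rewrite lee_fin sqr_ge0.
  have ee0 : (0 <= e)%R by rewrite (le_trans e0)// ltW.
  rewrite -(qE (fun v => 2%:E * ((@mdist R (ambient Z u) v.1 v.2) ^+ 2)%:E + e%:E));
    last 2 first.
  - by apply: emeasurable_funD => //; exact: measurable_funeM.
  - by move=> v; rewrite adde_ge0// mule_ge0.
  have m2' : measurable_fun setT (fun v : borel (ambient Z u) * borel (ambient Z u) =>
      2%:E * ((@mdist R (ambient Z u) v.1 v.2) ^+ 2)%:E) by exact: measurable_funeM.
  have m2'0 (v : borel (ambient Z u) * borel (ambient Z u)) :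
    0 <= 2%:E * ((@mdist R (ambient Z u) v.1 v.2) ^+ 2)%:E by rewrite mule_ge0.
  rewrite integralDT// integral_cstT integralZT// qE//.
  by rewrite [leRHS]EFinD leeD2r// [leRHS]EFinM lee_wpmul2l.
have [rel [arel hrel]] := exists_almost_isometry sepu seps Qmu eta0 eta4 m0 k0
  hdelta hE hm hV2.
exists rel; split => //; rewrite -(QE (fun z =>
  (bridge rel (2 * eta) (z.1 : ambient Z u) (z.2 : ambient Z s))%:E))//.
  exact: measurable_bridge.
by move=> z; rewrite lee_fin ltW// bridge_gt0.
Qed.

End shift_bridge.

(** * Strong closeness *)

Section transport.
Local Open Scope ereal_scope.
Context {R : realType}.

Definition transportable d1 d2 (X : measurableType d1) (Y : measurableType d2)
    (c : X -> Y -> R) (P : probability X R) (Q : probability Y R) (e : \bar R) :=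
  exists q : probability (X * Y)%type R,
  [/\ forall A, measurable A -> q (A `*` setT) = P A,
      forall A, measurable A -> q (setT `*` A) = Q A &
      \int[q]_z (c z.1 z.2)%:E <= e].

Lemma exists_swap d1 d2 (X : measurableType d1) (Y : measurableType d2)
    (q : probability (X * Y)%type R) : exists q' : probability (Y * X)%type R,
  [/\ forall A, q' (A `*` setT) = q (setT `*` A),
      forall A, q' (setT `*` A) = q (A `*` setT) &
      forall f : Y * X -> \bar R, measurable_fun [set: Y * X] f ->
        (forall z, 0 <= f z) -> \int[q']_z f z = \int[q]_z f (z.2, z.1)].
Proof.
have mg : measurable_fun setT (fun z : X * Y => (z.2, z.1)).
  by apply/measurable_fun_pair => /=; [exact: measurable_snd|exact: measurable_fst].
have [q' [q'E q'I]] := exists_push q mg; exists q'; split => // A.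
- by rewrite q'E; congr (q _); apply/seteqP; split => z [].
- by rewrite q'E; congr (q _); apply/seteqP; split => z [].
Qed.

Lemma transportable_swap d1 d2 (X : measurableType d1) (Y : measurableType d2)
    (c : X -> Y -> R) (P : probability X R) (Q : probability Y R) (e : \bar R) :
  measurable_fun setT (fun z : X * Y => (c z.1 z.2)%:E) ->
  (forall x y, 0 <= c x y)%R ->
  transportable c P Q e -> transportable (fun y x => c x y) Q P e.
Proof.
move=> mc c0 [q [q1 q2 qe]]; have [q' [q'1 q'2 q'I]] := exists_swap q.
exists q'; split => [A mA|A mA|]; first by rewrite q'1 q2.
  by rewrite q'2 q1.
rewrite (q'I (fun z => (c z.2 z.1)%:E))//; last by move=> z; rewrite lee_fin.
have mg : measurable_fun setT (fun z : Y * X => (z.2, z.1)).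
  by apply/measurable_fun_pair => /=; [exact: measurable_snd|exact: measurable_fst].
exact: (measurableT_comp mc mg).
Qed.

(** The triangle inequality for transport costs. The gluing of the two couplings is
    approximate, whence [rho]. *)
Lemma transportable_trans d1 d3 (X1 : measurableType d1) (T : pmetricType R)
    (X3 : measurableType d3) (c12 : X1 -> borel T -> R) (c23 : borel T -> X3 -> R)
    (c13 : X1 -> X3 -> R) (P1 : probability X1 R) (P2 : borel_probability T R)
    (P3 : probability X3 R) (e12 e23 : \bar R) (rho : R) :
  separable_space T -> (0 < rho)%R ->
  measurable_fun setT (fun z : X1 * borel T => (c12 z.1 z.2)%:E) ->
  (forall x y, 0 <= c12 x y)%R -> (forall x y, 0 <= c23 x y)%R ->
  (forall x y, 0 <= c13 x y)%R ->
  (forall x1 (x2 x2' : T) x3, c13 x1 x3 <= c12 x1 x2 + mdist x2 x2' + c23 x2' x3)%R ->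
  transportable c12 P1 P2 e12 -> transportable c23 P2 P3 e23 ->
  transportable c13 P1 P3 (e12 + rho%:E + e23).
Proof.
move=> sT rho0 m12 c120 c230 c130 tri.
move=> /(transportable_swap m12 c120)[Q [Q1 Q2 Qe]] [q [q1 q2 qe]].
have [q' [q'1 q'2 q'I]] := glue_couplings sT rho0 Q1 q1.
exists q'; split => [A mA|A mA|]; first by rewrite q'1// Q2.
  by rewrite q'2// q2.
have M0 (x : T) y : 0 <= (c12 y x)%:E by rewrite lee_fin.
have W0 (x : T) z : 0 <= (c23 x z)%:E by rewrite lee_fin.
have W'0 y z : 0 <= (c13 y z)%:E by rewrite lee_fin.
have mM : measurable_fun setT (fun z : borel T * X1 => (c12 z.2 z.1)%:E).
  have mg : measurable_fun setT (fun z : borel T * X1 => (z.2, z.1)).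
    by apply/measurable_fun_pair => /=; [exact: measurable_snd|exact: measurable_fst].
  exact: (measurableT_comp m12 mg).
apply: le_trans (q'I _ _ _ _ (ltW rho0) M0 W0 W'0 mM _) _.
  move=> x x' y z xx'; rewrite -!EFinD lee_fin.
  apply: le_trans (tri y x' x z) _; rewrite lerD2r lerD2l mdistC.
  exact: ltW.
by apply: leeD => //; exact: leeD2r.
Qed.

End transport.

Section strongly_close.
Local Open Scope ereal_scope.
Context {R : realType}.

Definition time_change (Z : flow R) (tau : R -> R) : flow R :=
  @Flow R (fun t => ambient Z (tau t)) (fun t => setT)
    (fun t x s => hker Z x (tau s)).

(** In this closeness, unlike in [F]-closeness, the two slices at a time are bridged
    by a relation and the bounds [M] for the distances between heat kernels are
    measurable, so that two couplings can be glued. It is symmetric. *)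
Definition strongly_close (G : set R) (delta : R) (Y1 Y2 : flow R)
    (m1 : forall t, borel_probability (ambient Y1 t) R)
    (m2 : forall t, borel_probability (ambient Y2 t) R) :=
  exists (rel : forall t, ambient Y1 t -> ambient Y2 t -> Prop) (eta : R -> R)
    (Q : forall t, probability (borel (ambient Y1 t) * borel (ambient Y2 t))%type R),
  [/\ forall t, G t -> almost_isometry (rel t) (eta t),
      forall t, G t -> coupling (m1 t) (m2 t) (Q t) &
      forall s t, G s -> G t -> (s <= t)%R ->
      exists M : ambient Y1 t -> ambient Y2 t -> \bar R,
      [/\ forall x y, 0 <= M x y,
          measurable_fun setT (fun z : borel (ambient Y1 t) * borel (ambient Y2 t) =>
            M z.1 z.2),
          forall x y, @transportable R _ _ (borel (ambient Y1 s))
            (borel (ambient Y2 s)) (bridge (rel s) (eta s))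
            (hker Y1 x s) (hker Y2 y s) (M x y) &
          \int[Q t]_z M z.1 z.2 <= delta%:E]].

Lemma almost_isometry_flip (X Y : pmetricType R) (rel : X -> Y -> Prop) (eta : R) :
  almost_isometry rel eta -> almost_isometry (fun y x => rel x y) eta.
Proof.
move=> [eta0 [x [y r]] h]; split => //; first by exists y, x.
by move=> y1 x1 y2 x2 r1 r2; rewrite distrC; exact: h.
Qed.

Lemma bridge_flip (X Y : pmetricType R) (rel : X -> Y -> Prop) (eta : R) x y :
  bridge (fun y x => rel x y) eta y x = bridge rel eta x y.
Proof.
congr inf; apply/seteqP; split => r [a [c [rc ->]]]; exists c, a; split => //;
  by rewrite (mdistC y) (mdistC x) addrC addrA [X in (X + _)%R]addrC -addrA addrC
    -addrA addrC ?addrA.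
Qed.

Lemma strongly_close_sym G delta Y1 Y2 m1 m2 :
  (forall t, G t -> separable_space (ambient Y1 t)) ->
  strongly_close (Y1 := Y1) (Y2 := Y2) G delta m1 m2 ->
  strongly_close (Y1 := Y2) (Y2 := Y1) G delta m2 m1.
Proof.
move=> sep [rel [eta [Q [arel cQ h]]]].
have sw t := cid (exists_swap (Q t)).
exists (fun t y x => rel t x y), eta, (fun t => sval (sw t)); split.
- by move=> t Gt; apply: almost_isometry_flip; exact: arel.
- move=> t Gt; have [c1 c2] := cQ _ Gt; have [q1 q2 _] := svalP (sw t).
  by split=> A mA; rewrite ?q1 ?q2; [exact: c2|exact: c1].
move=> s t Gs Gt st; have [M [M0 mM tM IM]] := h _ _ Gs Gt st.
have mg : measurable_fun setT
    (fun z : borel (ambient Y2 t) * borel (ambient Y1 t) => (z.2, z.1)).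
  by apply/measurable_fun_pair => /=; [exact: measurable_snd|exact: measurable_fst].
exists (fun y x => M x y); split => //.
- exact: (measurableT_comp mM mg).
- move=> y x.
  have := transportable_swap (measurable_bridge (arel _ Gs) (sep _ Gs)) _ (tM x y).
  case=> [u v|q [q1 q2 qe]]; first by rewrite ltW// (bridge_gt0 (arel _ Gs)).
  exists q; split => //; apply: le_trans qe.
  by under eq_integral do rewrite bridge_flip.
- have [_ _ qI] := svalP (sw t).
  rewrite (qI (fun z => M z.2 z.1))//.
  exact: (measurableT_comp mM mg).
Qed.

End strongly_close.

Section comparisons.
Local Open Scope ereal_scope.
Context {R : realType} (b Theta H : R) (c : R -> R) (Z : flow R).
Hypothesis Theta0 : (0 < Theta)%R.
Hypothesis H0 : (0 <= H)%R.
Hypothesis rZ : regular_flow b Theta H c Z.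

Local Notation prob t := (borel_probability (ambient Z t) R).

Lemma measurable_modulus2 (T : pmetricType R) (h r K L : R) : separable_space T ->
  measurable_fun setT (fun z : borel T * borel T =>
    (modulus h r K L (@mdist R T z.1 z.2))%:E).
Proof.
move=> sT; apply/measurable_EFinP; have md := measurable_mdist sT.
rewrite /modulus; apply: measurable_funD; first exact: measurable_funD.
apply: measurable_funD; first by do 2 apply: measurable_funM => //.
by apply: measurable_funM => //; apply: measurable_funD => //; exact: measurable_funX.
Qed.

Lemma integral_modulus d (W : measurableType d) (q : probability W R)
    (X : W -> R) (h r K L A B : R) :
  measurable_fun setT X -> (forall w, 0 <= X w)%R ->
  (0 <= h)%R -> (0 < K)%R -> (0 <= L)%R ->
  \int[q]_w (X w)%:E <= A%:E -> \int[q]_w (X w ^+ 2)%:E <= B%:E ->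
  \int[q]_w (modulus h r K L (X w))%:E <=
    (h + (1 + K / 2 / Num.sqrt r) * A + (B + L) / K)%:E.
Proof.
move=> mX X0 h0 K0 L0 hA hB.
have Ki : (0 <= K^-1)%R by rewrite invr_ge0 ltW.
have c1 : (0 <= 1 + K / 2 / Num.sqrt r)%R.
  by rewrite addr_ge0// !divr_ge0// ?sqrtr_ge0// ltW.
have mXE : measurable_fun setT (fun w => (X w)%:E) by exact/measurable_EFinP.
have XE0 w : 0 <= (X w)%:E by rewrite lee_fin.
have mX2 : measurable_fun setT (fun w => (X w ^+ 2)%:E).
  by apply/measurable_EFinP; exact: measurable_funX.
have X20 w : 0 <= (X w ^+ 2)%:E by rewrite lee_fin sqr_ge0.
pose f1 w := (1 + K / 2 / Num.sqrt r)%:E * (X w)%:E.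
pose f2 w := (K^-1)%:E * (X w ^+ 2)%:E.
have mf1 : measurable_fun setT f1 by exact: measurable_funeM.
have mf2 : measurable_fun setT f2 by exact: measurable_funeM.
have f10 w : 0 <= f1 w by rewrite mule_ge0.
have f20 w : 0 <= f2 w by rewrite mule_ge0.
have mf12 : measurable_fun setT (fun w => f1 w + f2 w) by exact: emeasurable_funD.
have f120 w : 0 <= f1 w + f2 w by rewrite adde_ge0.
have hL0 : 0 <= (h + L / K)%:E by rewrite lee_fin addr_ge0// divr_ge0// ltW.
rewrite (eq_integral (fun w => (h + L / K)%:E + (f1 w + f2 w))); last first.
  move=> w _; rewrite /f1 /f2 -!EFinM -!EFinD; congr EFin.
  by rewrite /modulus; set y := (Num.sqrt r)^-1%R; set z := (K^-1)%R; lra.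
rewrite (integralDT q (measurable_cst _) (fun _ => hL0) mf12 f120).
rewrite integral_cstT (integralDT q mf1 f10 mf2 f20).
rewrite (integralZT q c1 mXE XE0) (integralZT q Ki mX2 X20).
apply: (@le_trans _ _ ((h + L / K)%:E + ((1 + K / 2 / Num.sqrt r)%:E * A%:E +
    K^-1%:E * B%:E))).
  by apply: leeD2l; apply: leeD; apply: lee_wpmul2l.
rewrite -!EFinM -!EFinD lee_fin.
by set y := (Num.sqrt r)^-1%R; set z := (K^-1)%R; lra.
Qed.

(** With the diagonal as relation: two conjugate heat flows that are close in total
    variation and have bounded variance are coupled at small mean distance, and the
    heat kernels at nearby points are close. *)
Lemma base_change_close (tau : R -> R) (G : set R) (m m' : forall u, prob u)
    (h r K K1 eta t1 C T delta : R) :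
  (forall t, G t -> (tau t < b)%R) ->
  (forall s t, G s -> G t -> (s <= t)%R -> (tau s <= tau t)%R /\
    (Theta * (tau t - tau s) <= T)%R) ->
  (forall t, G t -> forall A, measurable A -> m (tau t) A <= m' (tau t) A + t1%:E) ->
  (forall t, G t -> mutual_variance (m' (tau t)) (m (tau t)) +
    mutual_variance (m' (tau t)) (m' (tau t)) < C%:E) ->
  (0 < h)%R -> (0 < r)%R -> (0 < K)%R -> (0 < K1)%R -> (0 < eta)%R -> (0 <= T)%R ->
  (H * r <= h ^+ 2)%R ->
  (eta + (h + (1 + K / 2 / Num.sqrt r) * (K1 / 2 * t1 + K1^-1 * C) +
    (2 * C + (2 * H * T + 1)) / K) <= delta)%R ->
  strongly_close (Y1 := time_change Z tau) (Y2 := time_change Z tau) G delta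
    (fun t => m (tau t)) (fun t => m' (tau t)).
Proof.
move=> Gb Gtau hvar hV h0 r0 K0 K10 eta0 T0 Hr hdelta.
have L0 : (0 <= 2 * H * T + 1)%R by rewrite addr_ge0// !mulr_ge0.
have exQ t : exists Q : probability (borel (ambient Z (tau t)) *
    borel (ambient Z (tau t)))%type R, G t ->
    [/\ coupling (m (tau t)) (m' (tau t)) Q,
      \int[Q]_z (@mdist R (ambient Z (tau t)) z.1 z.2)%:E <=
        (K1 / 2 * t1 + K1^-1 * C)%:E &
      \int[Q]_z ((@mdist R (ambient Z (tau t)) z.1 z.2) ^+ 2)%:E <= (2 * C)%:E].
  have [Gt|nGt] := pselect (G t); last first.
    by have [q _] := exists_prod (m (tau t)) (m (tau t)); exists q.
  have seps := regular_separable rZ (Gb _ Gt).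
  have [Q [Q1 Q2 QI]] := total_variation_coupling (hvar _ Gt).
  exists Q => _.
  pose V (p : borel (ambient Z (tau t))) :=
    \int[m (tau t)]_x ((@mdist R (ambient Z (tau t)) p x) ^+ 2)%:E +
    \int[m' (tau t)]_x ((@mdist R (ambient Z (tau t)) p x) ^+ 2)%:E.
  have [p Vp] : exists p, V p < C%:E.
    apply: (exists_le_integral (P := m' (tau t))).
      by move=> p; rewrite adde_ge0//; exact: mean2_ge0.
    rewrite integralDT; [exact: hV|exact: measurable_mean2| |exact: measurable_mean2|].
      by move=> p; exact: mean2_ge0.
    by move=> p; exact: mean2_ge0.
  have mp : measurable_fun setT (fun x : borel (ambient Z (tau t)) =>
      ((@mdist R (ambient Z (tau t)) p x) ^+ 2)%:E).
    rewrite (_ : (fun x => _) = (fun x : borel (ambient Z (tau t)) =>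
      ((@mdist R (ambient Z (tau t)) x p) ^+ 2)%:E)); first exact: measurable_mdist2l.
    by apply/funext => x; rewrite mdistC.
  have p0 (x : borel (ambient Z (tau t))) :
    0 <= ((@mdist R (ambient Z (tau t)) p x) ^+ 2)%:E by rewrite lee_fin sqr_ge0.
  have mkp k : measurable_fun setT (fun x : borel (ambient Z (tau t)) =>
      k%:E * ((@mdist R (ambient Z (tau t)) p x) ^+ 2)%:E) by exact: measurable_funeM.
  have kp0 k (x : borel (ambient Z (tau t))) : (0 <= k)%R ->
    0 <= k%:E * ((@mdist R (ambient Z (tau t)) p x) ^+ 2)%:E.
    by move=> k0; rewrite mule_ge0.
  have md := measurable_mdistE seps; have md2 := measurable_mdist2 seps.
  have Ki : (0 <= K1^-1)%R by rewrite invr_ge0 ltW.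
  have bound k F (f : borel (ambient Z (tau t)) * borel (ambient Z (tau t)) -> \bar R) :
    (0 <= k)%R -> (0 <= F)%R -> measurable_fun setT f -> (forall z, 0 <= f z) ->
    (forall x, f (x, x) = 0) ->
    (forall x y, f (x, y) <= F%:E + k%:E * ((@mdist R (ambient Z (tau t)) p x) ^+ 2)%:E
      + k%:E * ((@mdist R (ambient Z (tau t)) p y) ^+ 2)%:E) ->
    \int[Q]_z f z <= (F * t1 + k * C)%:E.
    move=> k0 F0 mf f0 fd fF.
    apply: le_trans (QI f F _ _ mf f0 fd F0 (mkp k) _ (mkp k) _ fF) _.
    - by move=> x; exact: kp0.
    - by move=> x; exact: kp0.
    rewrite !integralZT// -addeA -ge0_muleDr//; last 2 first.
    - by apply: integral_ge0.
    - by apply: integral_ge0.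
    by rewrite EFinD leeD2l// EFinM lee_wpmul2l// ltW.
  split.
  - by split.
  - apply: bound => //; first by rewrite divr_ge0// ltW.
    - by move=> z; rewrite lee_fin mdist_ge0.
    - by move=> x; rewrite /= mdistxx.
    - by move=> x y; rewrite -!EFinM -!EFinD lee_fin; exact: mdist_sqr_split.
  - apply: le_trans (bound 2%R 0%R _ _ _ md2 _ _ _) _ => //.
    - by move=> z; rewrite lee_fin sqr_ge0.
    - by move=> x; rewrite /= mdistxx expr0n.
    - move=> x y; rewrite add0e -!EFinM -!EFinD lee_fin /=.
      have t3 := mdist_tri p (x : ambient Z (tau t)) y.
      rewrite (mdistC (x : ambient Z (tau t)) p) in t3.
      have h2 := ler_pXn2r (n := 2) isT (mdist_ge0 (x : ambient Z (tau t)) y)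
        (addr_ge0 (mdist_ge0 p x) (mdist_ge0 p y)).
      rewrite t3 sqrrD in h2; move: (sqr_ge0 (mdist p x - mdist p y)) h2.
      by rewrite sqrrB; lra.
    by rewrite mul0r add0r.
pose Q t := sval (cid (exQ t)); have QP t := svalP (cid (exQ t)).
exists (fun t x y => x = y), (fun=> eta), Q; split.
- move=> t Gt; split => //; first by exists point, point.
  by move=> x y x' y' -> ->; rewrite subrr normr0 mulr_ge0// ltW.
- by move=> t /QP[].
move=> s t Gs Gt st; have [sta stT] := Gtau _ _ Gs Gt st.
have tb := Gb _ Gt; have sb := Gb _ Gs.
have sept := regular_separable rZ tb; have seps := regular_separable rZ sb.
have [Qc Q1 Q2] := QP _ Gt.
pose L := (2 * H * T + 1)%R.
pose M (x y : ambient Z (tau t)) : \bar R := (eta + modulus h r K L (mdist x y))%:E.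
have mod0 (x y : ambient Z (tau t)) : (0 <= modulus h r K L (mdist x y))%R.
  by case: (modulus_ge r (ltW h0) K0 L0 (mdist_ge0 x y)).
have mmod := measurable_modulus2 h r K L sept.
have mod0E (z : borel (ambient Z (tau t)) * borel (ambient Z (tau t))) :
  0 <= (modulus h r K L (@mdist R (ambient Z (tau t)) z.1 z.2))%:E.
  by rewrite lee_fin.
exists M; split.
- by move=> x y; rewrite lee_fin addr_ge0// ltW.
- have mM : measurable_fun setT
      (fun z : borel (ambient Z (tau t)) * borel (ambient Z (tau t)) =>
        eta%:E + (modulus h r K L (@mdist R (ambient Z (tau t)) z.1 z.2))%:E).
    exact: emeasurable_funD.
  exact: mM.
- move=> x y; have dirx := evolves_dirac rZ x sta tb.
  have [q [[q1 q2] qI]] := kernel_coupling Theta0 H0 rZ y sta tb dirx h0 r0 K0 Hr stT.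
  exists q; split => //.
  apply: (@le_trans _ _ (\int[q]_z (eta%:E + (@mdist R (ambient Z (tau s)) z.1 z.2)%:E))).
    have ar : almost_isometry (fun x y : ambient Z (tau s) => x = y) eta.
      split => //; first by exists point, point.
      by move=> x1 y1 x2 y2 -> ->; rewrite subrr normr0 mulr_ge0// ltW.
    apply: le_integral_ge0 => z; first by rewrite lee_fin ltW// (bridge_gt0 ar).
    rewrite -EFinD lee_fin.
    have := bridge_le ar (z.1 : ambient Z (tau s)) (z.2 : ambient Z (tau s))
      (erefl (z.2 : ambient Z (tau s))).
    by rewrite mdistxx addr0 addrC.
  rewrite integralDT//; last 3 first.
  - by move=> _; rewrite lee_fin ltW.
  - exact: measurable_mdistE.
  - by move=> z; rewrite lee_fin mdist_ge0.
  rewrite integral_cstT /M EFinD leeD2l//; apply: le_trans qI _.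
  rewrite integral_dirac//; last exact: measurable_modulus.
  by rewrite diracT mul1e.
- have eta00 : 0 <= eta%:E by rewrite lee_fin ltW.
  rewrite (integralDT (Q t) (measurable_cst _) (fun _ => eta00) mmod mod0E).
  rewrite integral_cstT.
  apply: le_trans (leeD2l _ (integral_modulus r (measurable_mdist sept) _ (ltW h0) K0 L0
    Q1 Q2)) _.
    by move=> z; exact: mdist_ge0.
  by rewrite -EFinD lee_fin.
Qed.

End comparisons.

Section shift.
Local Open Scope ereal_scope.
Context {R : realType} (b Theta H : R) (c : R -> R) (Z : flow R).
Hypothesis Theta0 : (0 < Theta)%R.
Hypothesis H0 : (0 <= H)%R.
Hypothesis rZ : regular_flow b Theta H c Z.

Local Notation prob t := (borel_probability (ambient Z t) R).

Lemma exists_evolution_coupling s u (mu : prob u) (mu' : prob s) :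
  (s <= u)%R -> (u < b)%R -> evolves mu mu' ->
  exists Q : probability (borel (ambient Z u) * borel (ambient Z s))%type R,
    coupling mu mu' Q /\
    forall f : borel (ambient Z u) * borel (ambient Z s) -> \bar R,
      measurable_fun setT f -> (forall z, 0 <= f z) ->
      \int[Q]_z f z = \int[mu]_x \int[hker Z (x : ambient Z u) s]_y f (x, y).
Proof.
move=> su ub ev.
have mk := regular_kernel rZ su ub.
have [Q QE] := exists_kprod mu mk; exists Q; split => //; split => A mA.
- have mA' : measurable (A `*` [set: borel (ambient Z s)]) by exact: measurableX.
  rewrite -[LHS]integral_indicT// QE//; last exact: measurable_indicE.
  rewrite -[RHS]integral_indicT//; apply: eq_integral => x _.
  rewrite (eq_integral (cst (\1_A x)%:E)) ?integral_cstT//.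
  by move=> y _; rewrite /= !indicE in_setX in_setT andbT.
- have mA' : measurable ([set: borel (ambient Z u)] `*` A) by exact: measurableX.
  rewrite -[LHS]integral_indicT// QE//; last exact: measurable_indicE.
  rewrite ev//; apply: eq_integral => x _.
  rewrite -[RHS]integral_indicT//; apply: eq_integral => y _.
  by rewrite /= !indicE in_setX in_setT.
Qed.

(** A heat kernel of the first flow is first moved to that of the second at the same
    point by means of the bridge, and then, inside the second flow, to the heat kernel
    at the point to which the heat kernel has moved the point. *)
Lemma shift_close (tau1 tau2 : R -> R) (G : set R) (m : forall u, prob u)
    (h r K eta e1 B1 rho T delta : R) :
  (forall t, G t -> (tau2 t <= tau1 t)%R /\ (tau1 t < b)%R) ->
  (forall s t, G s -> G t -> (s <= t)%R -> [/\ (tau1 s <= tau1 t)%R,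
    (tau2 s <= tau2 t)%R & (Theta * (tau2 t - tau2 s) <= T)%R]) ->
  (forall s u, (s <= u)%R -> (u < b)%R -> evolves (m u) (m s)) ->
  (forall t, G t -> (Theta * H * (tau1 t - tau2 t) <= e1 ^+ 2)%R) ->
  (forall t, G t -> exists rel, almost_isometry rel eta /\
    \int[m (tau1 t)]_z \int[hker Z (z : ambient Z (tau1 t)) (tau2 t)]_w
      (bridge rel eta (z : ambient Z (tau1 t)) (w : ambient Z (tau2 t)))%:E <= B1%:E) ->
  (0 < h)%R -> (0 < r)%R -> (0 < K)%R -> (0 < e1)%R -> (0 < rho)%R -> (0 <= T)%R ->
  (H * r <= h ^+ 2)%R ->
  (B1 + rho + (h + (1 + K / 2 / Num.sqrt r) * e1 +
    (e1 ^+ 2 + (2 * H * T + 1)) / K) <= delta)%R ->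
  strongly_close (Y1 := time_change Z tau1) (Y2 := time_change Z tau2) G delta
    (fun t => m (tau1 t)) (fun t => m (tau2 t)).
Proof.
move=> Gb Gtau ev he1 hrel h0 r0 K0 e10 rho0 T0 Hr hdelta.
set L := (2 * H * T + 1)%R in hdelta *.
have L0 : (0 <= L)%R by rewrite addr_ge0// !mulr_ge0.
have exrel t : exists rel : ambient Z (tau1 t) -> ambient Z (tau2 t) -> Prop,
    G t -> almost_isometry rel eta /\
    \int[m (tau1 t)]_z \int[hker Z (z : ambient Z (tau1 t)) (tau2 t)]_w
      (bridge rel eta (z : ambient Z (tau1 t)) (w : ambient Z (tau2 t)))%:E <= B1%:E.
  by have [/hrel[rel ?]|nGt] := pselect (G t); [exists rel|exists (fun _ _ => True)].
have exQ t : exists Q : probability (borel (ambient Z (tau1 t)) *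
      borel (ambient Z (tau2 t)))%type R, G t ->
    coupling (m (tau1 t)) (m (tau2 t)) Q /\
    forall f : borel (ambient Z (tau1 t)) * borel (ambient Z (tau2 t)) -> \bar R,
      measurable_fun setT f -> (forall z, 0 <= f z) ->
      \int[Q]_z f z = \int[m (tau1 t)]_x
        \int[hker Z (x : ambient Z (tau1 t)) (tau2 t)]_y f (x, y).
  have [/Gb[t21 tb]|nGt] := pselect (G t); last first.
    by have [q _] := exists_prod (m (tau1 t)) (m (tau2 t)); exists q.
  by have [Q QP] := exists_evolution_coupling t21 tb (ev _ _ t21 tb); exists Q.
pose rel t := sval (cid (exrel t)); have relP t := svalP (cid (exrel t)).
pose Q t := sval (cid (exQ t)); have QP t := svalP (cid (exQ t)).
exists rel, (fun=> eta), Q; split.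
- by move=> t /relP[].
- by move=> t /QP[].
move=> s t Gs Gt st; have [s1t1 s2t2 stT] := Gtau _ _ Gs Gt st.
have [s21 s1b] := Gb _ Gs; have [t21 t1b] := Gb _ Gt.
have s2b := le_lt_trans s21 s1b; have t2b := le_lt_trans t21 t1b.
have [ars hB] := relP _ Gs; have [_ QI] := QP _ Gt.
have sepS1 := regular_separable rZ s1b; have sepS2 := regular_separable rZ s2b.
have sepT1 := regular_separable rZ t1b; have sepT2 := regular_separable rZ t2b.
have mbr := measurable_bridge ars sepS1.
have br0 (z : borel (ambient Z (tau1 s)) * borel (ambient Z (tau2 s))) :
  0 <= (bridge (rel s) eta (z.1 : ambient Z (tau1 s)) (z.2 : ambient Z (tau2 s)))%:E.
  by rewrite lee_fin ltW// (bridge_gt0 ars).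
have mkS := regular_kernel rZ s21 s1b.
have mkT := regular_kernel rZ t21 t1b.
pose F (z : borel (ambient Z (tau1 s))) := \int[hker Z (z : ambient Z (tau1 s)) (tau2 s)]_w
   (bridge (rel s) eta (z : ambient Z (tau1 s)) (w : ambient Z (tau2 s)))%:E.
have mF : measurable_fun setT F by exact: (measurable_kernel_integral mkS br0 mbr).
have F0 z : 0 <= F z by apply: integral_ge0 => w _; exact: (br0 (z, w)).
pose M1 (x : borel (ambient Z (tau1 t))) := \int[hker Z (x : ambient Z (tau1 t)) (tau1 s)]_z F z.
have mkST := regular_kernel rZ s1t1 t1b.
have mM1 : measurable_fun setT M1.
  exact: (measurable_kernel_integral1 mkST).
have M10 x : 0 <= M1 x by exact: integral_ge0.
pose md (z : borel (ambient Z (tau2 t)) * borel (ambient Z (tau2 t))) : \bar R :=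
  (modulus h r K L (@mdist R (ambient Z (tau2 t)) z.1 z.2))%:E.
have mmd : measurable_fun setT md by exact: measurable_modulus2.
have md0 z : 0 <= md z.
  by rewrite lee_fin; case: (modulus_ge r (ltW h0) K0 L0 (mdist_ge0 (z.1 : ambient Z (tau2 t)) z.2)).
pose M2 (v : borel (ambient Z (tau1 t)) * borel (ambient Z (tau2 t))) : \bar R :=
  \int[hker Z (v.1 : ambient Z (tau1 t)) (tau2 t)]_y' md (y', v.2).
have mM2 : measurable_fun setT M2.
  have mk1 : kernel_like (fun v : borel (ambient Z (tau1 t)) * borel (ambient Z (tau2 t))
      => hker Z (v.1 : ambient Z (tau1 t)) (tau2 t)).
    by move=> A mA; exact: (measurableT_comp (mkT A mA) measurable_fst).
  apply: (measurable_kernel_integral mk1 (f := fun w => md (w.2, w.1.2))) => //.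
  have mg : measurable_fun setT (fun w : (borel (ambient Z (tau1 t)) *
      borel (ambient Z (tau2 t))) * borel (ambient Z (tau2 t)) => (w.2, w.1.2)).
    apply/measurable_fun_pair => /=; first exact: measurable_snd.
    exact: (measurableT_comp measurable_snd measurable_fst).
  exact: (measurableT_comp mmd mg).
have M20 v : 0 <= M2 v by exact: integral_ge0.
have mM2' : measurable_fun setT (fun v : borel (ambient Z (tau1 t)) *
    borel (ambient Z (tau2 t)) => M2 (v.1, v.2)).
  by rewrite (_ : (fun v : borel (ambient Z (tau1 t)) *
    borel (ambient Z (tau2 t)) => M2 (v.1, v.2)) = M2)//; apply/funext => -[].
pose M (x : ambient Z (tau1 t)) (y : ambient Z (tau2 t)) : \bar R :=
  M1 x + rho%:E + M2 (x, y).
have mM1' : measurable_fun setT (fun v : borel (ambient Z (tau1 t)) *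
    borel (ambient Z (tau2 t)) => M1 v.1).
  exact: (measurableT_comp mM1 measurable_fst).
have mM1r : measurable_fun setT (fun v : borel (ambient Z (tau1 t)) *
    borel (ambient Z (tau2 t)) => M1 v.1 + rho%:E) by exact: emeasurable_funD.
have M1r0 (v : borel (ambient Z (tau1 t)) * borel (ambient Z (tau2 t))) :
    0 <= M1 v.1 + rho%:E by rewrite adde_ge0// lee_fin ltW.
have mM : measurable_fun setT (fun v : borel (ambient Z (tau1 t)) *
    borel (ambient Z (tau2 t)) => M1 v.1 + rho%:E + M2 (v.1, v.2)).
  exact: emeasurable_funD.
exists M; split.
- by move=> x y; rewrite adde_ge0//; exact: (M1r0 (x, y)).
- exact: mM.
- move=> x y.
  have ex1 : evolves (hker Z x (tau1 s)) (hker Z x (tau2 s)).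
    exact: (evolves_kernel rZ).
  have [q1 [[q11 q12] q1I]] := exists_evolution_coupling s21 s1b ex1.
  have ex2 : evolves (hker Z x (tau2 t)) (hker Z x (tau2 s)).
    exact: (evolves_kernel rZ).
  have [q2 [[q21 q22] q2I]] := kernel_coupling Theta0 H0 rZ y s2t2 t2b ex2 h0 r0 K0 Hr stT.
  have tr1 : @transportable R _ _ (borel (ambient Z (tau1 s))) (borel (ambient Z (tau2 s)))
      (bridge (rel s) eta) (hker Z x (tau1 s)) (hker Z x (tau2 s)) (M1 x).
    by exists q1; split => //; rewrite q1I.
  have tr2 : @transportable R _ _ (borel (ambient Z (tau2 s))) (borel (ambient Z (tau2 s)))
      (fun w w' => @mdist R (ambient Z (tau2 s)) w w')
      (hker Z x (tau2 s)) (hker Z y (tau2 s)) (M2 (x, y)).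
    by exists q2; split.
  apply: (transportable_trans sepS2 rho0 mbr _ _ _ _ tr1 tr2).
  - by move=> z w; rewrite ltW// (bridge_gt0 ars).
  - by move=> z w; exact: mdist_ge0.
  - by move=> z w; rewrite ltW// (bridge_gt0 ars).
  - move=> z w w' w''; apply: le_trans (bridge_lipr ars z w'' w) _.
    by rewrite -addrA lerD2l; exact: mdist_tri.
- rewrite (integralDT (Q t) mM1r M1r0 mM2' (fun v => M20 (v.1, v.2))).
  have rho00 : 0 <= rho%:E by rewrite lee_fin ltW.
  rewrite (integralDT (Q t) mM1' (fun v => M10 v.1) (measurable_cst _) (fun _ => rho00)).
  rewrite integral_cstT.
  have I1 : \int[Q t]_v M1 v.1 <= B1%:E.
    rewrite (QI (fun v => M1 v.1) mM1' (fun v => M10 v.1)).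
    rewrite (eq_integral M1); last by move=> x _; rewrite /= integral_cstT.
    by rewrite -(integral_evolves rZ s1t1 t1b (ev _ _ s1t1 t1b) mF F0).
  have I2 : \int[Q t]_v M2 (v.1, v.2) <= (h + (1 + K / 2 / Num.sqrt r) * e1 +
      (e1 ^+ 2 + L) / K)%:E.
    rewrite (QI (fun v => M2 (v.1, v.2)) mM2' (fun v => M20 (v.1, v.2))).
    apply: integral_le_cst => x; first by apply: integral_ge0 => y _; exact: M20.
    pose nu := hker Z (x : ambient Z (tau1 t)) (tau2 t).
    have [q [_ _ qE]] := exists_prod nu nu.
    rewrite (eq_integral (fun y => \int[nu]_y' md (y, y'))); last first.
      by move=> y _; apply: eq_integral => y' _; rewrite /md mdistC.
    rewrite -(qE md mmd md0).
    have V : mutual_variance nu nu <= (e1 ^+ 2)%:E.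
      apply: le_trans (regular_concentrated rZ t21 t1b x x) _.
      by rewrite mdistxx expr0n add0r lee_fin; exact: he1.
    apply: integral_modulus => //.
    - exact: measurable_mdist.
    - by move=> z; exact: mdist_ge0.
    - exact: ltW.
    - rewrite (qE (fun z => (@mdist R (ambient Z (tau2 t)) z.1 z.2)%:E)); last 2 first.
      + exact: measurable_mdistE.
      + by move=> z; rewrite lee_fin mdist_ge0.
      exact: mean_dist_le.
    - rewrite (qE (fun z => ((@mdist R (ambient Z (tau2 t)) z.1 z.2) ^+ 2)%:E)) => //.
      + exact: measurable_mdist2.
      + by move=> z; rewrite lee_fin sqr_ge0.
  apply: (@le_trans _ _ (B1%:E + rho%:E + (h + (1 + K / 2 / Num.sqrt r) * e1 +
      (e1 ^+ 2 + L) / K)%:E)); last by rewrite -!EFinD lee_fin.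
  by apply: leeD => //; exact: leeD2r.
Qed.

End shift.

(** * Comparison at small scales *)

Section good_times.
Context {R : realType}.

(** On a grid of mesh [e] the increments of [g] over two consecutive cells telescope,
    hence few of them exceed [d]; the bad set consists of the cells where they do. *)
Lemma small_increments (g : R -> R) (a e d : R) (n : nat) :
  {homo g : x y / x <= y} -> 0 < e -> 0 < d ->
  exists E : set R, [/\ measurable E, E `<=` `[a, a + n%:R * e],
    forall t, a <= t -> t < a + n%:R * e -> ~ E t -> g t - g (t - e) <= d &
    (lebesgue_measure E <=
      (d^-1 * (e * (g (a + n%:R * e) + g (a + (n%:R - 1) * e) - g a - g (a - e))))%:E)%E].
Proof.
move=> gm e0 d0.
have di : 0 < d^-1 by rewrite invr_gt0.
elim: n => [|n [E [mE EI Eg lE]]].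
  exists set0; split => //.
  - by move=> t at_; rewrite mul0r addr0 => ta; move: (le_lt_trans at_ ta); rewrite ltxx.
  - rewrite measure0 mul0r addr0 sub0r mulN1r lee_fin.
    by rewrite mulr_ge0 ?(ltW di)// mulr_ge0 ?(ltW e0)//; lra.
pose p k : R := a + k * e.
have [small|big] := leP (g (p (n%:R + 1)) - g (p (n%:R - 1))) d.
  exists E; split => //.
  - apply: subset_trans EI _; apply: subset_itvl; rewrite bnd_simp lerD2l ler_pM2r//.
    by rewrite ler_nat.
  - move=> t at_ tb nE; have [tn|nt] := ltP t (a + n%:R * e); first exact: Eg.
    apply: le_trans small; apply: lerB; apply: gm.
      by rewrite /p -natr1 in tb *; exact: ltW.
    by rewrite /p mulrBl mul1r addrA lerB.
  - apply: le_trans lE _; rewrite lee_fin; apply: ler_wpM2l; first exact: ltW.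
    apply: ler_wpM2l; first exact: ltW.
    rewrite -natr1 addrK.
    have := gm (p n%:R) (p (n%:R + 1)); have := gm (p (n%:R - 1)) (p n%:R).
    rewrite /p !lerD2l !ler_pM2r//.
    by move=> /(_ ltac:(lra)) h1 /(_ ltac:(lra)) h2; lra.
exists (E `|` `[a + n%:R * e, a + n.+1%:R * e[%classic); split.
- exact: measurableU.
- move=> t [/EI|] /=; rewrite !in_itv /= => /andP[h1 h2]; apply/andP; split => //.
  + by apply: le_trans h2 _; rewrite lerD2l ler_pM2r// ler_nat.
  + by apply: le_trans h1; rewrite lerDl mulr_ge0// ltW.
  + exact: ltW.
- move=> t at_ tb /not_orP[nE nI]; apply: Eg => //.
  rewrite ltNge; apply/negP => nt; apply: nI; rewrite /= in_itv /=.
  by rewrite nt.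
- have lI : (lebesgue_measure (`[(a + n%:R * e)%R, (a + n.+1%:R * e)%R[%classic : set R) =
      e%:E)%E.
    rewrite lebesgue_measure_itv /= lte_fin ltrD2l ltr_pM2r// ltr_nat ltnSn.
    by rewrite -EFinB -natr1; congr EFin; lra.
  have lI' : (lebesgue_measure (`[(a + n%:R * e)%R, (a + n.+1%:R * e)%R[%classic : set R) <=
      e%:E)%E by rewrite lI.
  apply: le_trans (measureU2 _ _ _) _ => //.
  apply: le_trans (leeD lE lI') _; rewrite -EFinD lee_fin -natr1.
  have eE : e = d^-1 * (e * d) by rewrite mulrCA mulVf ?gt_eqF// mulr1.
  rewrite [X in _ + X <= _]eE -mulrDr -mulrDr ler_pM2l// ler_pM2l// addrK.
  by move: big; rewrite /p; lra.
Qed.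

Lemma near_mul_lt (X y : R) : 0 < y -> \forall Th \near 0^'+, Th * X < y.
Proof.
move=> y0; near=> Th.
have Th0 : 0 < Th by near: Th; exact: nbhs_right_gt.
apply: (@le_lt_trans _ _ (Th * (`|X| + 1))).
  by rewrite ler_pM2l//; have := ler_norm X; lra.
rewrite -ltr_pdivlMr; last by have := normr_ge0 X; lra.
near: Th; apply: nbhs_right_lt; rewrite divr_gt0//.
Unshelve. all: by end_near. Qed.

End good_times.

Section variation.
Local Open Scope ereal_scope.
Context {R : realType} (b Theta H : R) (c : R -> R) (Z : flow R).
Hypothesis Theta0 : (0 < Theta)%R.
Hypothesis H0 : (0 <= H)%R.
Hypothesis rZ : regular_flow b Theta H c Z.

Local Notation prob t := (borel_probability (ambient Z t) R).

(** By [regular_variation] the total variation is at most the mean distance divided by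
    [Num.sqrt (Theta * (u - s))], and [Theta] cancels. *)
Lemma variation_evolves s u (P P' : prob u) (Q Q' : prob s) (C0 : R) :
  (s < u)%R -> (u < b)%R -> (0 < C0)%R -> evolves P Q -> evolves P' Q' ->
  mutual_variance P P' <= (Theta * C0 ^+ 2)%:E ->
  forall A, measurable A -> Q A <= Q' A + (C0 / Num.sqrt (u - s))%:E.
Proof.
move=> su ub C00 PQ PQ' V A mA.
have us0 : (0 < u - s)%R by rewrite subr_gt0.
have sepu := regular_separable rZ ub.
have mk := regular_kernel rZ (ltW su) ub.
have sT : (0 < Num.sqrt Theta)%R by rewrite sqrtr_gt0.
have D0 : (0 < Num.sqrt (Theta * (u - s)))%R by rewrite sqrtr_gt0 mulr_gt0.
have hd : \int[P]_x \int[P']_y (@mdist R (ambient Z u) x y)%:E <=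
    (Num.sqrt Theta * C0)%:E.
  apply: mean_dist_le => //; first by rewrite mulr_gt0.
  by rewrite exprMn sqr_sqrtr// ltW.
have [q [q1 q2 qE]] := exists_prod P P'.
have mkA := mk A mA.
have mk1 : measurable_fun setT (fun z : borel (ambient Z u) * borel (ambient Z u) =>
  hker Z (z.1 : ambient Z u) s A) by exact: (measurableT_comp mkA measurable_fst).
have mk2 : measurable_fun setT (fun z : borel (ambient Z u) * borel (ambient Z u) =>
  hker Z (z.2 : ambient Z u) s A) by exact: (measurableT_comp mkA measurable_snd).
set D := (Num.sqrt (Theta * (u - s)))^-1%R.
have Dge : (0 <= D)%R by rewrite invr_ge0 ltW.
have md := measurable_mdistE sepu.
have d0 (z : borel (ambient Z u) * borel (ambient Z u)) :
  0 <= (@mdist R (ambient Z u) z.1 z.2)%:E by rewrite lee_fin mdist_ge0.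
have mDd : measurable_fun setT (fun z : borel (ambient Z u) * borel (ambient Z u) =>
  D%:E * (@mdist R (ambient Z u) z.1 z.2)%:E) by exact: measurable_funeM.
have Dd0 (z : borel (ambient Z u) * borel (ambient Z u)) :
  0 <= D%:E * (@mdist R (ambient Z u) z.1 z.2)%:E by rewrite mule_ge0.
have k0 (x : ambient Z u) : 0 <= hker Z x s A by [].
rewrite (PQ A mA) (PQ' A mA).
have -> : \int[P]_x hker Z (x : ambient Z u) s A =
    \int[q]_z hker Z (z.1 : ambient Z u) s A.
  rewrite (qE (fun z => hker Z (z.1 : ambient Z u) s A))//.
  by apply: eq_integral => x _; rewrite /= integral_cstT.
have -> : \int[P']_x hker Z (x : ambient Z u) s A =
    \int[q]_z hker Z (z.2 : ambient Z u) s A.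
  by rewrite (qE (fun z => hker Z (z.2 : ambient Z u) s A))// /= integral_cstT.
apply: (@le_trans _ _ (\int[q]_z (hker Z (z.2 : ambient Z u) s A +
    D%:E * (@mdist R (ambient Z u) z.1 z.2)%:E))).
  apply: le_integral_ge0 => z; first exact: k0.
  by rewrite -EFinM [(D * _)%R]mulrC; exact: (regular_variation rZ).
rewrite (integralDT q mk2 (fun z => k0 z.2) mDd Dd0) leeD2l//.
rewrite (integralZT q Dge md d0).
rewrite (qE (fun z => (@mdist R (ambient Z u) z.1 z.2)%:E) md d0).
apply: le_trans (lee_wpmul2l _ hd) _; first by rewrite lee_fin.
rewrite -EFinM lee_fin /D sqrtrM ?(ltW Theta0)// invfM.
rewrite mulrACA mulVf ?gt_eqF// mul1r mulrC; exact: lexx.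
Qed.

End variation.

Section constants.
Context {R : realType}.

(** Every summand is made at most [delta / 8]: first those of [h] and [K], which fix the
    factor of the mean distance, then those of [K1] and [t1]. *)
Lemma base_change_constants (H T C delta : R) : 0 <= H -> 0 <= T -> 0 < C -> 0 < delta ->
  exists h r K K1 eta t1, [/\ [/\ 0 < h, 0 < r, 0 < K, 0 < K1 & 0 < eta],
    0 < t1, H * r <= h ^+ 2 &
    eta + (h + (1 + K / 2 / Num.sqrt r) * (K1 / 2 * t1 + K1^-1 * C) +
      (2 * C + (2 * H * T + 1)) / K) <= delta].
Proof.
move=> H0 T0 C0 d0.
have e0 : 0 < delta / 8 by rewrite divr_gt0.
set h := delta / 8 in e0 *.
have H1 : 0 < H + 1 by lra.
have r0 : 0 < h ^+ 2 / (H + 1) by rewrite divr_gt0// exprn_gt0.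
set r := h ^+ 2 / (H + 1) in r0 *.
have HT : 0 <= H * T by rewrite mulr_ge0.
have L0 : 0 < 2 * C + (2 * H * T + 1) by rewrite -[2 * H * T]mulrA; lra.
set L := 2 * C + (2 * H * T + 1) in L0 *.
have K0 : 0 < L / h by rewrite divr_gt0.
have q0 : 0 < 1 + L / h / 2 / Num.sqrt r.
  by rewrite addr_gt0// !divr_gt0// sqrtr_gt0.
set q := 1 + L / h / 2 / Num.sqrt r in q0 *.
have K10 : 0 < q * C / h by rewrite divr_gt0// mulr_gt0.
set K1 := q * C / h in K10 *.
have K120 : 0 < K1 / 2 by rewrite divr_gt0.
have t10 : 0 < h / q / (K1 / 2) by apply: divr_gt0 => //; exact: divr_gt0.
set t1 := h / q / (K1 / 2) in t10 *.
exists h, r, (L / h), K1, h, t1; split => //.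
  rewrite /r mulrCA -[leRHS]mulr1 ler_pM2l ?exprn_gt0//.
  by rewrite ler_pdivrMr// mul1r; lra.
rewrite -/q; have -> : L / (L / h) = h.
  by rewrite invf_div mulrCA mulfV ?gt_eqF// mulr1.
have -> : q * (K1 / 2 * t1 + K1^-1 * C) = h + h.
  rewrite mulrDr; congr (_ + _).
    by rewrite /t1 [K1 / 2 * _]mulrC divfK ?gt_eqF// mulrC divfK ?gt_eqF.
  by rewrite /K1 invf_div mulrAC mulrA [q * (h * C)]mulrCA mulfK// gt_eqF// mulr_gt0.
rewrite /h; lra.
Qed.
End constants.

Section asymptotics.
Context {R : realType}.

Definition scaled_time (Th o t : R) : R := t / Th + o.

Lemma scaled_time_le (Th sig X o v : R) : 0 < Th -> Th * (o + X) <= sig -> v <= - sig ->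
  scaled_time Th o v <= - X.
Proof.
rewrite /scaled_time => Th0 h hv.
have : v / Th <= - (o + X); last by lra.
by rewrite ler_pdivrMr// mulrC; lra.
Qed.

Lemma scaled_time_diff (Th o o' v w : R) : 0 < Th ->
  Th * (scaled_time Th o v - scaled_time Th o' w) = v - w + Th * (o - o').
Proof.
by move=> Th0; rewrite /scaled_time opprD addrACA mulrDr mulrBr [Th * (v / Th)]mulrC divfK ?gt_eqF//
  [Th * (w / Th)]mulrC divfK ?gt_eqF// mulrBr.
Qed.

(** At a small scale the base point does not matter: up to a small time before
    the top, the conjugate heat flows have had, after scaling, a long time to
    mix. *)
Lemma base_change_asymptotic (c : R -> R) (H b b1 o C0 T delta : R) :
  0 <= H -> b1 < b -> 0 < C0 -> 0 <= T -> 0 < delta ->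
  \forall Th \near (0 : R)^'+, forall Z : flow R, regular_flow b Th H c Z ->
    forall m m' : forall u, borel_probability (ambient Z u) R,
    (forall s u, s <= u -> u < b -> evolves (m u) (m s)) ->
    (forall s u, s <= u -> u < b -> evolves (m' u) (m' s)) ->
    (mutual_variance (m b1) (m' b1) <= (Th * C0 ^+ 2)%:E)%E ->
    (mutual_variance (m' b1) (m b1) <= (Th * C0 ^+ 2)%:E)%E ->
    (mutual_variance (m' b1) (m' b1) <= (Th * C0 ^+ 2)%:E)%E ->
    exists E : set R, [/\ measurable E, E `<=` `[- T, 0],
      (lebesgue_measure E <= (delta ^+ 2)%:E)%E,
      forall t, (`[- T, 0] `\` E) t -> scaled_time Th o t < b &
      strongly_close (Y1 := time_change Z (scaled_time Th o))
        (Y2 := time_change Z (scaled_time Th o)) (`[- T, 0] `\` E) delta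
        (fun t => m (scaled_time Th o t)) (fun t => m' (scaled_time Th o t))].
Proof.
move=> H0 b1b C00 T0 d0.
pose sig := delta ^+ 2.
have sig0 : 0 < sig by rewrite exprn_gt0.
have HT : 0 <= H * T by rewrite mulr_ge0.
have [|h [r [K [K1 [eta [t1 [[h0 r0 K0 K10 eta0] t10 Hr hd]]]]]]] :=
  @base_change_constants R H T (2 * (H * T) + 3) delta H0 T0 _ d0; first by lra.
have hX := @near_mul_lt R (o + ((C0 / t1) ^+ 2 + 1 - b1)) _ sig0.
have hY := @near_mul_lt R (C0 ^+ 2 + H * (b1 - o)) _ ltr01.
have hTh : \forall Th \near (0 : R)^'+, 0 < Th by exact: nbhs_right_gt.
apply: filterS3 hTh hX hY => Th Th0 /ltW {}hX /ltW {}hY Z rZ m m' ev ev' V12 V21 V22.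
pose tau := scaled_time Th o.
have taub t : - T <= t <= - sig -> tau t <= b1 - ((C0 / t1) ^+ 2 + 1).
  by move=> /andP[_ ts]; have := scaled_time_le Th0 hX ts; rewrite /tau; lra.
have tau1 t : - T <= t <= - sig -> tau t < b1.
  move=> /taub; have := sqr_ge0 (C0 / t1); lra.
have hvar t (P P' : borel_probability (ambient Z b1) R)
    (Q Q' : borel_probability (ambient Z (tau t)) R) : - T <= t <= - sig ->
    evolves P Q -> evolves P' Q' ->
    (mutual_variance P P' <= (Th * C0 ^+ 2)%:E -> 
    mutual_variance Q Q' <= (1 + H * T)%:E)%E.
  move=> ht PQ PQ' VP.
  apply: le_trans (variance_evolves Th0 H0 rZ (ltW (tau1 _ ht)) b1b PQ PQ') _.
  apply: le_trans (leeD2r _ VP) _; rewrite -EFinD lee_fin.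
  have -> : Th * H * (b1 - tau t) = H * (0 - t + Th * (b1 - o)).
    by rewrite -(scaled_time_diff b1 o 0 t Th0) {1}/scaled_time mul0r add0r mulrCA mulrA.
  have tT : H * (- t) <= H * T by rewrite ler_wpM2l//; case/andP: ht; lra.
  rewrite mulrN in tT; rewrite mulrDr in hY.
  by rewrite mulrDr [H * (Th * _)]mulrCA; lra.
have mI : measurable (`]- sig, 0%R]%classic : set R) by exact: measurable_itv.
have mT : measurable (`[- T, 0%R]%classic : set R) by exact: measurable_itv.
have good t : (`[- T, 0] `\` (`]- sig, 0] `&` `[- T, 0])) t -> - T <= t <= - sig.
  move=> [] /=; rewrite in_itv /= => /andP[u1 u2] nE; rewrite u1 /=.
  rewrite leNgt; apply/negP => ts; apply: nE; rewrite !in_itv /= u1 u2.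
  by rewrite ts.
exists (`]- sig, 0] `&` `[- T, 0]); split.
- exact: measurableI.
- by move=> t [].
- apply: (@le_trans _ _ (lebesgue_measure (`](- sig)%R, 0%R]%classic : set R))).
    by apply: le_measure; rewrite ?inE//; exact: measurableI.
  by rewrite lebesgue_measure_itv /= lte_fin oppr_lt0 sig0 -EFinB lee_fin sub0r opprK.
- by move=> t /good ht; exact: lt_trans (tau1 _ ht) b1b.
apply: (base_change_close (C := 2 * (H * T) + 3) (t1 := t1) Th0 H0 rZ _ _ _ _
  h0 r0 K0 K10 eta0 T0 Hr hd).
- by move=> t /good ht; exact: lt_trans (tau1 _ ht) b1b.
- move=> s t /good hs /good ht st; split.
    by rewrite /scaled_time lerD2r ler_pM2r// invr_gt0.
  rewrite scaled_time_diff// subrr mulr0 addr0.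
  by case/andP: hs; case/andP: ht; lra.
- move=> t /good ht A mA.
  apply: le_trans (variation_evolves Th0 rZ (tau1 _ ht) b1b C00 (ev _ _ _ _)
    (ev' _ _ _ _) V12 mA) _ => //.
  - exact: ltW (tau1 _ ht).
  - exact: ltW (tau1 _ ht).
  rewrite leeD2l// lee_fin.
  have C1 : 0 < C0 / t1 by rewrite divr_gt0.
  have hs : C0 / t1 <= Num.sqrt (b1 - tau t).
    rewrite -(ger0_norm (ltW C1)) -sqrtr_sqr ler_wsqrtr//.
    by have := taub _ ht; lra.
  rewrite ler_pdivrMr; last exact: lt_le_trans hs.
  by rewrite -ler_pdivrMl// mulrC.
- move=> t /good ht.
  have e1 := ev _ _ (ltW (tau1 _ ht)) b1b; have e2 := ev' _ _ (ltW (tau1 _ ht)) b1b.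
  apply: le_lt_trans (leeD (hvar _ _ _ _ _ ht e2 e1 V21) (hvar _ _ _ _ _ ht e2 e2 V22)) _.
  by rewrite -EFinD lte_fin; lra.
Qed.
End asymptotics.

Section shift_asymptotics.
Context {R : realType}.

(** The order in which the constants are chosen: the weight [k], then the scale
    [eta], then the lower bound for the mass of balls, and finally the tolerances
    [d0] and [e] for the variance. *)
Lemma shift_constants (c : R -> R) (H T C sig delta : R) : (forall K, 0 < c K) ->
  0 <= H -> 0 <= T -> 0 < C -> 0 < sig -> 0 < delta ->
  exists k eta sg K kap d0 e, [/\ [/\ 0 < k, 0 < eta, eta <= 4^-1, 0 < sg & sg <= sig / 2],
    [/\ 0 < K, 0 < kap, 0 < d0, 0 < e & e <= 1],
    C / (K ^+ 2 * sg / 2) + H * sg / (eta ^+ 2 / 2) <= eta,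
    kap / 2 + kap^-1 / 2 * (d0 + 8 * e) <= eta * (eta * (c K / 2) / 2) &
    2 * eta + k * (2 * eta) + k^-1 * (2 * (2 * C + e) + 1) <= delta / 4].
Proof.
move=> c0 H0 T0 C0 s0 del0.
have e8 : 0 < delta / 8 by rewrite divr_gt0.
have CC : 0 < 4 * C + 3 by lra.
pose k := (4 * C + 3) / (delta / 8).
have k0 : 0 < k by rewrite divr_gt0.
have k2 : 0 < 2 + 2 * k by lra.
pose eta := Num.min 4^-1 (delta / 8 / (2 + 2 * k)).
have eta0 : 0 < eta by rewrite lt_min invr_gt0 ltr0n divr_gt0.
have eta1 : eta <= 4^-1 by rewrite ge_min lexx.
have eta2 : (2 + 2 * k) * eta <= delta / 8.
  by rewrite mulrC -ler_pdivlMr// ge_min lexx orbT.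
have H1 : 0 < 4 * (H + 1) by lra.
pose sg := Num.min (sig / 2) (eta ^+ 3 / (4 * (H + 1))).
have sg0 : 0 < sg by rewrite lt_min !divr_gt0// exprn_gt0.
have sg1 : sg <= sig / 2 by rewrite ge_min lexx.
have sg2 : (4 * (H + 1)) * sg <= eta ^+ 3.
  by rewrite mulrC -ler_pdivlMr// ge_min lexx orbT.
have a0 : 0 < 4 * C / (sg * eta) by rewrite divr_gt0// mulr_gt0.
pose K := Num.sqrt (4 * C / (sg * eta)).
have K0 : 0 < K by rewrite sqrtr_gt0.
pose q := eta * (eta * (c K / 2) / 2).
have q0 : 0 < q by rewrite /q mulr_gt0// divr_gt0// mulr_gt0// divr_gt0.
have qq0 : 0 < q ^+ 2 by rewrite exprn_gt0.
pose e := Num.min 1 (q ^+ 2 / 16).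
have e0 : 0 < e by rewrite lt_min ltr01 divr_gt0.
have e1 : e <= 1 by rewrite ge_min lexx.
have e2 : e <= q ^+ 2 / 16 by rewrite ge_min lexx orbT.
exists k, eta, sg, K, q, (q ^+ 2 / 2), e; split => //.
- by split => //; rewrite divr_gt0.
- have x1 : C / (K ^+ 2 * sg / 2) <= eta / 2.
    rewrite ler_pdivrMr ?divr_gt0 ?mulr_gt0 ?exprn_gt0//.
    rewrite sqr_sqrtr ?(ltW a0)//.
    have -> : eta / 2 * (4 * C / (sg * eta) * sg / 2) = C * ((sg * eta) / (sg * eta)).
      by set x := (sg * eta)^-1; lra.
    by rewrite mulfV ?mulr1// gt_eqF// mulr_gt0.
  have x2 : H * sg / (eta ^+ 2 / 2) <= eta / 2.
    rewrite ler_pdivrMr ?divr_gt0 ?exprn_gt0//.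
    have -> : eta / 2 * (eta ^+ 2 / 2) = eta ^+ 3 / 4.
      by rewrite !expr2 exprS expr2; lra.
    by rewrite mulrDr mulrDl mulr1 in sg2; rewrite -mulrA in sg2; lra.
  lra.
- rewrite -/q; apply: (@le_trans _ _ (q / 2 + q^-1 / 2 * (q ^+ 2))).
    rewrite lerD2l ler_pM2l; last by rewrite divr_gt0// invr_gt0.
    lra.
  have -> : q^-1 / 2 * q ^+ 2 = q / 2.
    by rewrite mulrAC expr2 mulrA mulVf ?gt_eqF// mul1r.
  lra.
- have x3 : k^-1 * (2 * (2 * C + e) + 1) <= delta / 8.
    rewrite ler_pdivrMl// /k divfK ?gt_eqF//; lra.
  by rewrite mulrDl in eta2; rewrite -mulrA in eta2; rewrite [k * (2 * _)]mulrCA; lra.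
Qed.

Lemma modulus_constants (H T delta : R) : 0 <= H -> 0 <= T -> 0 < delta ->
  exists h r K e1 : R, [/\ [/\ 0 < h, 0 < r, 0 < K & 0 < e1], H * r <= h ^+ 2 &
    h + (1 + K / 2 / Num.sqrt r) * e1 + (e1 ^+ 2 + (2 * H * T + 1)) / K <= delta].
Proof.
move=> H0 T0 del0.
pose h := delta / 4.
have h0 : 0 < h by rewrite divr_gt0.
have H1 : 0 < H + 1 by lra.
pose r := h ^+ 2 / (H + 1).
have r0 : 0 < r by rewrite divr_gt0// exprn_gt0.
have HT : 0 <= H * T by rewrite mulr_ge0.
have L0 : 0 < 1 + (2 * H * T + 1) by rewrite -[2 * H * T]mulrA; lra.
pose L := 1 + (2 * H * T + 1).
have K0 : 0 < L / h by rewrite divr_gt0.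
pose K := L / h.
have q0 : 0 < 1 + K / 2 / Num.sqrt r.
  by rewrite addr_gt0// !divr_gt0// sqrtr_gt0.
pose e1 := Num.min 1 (h / (1 + K / 2 / Num.sqrt r)).
have e10 : 0 < e1 by rewrite lt_min ltr01 divr_gt0.
have e11 : e1 <= 1 by rewrite ge_min lexx.
have e12 : (1 + K / 2 / Num.sqrt r) * e1 <= h.
  by rewrite mulrC -ler_pdivlMr// ge_min lexx orbT.
exists h, r, K, e1; split => //.
  rewrite /r mulrCA -[leRHS]mulr1 ler_pM2l ?exprn_gt0//.
  by rewrite ler_pdivrMr// mul1r; lra.
have : (e1 ^+ 2 + (2 * H * T + 1)) / K <= h.
  rewrite ler_pdivrMr// /K [h * _]mulrC divfK ?gt_eqF// /L lerD2r.
  by rewrite expr_le1// ltW.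
by rewrite /h in e12 *; lra.
Qed.

End shift_asymptotics.

Section shift_asymptotic.
Context {R : realType}.

(** At a small scale a shift of the origin of time does not matter, except at few
    times: as the sum of the variance and of a linear function of time is monotone,
    it seldom increases much during a short time, and when it does not, most
    points [z] are nearly isometrically related to the points that a heat kernel
    of [z] charges. *)
Lemma shift_asymptotic (c : R -> R) (H b b1 o1 o2 C0 T delta : R) :
  0 <= H -> b1 < b -> (forall K, 0 < c K) -> 0 < C0 -> 0 <= T -> 0 < delta ->
  o2 <= o1 ->
  \forall Th \near (0 : R)^'+, forall Z : flow R, regular_flow b Th H c Z ->
    forall m : forall u, borel_probability (ambient Z u) R,
    (forall s u, s <= u -> u < b -> evolves (m u) (m s)) ->
    (mutual_variance (m b1) (m b1) <= (Th * C0 ^+ 2)%:E)%E ->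
    exists E : set R, [/\ measurable E, E `<=` `[- T, 0],
      (lebesgue_measure E <= (delta ^+ 2)%:E)%E,
      forall t, (`[- T, 0] `\` E) t -> scaled_time Th o1 t < b &
      strongly_close (Y1 := time_change Z (scaled_time Th o1))
        (Y2 := time_change Z (scaled_time Th o2)) (`[- T, 0] `\` E) delta
        (fun t => m (scaled_time Th o1 t)) (fun t => m (scaled_time Th o2 t))].
Proof.
move=> H0 b1b c0 C00 T0 del0 o21.
have dd0 : 0 < delta ^+ 2 by rewrite exprn_gt0.
have HT : 0 <= H * T by rewrite mulr_ge0.
pose sig := Num.min 1 (delta ^+ 2 / 2).
have sig0 : 0 < sig by rewrite lt_min ltr01 divr_gt0.
have sig1 : sig <= 1 by rewrite ge_min lexx.
have sig2 : sig <= delta ^+ 2 / 2 by rewrite ge_min lexx orbT.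
have s20 : 0 < sig / 2 by rewrite divr_gt0.
(* [C] bounds the variance at the times from [- T - 1] on; the window of length [sig]
   below the top is discarded, as its times need not precede those of the base points. *)
pose C := 1 + H * (T + 1).
have C1 : 0 < C by rewrite /C mulrDr mulr1; lra.
have [k [eta [sg [K [kap [d0 [e [[k0 eta0 eta1 sg0 sg1] [K0 kap0 d00 e0 e1]
  hmass hkap hk]]]]]]]] := shift_constants c0 H0 T0 C1 sig0 del0.
have d40 : 0 < delta / 4 by rewrite divr_gt0.
have [h [r [K' [x [[h0 r0 K'0 x0] Hr hx]]]]] := modulus_constants H0 T0 d40.
have x20 : 0 < x ^+ 2 by rewrite exprn_gt0.
pose W := 2 * C + 2 * (H * (T + 1)).
have hN : \forall Th \near (0 : R)^'+, [/\ 0 < Th, Th * (C0 ^+ 2 + H * (b1 - o1)) < 1,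
    Th * (o1 + - b1) < sig / 2, Th * ((o1 - o2 + 1) * (d0^-1 * W)) < delta ^+ 2 / 2 &
    [/\ Th * (o1 - o2 + 1) < 1, Th * (H * (o1 - o2)) < e &
      Th * (H * (o1 - o2)) < x ^+ 2]].
  near=> Th; split; first by near: Th; exact: nbhs_right_gt.
  - by near: Th; exact: near_mul_lt.
  - by near: Th; exact: near_mul_lt.
  - by near: Th; apply: near_mul_lt; rewrite divr_gt0.
  - split; first by near: Th; exact: near_mul_lt.
    + by near: Th; exact: near_mul_lt.
    + by near: Th; exact: near_mul_lt.
apply: filterS hN => Th [Th0 hC hb hW [he1 he hex]] Z rZ m ev Vm.
pose tau1 := scaled_time Th o1; pose tau2 := scaled_time Th o2.
have tau1_le v w : v <= w -> tau1 v <= tau1 w.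
  by move=> vw; rewrite /tau1 /scaled_time lerD2r ler_pM2r// invr_gt0.
have tau1b v : v <= - (sig / 2) -> tau1 v <= b1.
  by move=> hv; rewrite -[b1]opprK; apply: scaled_time_le hv => //; exact: ltW.
pose V u := mutual_variance (m u) (m u).
have V0 u : (0 <= V u)%E.
  by apply: integral_ge0 => y _; apply: integral_ge0 => y' _; rewrite lee_fin sqr_ge0.
have Vle s u : s <= u -> u <= b1 -> (V s <= V u + (Th * H * (u - s))%:E)%E.
  move=> su ub; have ub' := le_lt_trans ub b1b.
  exact: (variance_evolves Th0 H0 rZ su ub' (ev _ _ su ub') (ev _ _ su ub')).
have Vb1 v : v <= - (sig / 2) -> (V (tau1 v) <= (1 - H * v)%:E)%E.
  move=> hv; apply: le_trans (Vle _ _ (tau1b _ hv) (lexx _)) _.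
  apply: le_trans (leeD2r _ Vm) _; rewrite -EFinD lee_fin.
  have -> : Th * H * (b1 - tau1 v) = H * (0 - v + Th * (b1 - o1)).
    by rewrite -(scaled_time_diff b1 o1 0 v Th0) {1}/scaled_time mul0r add0r mulrCA mulrA.
  by rewrite mulrDr in hC; rewrite mulrDr [H * (Th * _)]mulrCA; move: hC; clear; lra.
have Vfin v : v <= - (sig / 2) -> V (tau1 v) = (fine (V (tau1 v)))%:E.
  move=> hv; rewrite fineK// ge0_fin_numE//.
  by apply: le_lt_trans (Vb1 _ hv) _; rewrite ltry.
(* The variance at scaled time [v], plus [H * v]: a nondecreasing function, frozen in
   the discarded window. *)
pose g v := fine (V (tau1 (Num.min v (- (sig / 2))))) + H * Num.min v (- (sig / 2)).
have hmin v : Num.min v (- (sig / 2)) <= - (sig / 2) by rewrite ge_min lexx orbT.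
have gm : {homo g : v w / v <= w}.
  move=> v w vw; rewrite /g.
  have : Num.min v (- (sig / 2)) <= Num.min w (- (sig / 2)) by rewrite le_min2.
  move: (hmin v) (hmin w); set v' := Num.min v _; set w' := Num.min w _ => hv hw vw'.
  have := Vle _ _ (tau1_le _ _ vw') (tau1b _ hw).
  rewrite (Vfin _ hv) (Vfin _ hw) -EFinD lee_fin.
  have -> : Th * H * (tau1 w' - tau1 v') = H * (w' - v').
    by rewrite -mulrA mulrCA scaled_time_diff// subrr mulr0 addr0.
  by rewrite mulrBr; clear; lra.
have fV0 u : 0 <= fine (V u) by rewrite fine_ge0.
have HT1 : H * (- T - 1) = - (H * (T + 1)) by clear; lra.
have gup v : - T - 1 <= v -> g v <= C.
  move=> hv; have hv' : - T - 1 <= Num.min v (- (sig / 2)).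
    by rewrite le_min hv /=; move: T0 s20 sig1; clear; lra.
  have := Vb1 _ (hmin v); rewrite (Vfin _ (hmin v)) lee_fin /g /C.
  have : 0 <= H * (T + 1) by rewrite mulrDr mulr1; move: H0 HT; clear; lra.
  move: hv'; move/(ler_wpM2l H0); rewrite HT1; clear; lra.
have glow v : - T - 1 <= v -> - (H * (T + 1)) <= g v.
  move=> hv; have hv' : - T - 1 <= Num.min v (- (sig / 2)).
    by rewrite le_min hv /=; move: T0 s20 sig1; clear; lra.
  have := ler_wpM2l H0 hv'; rewrite HT1 /g; have := fV0 (tau1 (Num.min v (- (sig / 2)))).
  by clear; lra.
(* After scaling, the shift of the origin is at most [e']; the summand 1 keeps [e']
   positive when the origins agree. *)
pose e' := Th * (o1 - o2 + 1).
have e'0 : 0 < e' by rewrite mulr_gt0//; move: o21; clear; lra.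
pose n := (Num.truncn (T / e')).+1.
have Tn : T < n%:R * e'.
  rewrite -ltr_pdivrMr// /n.
  by have /andP[] := truncn_itv (divr_ge0 T0 (ltW e'0)).
have [B [mB BI Bg lB]] := small_increments (- T) n gm e'0 d00.
have mI : measurable (`]- sig, 0%R]%classic : set R) by exact: measurable_itv.
have mT : measurable (`[- T, 0%R]%classic : set R) by exact: measurable_itv.
have good t : (`[- T, 0] `\` ((B `|` `]- sig, 0]) `&` `[- T, 0])) t ->
    [/\ - T <= t, t <= 0, t <= - sig & ~ B t].
  move=> [] /=; rewrite in_itv /= => /andP[t1 t2] nE.
  have tI : `[- T, 0]%classic t by rewrite /= in_itv /= t1.
  split => //.
    rewrite leNgt; apply/negP => ts; apply: nE; split => //; right.
    by rewrite /= in_itv /= ts.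
  by move=> Bt; apply: nE; split => //; left.
exists ((B `|` `]- sig, 0%R]) `&` `[- T, 0%R]); split.
- by apply: measurableI => //; exact: measurableU.
- by move=> t [].
- apply: (@le_trans _ _ (lebesgue_measure (B `|` `](- sig)%R, 0%R]%classic))).
    have mU : measurable (B `|` `]- sig, 0%R]%classic) by exact: measurableU.
    by apply: le_measure; rewrite ?inE//; exact: measurableI.
  apply: le_trans (measureU2 _ _ _) _ => //.
  have lI : (lebesgue_measure (`](- sig)%R, 0%R]%classic : set R) <= sig%:E)%E.
    by rewrite lebesgue_measure_itv /= lte_fin oppr_lt0 sig0 -EFinB lee_fin sub0r opprK.
  apply: le_trans (leeD lB lI) _; rewrite -EFinD lee_fin.
  have n1 : 0 <= (n%:R - 1) * e'.
    by apply: mulr_ge0; [rewrite subr_ge0 ler1n|exact: ltW].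
  have h1 : g (- T + n%:R * e') <= C by apply: gup; move: n1 e'0; clear; lra.
  have h2 : g (- T + (n%:R - 1) * e') <= C by apply: gup; move: n1 e'0; clear; lra.
  have h3 : - (H * (T + 1)) <= g (- T) by apply: glow; clear; lra.
  have h4 : - (H * (T + 1)) <= g (- T - e').
    by apply: glow; move: he1; rewrite -/e'; clear; lra.
  have h5 : d0^-1 * (e' * (g (- T + n%:R * e') + g (- T + (n%:R - 1) * e') -
      g (- T) - g (- T - e'))) <= delta ^+ 2 / 2.
    apply: le_trans (ltW hW); rewrite [leRHS]mulrA -/e' [leLHS]mulrCA ler_pM2l//.
    by rewrite ler_pM2l ?invr_gt0// /W; move: h1 h2 h3 h4; clear; lra.
  by move: h5 sig2; clear; lra.
- by move=> t /good[t1 t2 t3 nB]; apply: le_lt_trans (tau1b _ _) b1b;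
    move: t3 sig0; clear; lra.
have tau2_le t : tau2 t <= tau1 t by rewrite /tau1 /tau2 /scaled_time lerD2l.
have hbr t : (`[- T, 0] `\` ((B `|` `]- sig, 0]) `&` `[- T, 0])) t ->
    exists rel, almost_isometry rel (2 * eta) /\
    (\int[m (tau1 t)]_z \int[hker Z (z : ambient Z (tau1 t)) (tau2 t)]_w
      (bridge rel (2 * eta) (z : ambient Z (tau1 t)) (w : ambient Z (tau2 t)))%:E <=
     (delta / 4)%:E)%E.
  move=> /good[t1 t2 t3 nB].
  have ts : t <= - (sig / 2) by move: t3 sig0; clear; lra.
  have tb : tau1 t < b by exact: le_lt_trans (tau1b _ ts) b1b.
  have ts' : t + sg <= - (sig / 2) by move: t3 sg1; clear; lra.
  have tb' : tau1 (t + sg) < b by exact: le_lt_trans (tau1b _ ts') b1b.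
  have VC v : - T <= v -> v <= - (sig / 2) -> (V (tau1 v) <= C%:E)%E.
    move=> v1 v2; apply: le_trans (Vb1 _ v2) _; rewrite lee_fin /C.
    by have := ler_wpM2l H0 v1; rewrite mulrN mulrDr mulr1; move: H0; clear; lra.
  have inc : (V (tau1 t) <= V (tau2 t) + d0%:E)%E.
    have te : t - e' <= - (sig / 2) by move: ts e'0; clear; lra.
    have gt := Bg t t1 (_ : t < - T + n%:R * e') nB.
    have tT : t < - T + n%:R * e' by move: Tn t2; clear; lra.
    have {}gt := gt tT; rewrite /g (min_idPl ts) (min_idPl te) in gt.
    have d12 : Th * (tau2 t - tau1 (t - e')) = Th.
      rewrite scaled_time_diff// /e'.
      by clear; lra.
    have l12 : tau1 (t - e') <= tau2 t.
      by rewrite -subr_ge0 -(pmulr_rge0 _ Th0) d12 ltW.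
    have := Vle _ _ l12 (le_trans (tau2_le t) (tau1b _ ts)).
    rewrite -mulrA mulrCA d12 (Vfin _ te) (Vfin _ ts).
    case: (V (tau2 t)) (V0 (tau2 t)) => // [v|] _; last by move=> _; rewrite leey.
    rewrite -!EFinD !lee_fin => hv.
    have : H * Th <= H * e'.
      apply: ler_wpM2l => //; rewrite /e' -[leLHS]mulr1 ler_pM2l//; move: o21; clear; lra.
    by move: gt; rewrite mulrBr; move: hv; clear; lra.
  have lt' : tau1 t < tau1 (t + sg).
    by rewrite /tau1 /scaled_time ltrD2r ltr_pM2r ?invr_gt0// ltrDl.
  have t1' : - T <= t + sg by rewrite (le_trans t1)// lerDl ltW.
  have dE : Th * (tau1 (t + sg) - tau1 t) = sg.
    by rewrite scaled_time_diff// subrr mulr0 addr0 addrAC subrr add0r.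
  have dHE : Th * H * (tau1 (t + sg) - tau1 t) = H * sg by rewrite -mulrA mulrCA dE.
  have hmass' := ball_mass Th0 H0 c0 rZ lt' tb' (ev _ _ (ltW lt') tb') K0 eta0
    (VC _ t1' ts').
  rewrite dHE dE in hmass'.
  have m0 : 0 < c K / 2 by rewrite divr_gt0.
  have het : Th * H * (tau1 t - tau2 t) < e.
    by rewrite -mulrA mulrCA scaled_time_diff// subrr add0r mulrCA.
  have [rel [ar Br]] := exists_shift_bridge Th0 H0 rZ (tau2_le t) tb
    (ev _ _ (tau2_le t) tb) het (VC _ t1 ts) inc eta0 eta1 m0 k0 kap0
    (le_trans hmass' (lee_tofin hmass)) hkap.
  by exists rel; split => //; apply: le_trans Br _; rewrite lee_fin.
apply: (shift_close (eta := 2 * eta) (B1 := delta / 4) (rho := delta / 4) Th0 H0 rZ _ _ ev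
  _ hbr h0 r0 K'0 x0 d40 T0 Hr).
- move=> t /good[_ _ t3 _]; split; first exact: tau2_le.
  by apply: le_lt_trans (tau1b _ _) b1b; move: t3 sig0; clear; lra.
- move=> s t /good[s1 _ _ _] /good[_ t2 _ _] st; split.
  + exact: tau1_le.
  + by rewrite /scaled_time lerD2r ler_pM2r// invr_gt0.
  + by rewrite scaled_time_diff// subrr mulr0 addr0; move: s1 t2; clear; lra.
- move=> t _; rewrite -mulrA mulrCA scaled_time_diff// subrr add0r mulrCA.
  exact: ltW.
- move: hx del0; clear; lra.
Unshelve. all: by end_near. Qed.
End shift_asymptotic.

(** * Subspaces and supports *)

Section full_integrals.
Local Open Scope ereal_scope.
Context {R : realType}.

(** Monotonicity up to a null set, for functions that need not be measurable: a simple
    function below [f] is cut off outside [A]. *)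
Lemma le_integral_full d (T : measurableType d) (P : probability T R)
    (f g : T -> \bar R) (A : set T) : measurable A -> P A = 1 ->
  (forall x, 0 <= f x) -> (forall x, 0 <= g x) ->
  (forall x, A x -> f x <= g x) -> \int[P]_x f x <= \int[P]_x g x.
Proof.
move=> mA PA f0 g0 fg; apply: integral_le_simple => // h mh h0 hf.
have mhE : measurable_fun setT (fun x => (h x)%:E) by exact/measurable_EFinP.
apply: (@le_trans _ _ (\int[P]_x (h x * \1_A x)%:E)).
  apply: ae_ge0_le_integral => //.
  - by move=> x _; rewrite lee_fin.
  - by move=> x _; rewrite lee_fin mulr_ge0.
  - by apply/measurable_EFinP; apply: measurable_funM => //; exact: measurable_indic.
  exists (~` A); split; [exact: measurableC|exact: probability_full|].
  move=> x /= nx Ax; apply: nx => _.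
  by rewrite lee_fin indicE mem_set// mulr1.
apply: le_integral_ge0 => x; first by rewrite lee_fin mulr_ge0.
rewrite indicE; have [Ax|nAx] := boolP (x \in A); last by rewrite mulr0.
by rewrite mulr1; apply: le_trans (hf x) (fg x _); rewrite inE in Ax.
Qed.

Lemma eq_integral_full d (T : measurableType d) (P : probability T R)
    (f g : T -> \bar R) (A : set T) : measurable A -> P A = 1 ->
  (forall x, 0 <= f x) -> (forall x, 0 <= g x) ->
  (forall x, A x -> f x = g x) -> \int[P]_x f x = \int[P]_x g x.
Proof.
move=> mA PA f0 g0 fg; apply/eqP; rewrite eq_le.
by rewrite !(le_integral_full mA PA)// => x Ax; rewrite fg.
Qed.

Lemma integral_full d (T : measurableType d) (P : probability T R)
    (f : T -> \bar R) (D : set T) : measurable D -> P D = 1 ->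
  (forall x, 0 <= f x) -> \int[P]_(x in D) f x = \int[P]_x f x.
Proof.
move=> mD PD f0; rewrite integral_mkcond; apply: (eq_integral_full mD PD) => // x.
  by rewrite erestrict_ge0.
by move=> Dx; rewrite patchE mem_set.
Qed.

(** For functions that need not be measurable only one inequality of the change
    of variables holds. *)
Lemma integral_push_le d1 d2 (X : measurableType d1) (Y : measurableType d2)
    (P : probability X R) (g : X -> Y) (Q : probability Y R) (f : Y -> \bar R) :
  measurable_fun setT g -> (forall A, measurable A -> Q A = P (g @^-1` A)) ->
  (forall y, 0 <= f y) -> \int[Q]_y f y <= \int[P]_x f (g x).
Proof.
move=> mg QP f0; apply: integral_le_simple => // h mh h0 hf.
have [Q' [Q'E Q'I]] := exists_push P mg.
have -> : \int[Q]_y (h y)%:E = \int[Q']_y (h y)%:E.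
  by apply: eq_measure_integral => A mA _; exact: etrans (QP A mA) (esym (Q'E A)).
rewrite (Q'I (fun y => (h y)%:E)).
- by apply: le_integral_ge0 => x; rewrite ?lee_fin.
- exact/measurable_EFinP.
- by move=> y; rewrite lee_fin.
Qed.

End full_integrals.

Section subspace.
Context {R : realType} (T : pmetricType R).

(** Spaces have to be nonempty: as a space of its own, the empty subset is replaced by
    the whole space. *)
Definition nonempty_hull (A : set T) : set T := [set x | A !=set0 -> A x].

Definition subspace_of (A : set T) : Type := {x : T | nonempty_hull A x}.

Lemma nonempty_hull_ex (A : set T) : exists x, nonempty_hull A x.
Proof.
have [[x Ax]|nA] := pselect (A !=set0); first by exists x.
by exists point.
Qed.

Context (A : set T).
Let S := subspace_of A.

HB.instance Definition _ := gen_eqMixin S.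
HB.instance Definition _ := gen_choiceMixin S.

Let sdist (x y : S) : R := mdist (sval x) (sval y).

Let sdistxx x : sdist x x = 0.
Proof. exact: mdistxx. Qed.

Let sdist_positivity x y : sdist x y = 0 -> x = y.
Proof. by move=> /mdist_positivity; exact: eq_sig_hprop. Qed.

Let sdist_sym x y : sdist x y = sdist y x.
Proof. exact: mdistC. Qed.

Let sdist_tri y x z : sdist x z <= sdist x y + sdist y z.
Proof. exact: mdist_tri. Qed.

HB.instance Definition _ := isMetric.Build R S
  sdistxx sdist_positivity sdist_sym sdist_tri.
HB.instance Definition _ := isPointed.Build S
  (exist _ (sval (cid (nonempty_hull_ex A))) (svalP (cid (nonempty_hull_ex A)))).

Definition retract (x : T) : S :=
  if pselect (nonempty_hull A x) is left h then exist _ x h else point.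

End subspace.

Section subspace_theory.
Context {R : realType} (T : pmetricType R) (A : set T).
Local Notation S := (subspace_of A).

Lemma mdist_sval (x y : S) : mdist (sval x) (sval y) = mdist x y.
Proof. by []. Qed.

Lemma sval_inj (x y : S) : sval x = sval y -> x = y.
Proof. exact: eq_sig_hprop. Qed.

Lemma svalK (x : S) : retract A (sval x) = x.
Proof.
rewrite /retract; case: pselect => [h|/(_ (svalP x))//].
exact: sval_inj.
Qed.

Lemma retractK (x : T) : A x -> sval (retract A x) = x.
Proof.
by move=> Ax; rewrite /retract; case: pselect => // nh; exfalso; apply: nh.
Qed.

Lemma sval_in (x : S) : A !=set0 -> A (sval x).
Proof. exact: (svalP x). Qed.

End subspace_theory.

Section measurable_isometry.
Context {R : realType}.

Lemma measurable_borel (T Z : pmetricType R) (f : borel T -> borel Z) :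
  (forall U : set Z, open U -> measurable (f @^-1` U)) -> measurable_fun setT f.
Proof.
move=> h; apply: (measurability _ (erefl : @measurable _ (borel Z) = <<s @open Z >>)).
by move=> _ [U oU <-]; rewrite setTI; exact: h.
Qed.

Lemma measurable_isometry (T Z : pmetricType R) (f : borel T -> borel Z) :
  (forall x y : T, mdist (f x : Z) (f y) = mdist x y) -> measurable_fun setT f.
Proof.
move=> hf; apply: measurable_borel => U oU; apply: borel_open.
apply: open_mdistP => x /= Ufx; move: oU; rewrite openE => /(_ _ Ufx).
move=> /nbhs_ballP[e /= e0 eU]; exists e => // y xy; apply: eU.
by rewrite ballEmdist /= hf.
Qed.

(** The preimage of an open set is the trace on the image of an open set, up to the
    points outside the image, which all have the value [p]. *)
Lemma measurable_left_inverse (T Z : pmetricType R) (f : T -> Z) (g : Z -> T) :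
  (forall x y, mdist (f x) (f y) = mdist x y) -> cancel f g ->
  (exists p, forall z, ~ range f z -> g z = p) ->
  measurable (range f : set (borel Z)) ->
  measurable_fun setT (g : borel Z -> borel T).
Proof.
move=> hf fg [p gp] mr; apply: measurable_borel => U oU.
pose V : set Z := [set z | exists x e, [/\ 0 < e, U x, (forall y, mdist x y < e -> U y) &
  mdist (f x) z < e]].
have oV : open V.
  apply: open_mdistP => z [x [e [e0 Ux eU xz]]]; exists (e - mdist (f x) z).
    by rewrite subr_gt0.
  move=> w zw; exists x, e; split => //.
  by apply: le_lt_trans (mdist_tri z _ _) _; lra.
have VU x : V (f x) <-> U x.
  split => [[y [e [e0 Uy eU]]]|Ux]; first by rewrite hf; exact: eU.
  move: oU; rewrite openE => /(_ _ Ux) /nbhs_ballP[e /= e0 eU].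
  exists x, e; split => //; last by rewrite mdistxx.
  by move=> y xy; apply: eU; rewrite ballEmdist.
have -> : g @^-1` U = (V `&` range f) `|` (~` range f `&` [set z | U p]).
  apply/seteqP; split => z /=.
    have [[x _ <-]|nz] := pselect (range f z).
      by rewrite fg => /VU Vx; left; split => //; exists x.
    by rewrite gp// => Up; right.
  case=> [[Vz [x _ xz]]|[nz Up]]; first by rewrite -xz fg; apply/VU; rewrite xz.
  by rewrite gp.
apply: measurableU; first by apply: measurableI => //; exact: borel_open.
apply: measurableI; first exact: measurableC.
have [Up|nUp] := pselect (U p).
  by rewrite (_ : [set z | U p] = setT)//; apply/seteqP; split.
by rewrite (_ : [set z | U p] = set0)//; apply/seteqP; split.
Qed.

Lemma measurable_hull (T : pmetricType R) (A : set T) :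
  measurable (A : set (borel T)) -> measurable (nonempty_hull A : set (borel T)).
Proof.
move=> mA; have [A0|nA] := pselect (A !=set0).
  rewrite (_ : nonempty_hull A = A)//; apply/seteqP; split => x; last by move=> ? ?.
  by move=> /(_ A0).
rewrite (_ : nonempty_hull A = setT)//; apply/seteqP; split => x // _ /nA.
by [].
Qed.

Lemma measurable_retract (T : pmetricType R) (A : set T) :
  measurable (A : set (borel T)) ->
  measurable_fun setT (retract A : borel T -> borel (subspace_of A)).
Proof.
move=> mA; have rE : range (sval : subspace_of A -> T) = nonempty_hull A.
  apply/seteqP; split => [_ [x _ <-]|x hx]; first exact: svalP.
  by exists (exist _ x hx).
apply: (@measurable_left_inverse (subspace_of A) T (fun x => sval x) (retract A)) => //.
- exact: svalK.
- exists point => z; rewrite rE /retract; case: pselect => //.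
- by rewrite rE; exact: measurable_hull.
Qed.

Lemma separable_subspace (T : pmetricType R) (B A : set T) :
  separable_set B -> A `<=` B -> A !=set0 -> separable_space (subspace_of A).
Proof.
move=> [D [cD DB BD]] AB [a0 Aa0].
have /pfcard_geP[D0|[d]] := cD.
  have := BD _ (AB _ Aa0); rewrite D0 closure0 => //.
have ex (nk : nat * nat) : exists s : subspace_of A,
    (exists s' : subspace_of A, mdist (sval s') (d nk.1) < nk.2.+1%:R^-1) ->
    mdist (sval s) (d nk.1) < nk.2.+1%:R^-1.
  have [[s hs]|ns] := pselect (exists s' : subspace_of A,
    mdist (sval s') (d nk.1) < nk.2.+1%:R^-1); first by exists s.
  by exists point.
pose s nk := sval (cid (ex nk)); have sP nk := svalP (cid (ex nk)).
pose u n : subspace_of A := if unpickle n is Some nk then s nk else point.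
exists u => x e e0.
have e20 : 0 < e / 2 by rewrite divr_gt0.
have [k ke] : exists k : nat, k.+1%:R^-1 < e / 2.
  have [k _ hk] := near_infty_natSinv_lt (PosNum e20).
  by exists k; apply: hk => /=.
have Bx : B (sval x) by apply: AB; apply: sval_in; exists a0.
have k0 : 0 < k.+1%:R^-1 :> R by rewrite invr_gt0.
have [y [Dy xy]] := BD _ Bx _ (nbhsx_ballx (sval x) _ k0).
have [n _ dn] := (@surj _ _ _ _ d) _ Dy.
have hx : mdist (sval x) (d n) < k.+1%:R^-1.
  by rewrite dn; move: xy; rewrite ballEmdist.
have hs := sP (n, k) (ex_intro _ x hx).
exists (pickle (n, k)); rewrite /u pickleK -mdist_sval.
apply: le_lt_trans (mdist_tri (d n) _ _) _; rewrite (mdistC (d n)) /=.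
by rewrite (splitr e); apply: ltrD; [exact: lt_trans ke|exact: lt_trans ke].
Qed.

End measurable_isometry.

Section supports.
Context {R : realType}.

(** The traces on [A] of the neighbourhoods of a limit point form a Cauchy filter. *)
Lemma complete_closed (T : pmetricType R) (A : set T) : complete_set A -> closed A.
Proof.
move=> cA x clx.
pose F : set_system T := [set B | exists2 U, nbhs x U & U `&` A `<=` B].
have FF : ProperFilter F.
  split.
    by move=> [U Ux UA]; have [y [Ay Uy]] := clx _ Ux; exact: (UA y).
  split.
  - by exists setT; [exact: filterT|].
  - move=> B C [U Ux UB] [V Vx VC]; exists (U `&` V); first exact: filterI.
    by move=> y [[Uy Vy] Ay]; split; [exact: UB|exact: VC].
  - by move=> B C BC [U Ux UB]; exists U => // y /UB /BC.
have Fx : F --> x.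
  by move=> U Ux; exists U => // y [].
have [||y Ay Fy] := cA F FF.
- by exists setT => [|y []//]; exact: filterT.
- by apply: cvg_cauchy; apply/cvg_ex; exists x.
have -> : x = y by exact: (@cvg_unique _ (@metric_hausdorff R T) F).
exact: Ay.
Qed.

Lemma closed_supp (T : pmetricType R) (mu : borel_probability T R) : closed (supp mu).
Proof.
rewrite -[supp mu]setCK; apply: open_closedC; rewrite openE => x.
move=> /existsNP[U /not_implyP[[oU Ux] nU]].
apply: filterS (open_nbhs_nbhs (conj oU Ux)) => y Uy /= sy; apply: nU.
exact: sy.
Qed.

(** The complement of the support within [A] is covered by the countably many null
    balls with centres in a dense sequence and radii [1 / n]. *)
Lemma supp_full (T : pmetricType R) (mu : borel_probability T R) (A : set T) :
  separable_set A -> measurable (A : set (borel T)) -> mu A = 1%E ->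
  mu (A `&` supp mu) = 1%E.
Proof.
move=> [D [cD DA AD]] mA muA.
have ms : measurable (supp mu : set (borel T)) by apply: borel_closed; exact: closed_supp.
have /pfcard_geP[D0|[d]] := cD.
  have A0 : A = set0 by apply/seteqP; split => // x /AD; rewrite D0 closure0.
  by move: muA; rewrite A0 measure0 => /eqP; rewrite eqe eq_sym oner_eq0.
have open_ball0 (x : T) (r : R) : open (ball x r).
  rewrite ballEmdist; apply: open_mdistP => y /= xy.
  exists (r - mdist x y); first by rewrite subr_gt0.
  by move=> z yz; apply: le_lt_trans (mdist_tri y _ _) _; lra.
pose N (nk : nat * nat) : set (borel T) :=
  if pselect (mu (ball (d nk.1) (nk.2.+1%:R^-1 : R)) = 0%E) is left _
  then ball (d nk.1) (nk.2.+1%:R^-1 : R) else set0.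
have mN nk : measurable (N nk).
  rewrite /N; case: pselect => [h|h]; last exact: measurable0.
  exact: borel_open.
have N0 nk : mu (N nk) = 0%E.
  by rewrite /N; case: pselect => [h|h]; [exact: h|rewrite measure0].
pose N' n := if unpickle n is Some nk then N nk else set0.
have mN' n : measurable (N' n).
  by rewrite /N'; case: unpickle => // nk; exact: measurable0.
have mU : measurable (\bigcup_n N' n) by exact: bigcup_measurable.
have U0 : mu (\bigcup_n N' n) = 0%E.
  apply/eqP; rewrite eq_le measure_ge0 andbT.
  apply: le_trans (measure_sigma_subadditive mu mN' mU (@subset_refl _ _)) _.
  rewrite eseries0// => n _ _; rewrite /N'; case: unpickle => [nk|].
    exact: N0.
  exact: measure0.
have sub : A `\` \bigcup_n N' n `<=` A `&` supp mu.
  move=> x [Ax nN]; split => // U [oU Ux].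
  have /nbhs_ballP[e /= e0 eU] : nbhs x U by exact: open_nbhs_nbhs.
  have e20 : 0 < e / 2 by rewrite divr_gt0.
  have [k ke] : exists k : nat, k.+1%:R^-1 < e / 2.
    have [k _ hk] := near_infty_natSinv_lt (PosNum e20).
    by exists k; apply: hk => /=.
  have k0 : 0 < k.+1%:R^-1 :> R by rewrite invr_gt0.
  have [y [Dy xy]] := AD _ Ax _ (nbhsx_ballx x _ k0).
  have [n _ dn] := (@surj _ _ _ _ d) _ Dy.
  have dx : ball (d n) (k.+1%:R^-1 : R) x by rewrite dn; exact: ball_sym.
  have bU : ball (d n) (k.+1%:R^-1 : R) `<=` U.
    move=> z; rewrite ballEmdist /= => dz; apply: eU; rewrite ballEmdist /=.
    apply: le_lt_trans (mdist_tri (d n) _ _) _; rewrite (splitr e) mdistC ltrD//.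
      by move: dx; rewrite ballEmdist /= => dx; exact: lt_trans ke.
    exact: lt_trans ke.
  have mb : measurable (ball (d n) (k.+1%:R^-1 : R) : set (borel T)).
    exact: borel_open.
  rewrite lt_neqAle measure_ge0 andbT eq_sym; apply/eqP => mU0.
  apply: nN; exists (pickle (n, k)) => //; rewrite /N' pickleK /N /=.
  case: pselect => // nb; exfalso; apply: nb.
  apply/eqP; rewrite eq_le measure_ge0 andbT -mU0.
  by apply: le_measure; rewrite ?inE//; exact: borel_open.
have mAs : measurable (A `&` supp mu : set (borel T)) by exact: measurableI.
apply/eqP; rewrite eq_le probability_le1//= -muA.
have h1 : (mu A <= mu ((A `&` supp mu) `|` \bigcup_n N' n))%E.
  apply: le_measure; rewrite ?inE//; first exact: measurableU.
  move=> x Ax; have [Nx|nN] := pselect ((\bigcup_n N' n) x); first by right.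
  by left; exact: sub.
apply: le_trans h1 _; apply: le_trans (measureU2 _ _ _) _ => //.
by rewrite [X in (_ + X)%E]U0 adde0.
Qed.

End supports.

(** * Heat kernels of a metric flow *)

Section heat_profiles.
Context {R : realType} (Phi : R -> R) (hPhi : heat_profile Phi).

(** [Phi] is nondecreasing and 1-Lipschitz, as its derivative lies between 0 and
    [1 / Num.sqrt (4 * pi)]. *)
Lemma profile_increment (x y : R) : x <= y -> 0 <= Phi y - Phi x <= y - x.
Proof.
case: hPhi => _ dPhi _ _.
rewrite le_eqVlt => /predU1P[->|xy]; first by rewrite !subrr lexx.
pose d (z : R) := expR (- z ^+ 2 / 4) / Num.sqrt (4 * pi).
have [z _ ->] : exists2 z, z \in `]x, y[ & Phi y - Phi x = d z * (y - x).
  have cP : {within `[x, y], continuous Phi}.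
    apply: continuous_subspaceT => z; apply: differentiable_continuous.
    by apply/derivable1_diffP; case: (dPhi z).
  exact: (MVT xy (fun z _ => dPhi z) cP).
have s1 : 1 <= Num.sqrt (4 * pi) :> R.
  by rewrite -{1}sqrtr1 ler_wsqrtr//; have := pi_ge2 R; lra.
have d0 : 0 <= d z by rewrite divr_ge0// expR_ge0.
have d1 : d z <= 1.
  rewrite ler_pdivrMr ?mul1r; last exact: lt_le_trans s1.
  by apply: le_trans s1; rewrite -expR0 ler_expR mulNr oppr_le0 divr_ge0// sqr_ge0.
by rewrite mulr_ge0 ?subr_ge0 ?(ltW xy)//= ler_piMl// subr_ge0 ltW.
Qed.

(** Values of [Phi] that are at least [1/2] are attained only above some number,
    whence a lower bound for the values of [Phi] at distance [K]. *)
Lemma profile_harnack : exists c : R -> R, (forall K, 0 < c K <= 2^-1) /\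
  forall K x y, 2^-1 <= Phi x -> x - K <= y -> c K <= Phi y.
Proof.
case: hPhi => P01 _ Pny _.
have [a Pa] : exists a, forall x, x < a -> Phi x < 2^-1.
  have h2 : (0 : R) < 2^-1 by rewrite invr_gt0.
  have [a [_ h]] : \forall x \near -oo, Phi x < 2^-1 := cvgr_lt 0 Pny 2^-1 h2.
  by exists a.
exists (fun K => Num.min 2^-1 (Phi (a - K))); split.
  move=> K; rewrite lt_min ge_min lexx/= andbT invr_gt0 ltr0n/=.
  by case/andP: (P01 (a - K)).
move=> K x y Px xKy; rewrite ge_min; apply/orP; right.
have ax : a <= x by rewrite leNgt; apply/negP => /Pa; rewrite ltNge Px.
have aKy : a - K <= y by lra.
by have /andP[] := profile_increment aKy; lra.
Qed.

End heat_profiles.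

Section kernels_of_flows.
Local Open Scope ereal_scope.
Context {R : realType} (Phi : R -> R) (hPhi : heat_profile Phi) (X : flow R).
Hypothesis hX : metric_flow Phi `]-oo, 0%R] X.

Let time (s : R) : (s <= 0)%R -> `]-oo, 0%R]%classic s.
Proof. by move=> s0; rewrite /= in_itv. Qed.

Lemma slice_closed s : (s <= 0)%R -> closed (slice X s).
Proof. by move=> /time s0; case: hX => h _ _ _ _; apply: complete_closed; case: (h _ s0). Qed.

Lemma slice_measurable s : (s <= 0)%R -> measurable (slice X s : set (borel (ambient X s))).
Proof. by move=> s0; apply: borel_closed; exact: slice_closed. Qed.

Lemma slice_separable s : (s <= 0)%R -> separable_set (slice X s).
Proof. by move=> /time s0; case: hX => h _ _ _ _; case: (h _ s0). Qed.

Lemma hker_slice s t (x : ambient X t) : (s <= t)%R -> (t <= 0)%R -> slice X t x ->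
  hker X x s (slice X s) = 1.
Proof.
move=> st t0; case: hX => _ h _ _ _; apply: h => //.
by apply: time; exact: le_trans t0.
Qed.

(** Heat regularity with [T = 0], for the indicator function of [A]. *)
Lemma hker_profile s t : (s < t)%R -> (t <= 0)%R ->
  forall A : set (borel (ambient X s)), measurable A ->
  (exists c : R, forall x, slice X t x -> hker X x s A = c%:E) \/
  (exists2 f, lipschitz_in (slice X t) (Num.sqrt (t - s))^-1 f &
    forall x, slice X t x -> hker X x s A = (Phi (f x))%:E).
Proof.
move=> st t0 A mA; have s0 := le_trans (ltW st) t0.
have mS := slice_measurable s0.
have kA (x : ambient X t) : slice X t x ->
    hker X x s A = hker X x s (A `&` slice X s).
  move=> Sx; have k1 := hker_slice (ltW st) t0 Sx.
  have mAS : measurable (A `&` slice X s) by exact: measurableI.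
  rewrite -[LHS]integral_indicT// -[RHS]integral_indicT//.
  apply: (eq_integral_full mS k1) => y; rewrite ?lee_fin// => Sy.
  by rewrite !indicE in_setI [y \in slice X s]mem_set// andbT.
case: hX => _ _ _ hreg _.
have := hreg s t 0%R (time s0) (time t0) st (lexx _) (\1_A).
case.
- exact: measurable_indic.
- by move=> y _; rewrite indicE; case: (_ \in _); rewrite /= ?lexx ler01.
- by rewrite ltxx.
- move=> [c hc]; left; exists c => x Sx; rewrite -(hc x Sx) integral_indic//; exact: kA.
- move=> [f lf hf]; right; exists f; first by rewrite -[(t - s)%R]addr0.
  move=> x Sx; rewrite -(hf x Sx) integral_indic//; exact: kA.
Qed.

Lemma hker_variation s t (x y : ambient X t) : (s < t)%R -> (t <= 0)%R ->
  slice X t x -> slice X t y ->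
  forall A : set (borel (ambient X s)), measurable A ->
  hker X x s A <= hker X y s A + (mdist x y / Num.sqrt (t - s))%:E.
Proof.
move=> st t0 Sx Sy A mA.
have d0 : (0 <= mdist x y / Num.sqrt (t - s))%R by rewrite divr_ge0// mdist_ge0.
have [[c hc]|[f lf hf]] := hker_profile st t0 mA.
  by rewrite (hc x Sx) (hc y Sy) -EFinD lee_fin lerDl.
rewrite (hf x Sx) (hf y Sy) -EFinD lee_fin.
have := lf x y Sx Sy; rewrite mulrC => hxy.
have [fxy|fyx] := leP (f x) (f y).
  by have := profile_increment hPhi fxy => /andP[h _]; lra.
have := profile_increment hPhi (ltW fyx) => /andP[_ h].
by have := ler_norm (f x - f y); lra.
Qed.

Lemma hker_harnack (c : R -> R) : (forall K, 0 < c K <= 2^-1)%R ->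
  (forall K x y, 2^-1 <= Phi x -> x - K <= y -> c K <= Phi y)%R ->
  forall s t (x y : ambient X t), (s < t)%R -> (t <= 0)%R ->
  slice X t x -> slice X t y ->
  forall (A : set (borel (ambient X s))) (K : R), measurable A ->
  2^-1%:E <= hker X x s A -> (mdist x y <= K * Num.sqrt (t - s))%R ->
  (c K)%:E <= hker X y s A.
Proof.
move=> c0 cP s t x y st t0 Sx Sy A K mA hx xy.
have [[k hk]|[f lf hf]] := hker_profile st t0 mA.
  rewrite (hk y Sy) lee_fin; move: hx; rewrite (hk x Sx) lee_fin.
  by apply: le_trans; case/andP: (c0 K).
rewrite (hf y Sy) lee_fin; move: hx; rewrite (hf x Sx) lee_fin => hx.
apply: (cP K (f x)) => //.
have ts : (0 < Num.sqrt (t - s))%R by rewrite sqrtr_gt0 subr_gt0.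
have := lf x y Sx Sy; rewrite mulrC ler_pdivlMr// => h.
have : (`|f x - f y| <= K)%R.
  by have := le_trans h xy; rewrite ler_pM2r.
by have := ler_norm (f x - f y); lra.
Qed.

(** A value of the form [Phi (f x)] is never 0. *)
Lemma hker_null s t (x y : ambient X t) : (s < t)%R -> (t <= 0)%R ->
  slice X t x -> slice X t y ->
  forall A : set (borel (ambient X s)), measurable A ->
  hker X x s A = 0 -> hker X y s A = 0.
Proof.
move=> st t0 Sx Sy A mA.
have [[k hk]|[f lf hf]] := hker_profile st t0 mA; first by rewrite (hk x Sx) (hk y Sy).
rewrite (hf x Sx) => -[h0]; case: hPhi => /(_ (f x)) /andP[] + _ _ _ _.
by rewrite h0 ltxx.
Qed.

Lemma integral_gt0_on d (T : measurableType d) (P : probability T R) (f : T -> \bar R)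
    (D W : set T) (e : R) : measurable W -> W `<=` D -> (forall x, 0 <= f x) ->
  (0 < e)%R -> (forall x, W x -> e%:E <= f x) -> 0 < P W ->
  0 < \int[P]_(x in D) f x.
Proof.
move=> mW WD f0 e0 ef PW.
apply: (@lt_le_trans _ _ (\int[P]_x (e%:E * (\1_W x)%:E))).
  rewrite integralZT ?(ltW e0)//; last exact: measurable_indicE.
  by rewrite integral_indicT// mule_gt0.
rewrite [leRHS]integral_mkcond; apply: le_integral_ge0 => x.
  by rewrite -EFinM lee_fin mulr_ge0// ltW.
rewrite indicE; have [Wx|nW] := boolP (x \in W).
  rewrite mule1 patchE mem_set; last by apply: WD; rewrite inE in Wx.
  by apply: ef; rewrite inE in Wx.
by rewrite mule0 erestrict_ge0.
Qed.

(** By reproduction the left side is a mean of masses [hker X y s A]. When one of them is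
    positive they are all positive, by [hker_profile] and as [Phi] vanishes nowhere,
    and they are bounded below on every ball. *)
Lemma hker_null_later s u t (x : ambient X t) (z : ambient X u) :
  (s < u)%R -> (u <= t)%R -> (t <= 0)%R -> slice X t x -> slice X u z ->
  forall A : set (borel (ambient X s)), measurable A ->
  hker X x s A = 0 <-> hker X z s A = 0.
Proof.
move=> su ut t0 Sx Sz A mA; have u0 := le_trans ut t0.
have mS := slice_measurable u0.
have rep : hker X x s A = \int[hker X x u]_(y in slice X u) hker X y s A.
  case: hX => _ _ _ _ h; apply: (h s u t) => //; last exact: ltW.
  by apply: time; exact: le_trans (ltW su) u0.
rewrite rep; split => [|hz]; last first.
  rewrite (eq_integral (cst 0)); first by rewrite integral0.
  by move=> y; rewrite inE => Sy; exact: hker_null su u0 Sz Sy _ mA hz.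
move=> h0; apply/eqP/negPn/negP => nz.
have zpos : 0 < hker X z s A by rewrite lt_neqAle eq_sym nz measure_ge0.
suff : 0 < \int[hker X x u]_(y in slice X u) hker X y s A by rewrite h0 ltxx.
have f0 (y : ambient X u) : 0 <= hker X y s A by [].
have [[k hk]|[f lf hf]] := hker_profile su u0 mA.
  apply: (integral_gt0_on
    (f := fun y : borel (ambient X u) => hker X (y : ambient X u) s A) (W := slice X u) (e := k)) => //.
  - by move: zpos; rewrite (hk z Sz) lte_fin.
  - by move=> y Sy; rewrite (hk y Sy).
  - by rewrite (hker_slice ut t0 Sx) lte_fin.
pose W (n : nat) : set (borel (ambient X u)) :=
  slice X u `&` [set y : ambient X u | (mdist z y < n%:R)%R].
have mW n : measurable (W n).
  by apply: measurableI; [exact: mS|exact: measurable_open_ball].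
have [n Wn] : exists n, 0 < hker X x u (W n).
  apply: contrapT => /forallNP nW.
  have : hker X x u (\bigcup_n W n) = 0.
    apply/eqP; rewrite eq_le measure_ge0 andbT.
    apply: le_trans (measure_sigma_subadditive (hker X x u) mW
      (bigcup_measurable (fun n _ => mW n)) (@subset_refl _ _)) _.
    rewrite eseries0// => n _ _; apply/eqP; rewrite eq_le measure_ge0 andbT leNgt.
    by apply/negP => /nW.
  have -> : \bigcup_n W n = slice X u.
    apply/seteqP; split => [y [n _ []]//|y Sy].
    exists (Num.truncn (mdist z y)).+1 => //; split => //=.
    by have /andP[] := truncn_itv (mdist_ge0 z y).
  by rewrite (hker_slice ut t0 Sx) => /eqP; rewrite eqe oner_eq0.
pose r := (f z - n%:R / Num.sqrt (u - s))%R.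
apply: (integral_gt0_on
    (f := fun y : borel (ambient X u) => hker X (y : ambient X u) s A) (W := W n) (e := Phi r)) => //.
- by move=> y [].
- by case: hPhi => /(_ r) /andP[].
- move=> y [Sy /= zy]; rewrite (hf y Sy) lee_fin.
  have ts : (0 < (Num.sqrt (u - s))^-1)%R by rewrite invr_gt0 sqrtr_gt0 subr_gt0.
  have ry : (r <= f y)%R.
    have := lf z y Sz Sy; have := ler_norm (f z - f y).
    have := ltW zy; rewrite -(ler_pM2l ts) /r mulrC; lra.
  by have /andP[] := profile_increment hPhi ry; lra.
Qed.

End kernels_of_flows.

(** * Separable models *)

Section pushed.
Local Open Scope ereal_scope.
Context {R : realType}.

(** Total, so that a flow can be defined from push-forwards without proofs in its data. *)
Definition pushed (T Z : pmetricType R) (g : T -> Z) (P : borel_probability T R) :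
    borel_probability Z R :=
  if pselect (measurable_fun setT (g : borel T -> borel Z)) is left mg
  then sval (cid (exists_push P mg)) else \d_(point : borel Z).

Lemma pushedE (T Z : pmetricType R) (g : T -> Z) (P : borel_probability T R) :
  measurable_fun setT (g : borel T -> borel Z) ->
  forall A, pushed g P A = P (g @^-1` A).
Proof.
move=> mg A; rewrite /pushed; case: pselect => [h|//].
by have [h1 _] := svalP (cid (exists_push P h)); exact: h1.
Qed.

Lemma integral_pushed (T Z : pmetricType R) (g : T -> Z) (P : borel_probability T R) :
  measurable_fun setT (g : borel T -> borel Z) ->
  forall f : borel Z -> \bar R, measurable_fun setT f -> (forall y, 0 <= f y) ->
  \int[pushed g P]_y f y = \int[P]_x f (g x).
Proof.
move=> mg f mf f0; rewrite /pushed; case: pselect => [h|//].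
by have [_ h1] := svalP (cid (exists_push P h)); exact: h1.
Qed.

(** The squared distance on the ambient space need not be measurable for the product of
    the Borel sigma-algebras, so that the right side is a lower integral. *)
Lemma mutual_variance_retract (T : pmetricType R) (A : set T)
    (P Q : borel_probability T R) : measurable (A : set (borel T)) ->
  separable_space (subspace_of A) -> P A = 1 -> Q A = 1 ->
  mutual_variance (pushed (retract A) P) (pushed (retract A) Q) <= mutual_variance P Q.
Proof.
move=> mA sA PA QA; have mr := measurable_retract mA.
have d0 (z : borel (subspace_of A) * borel (subspace_of A)) :
  0 <= ((@mdist R (subspace_of A) z.1 z.2) ^+ 2)%:E by rewrite lee_fin sqr_ge0.
have d0' (T' : pmetricType R) (x y : T') : 0 <= ((mdist x y) ^+ 2)%:E.
  by rewrite lee_fin sqr_ge0.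
have m2 := measurable_mdist2 sA.
rewrite mutual_varianceE.
rewrite (integral_pushed P mr (f := fun x =>
  \int[pushed (retract A) Q]_y ((@mdist R (subspace_of A) x y) ^+ 2)%:E)); last 2 first.
- exact: (measurable_mean _ (f := fun z : borel (subspace_of A) * borel (subspace_of A) =>
    ((@mdist R (subspace_of A) z.1 z.2) ^+ 2)%:E)).
- by move=> x; apply: integral_ge0 => y _; exact: d0'.
rewrite mutual_varianceE; apply: (le_integral_full mA PA).
- by move=> x; apply: integral_ge0 => y _; exact: d0'.
- by move=> x; apply: integral_ge0 => y _; exact: d0'.
move=> x Ax.
rewrite (integral_pushed Q mr (f := fun y =>
  ((@mdist R (subspace_of A) (retract A x) y) ^+ 2)%:E)); last 2 first.
- rewrite (_ : (fun y => _) = (fun y : borel (subspace_of A) =>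
      ((@mdist R (subspace_of A) y (retract A x)) ^+ 2)%:E)); first exact: measurable_mdist2l.
  by apply/funext => y; rewrite mdistC.
- by move=> y; exact: d0'.
apply: (le_integral_full mA QA) => [y|y|y Ay]; [exact: d0'|exact: d0'|].
by rewrite -mdist_sval !retractK.
Qed.

End pushed.

Section model.
Local Open Scope ereal_scope.
Context {R : realType} (Phi : R -> R) (hPhi : heat_profile Phi) (X : flow R).
Hypothesis hX : metric_flow Phi `]-oo, 0%R] X.

Let time (s : R) : (s <= 0)%R -> `]-oo, 0%R]%classic s.
Proof. by move=> s0; rewrite /= in_itv. Qed.

Lemma hker_null_equiv s t t' (x : ambient X t) (y : ambient X t') :
  (s < t)%R -> (s < t')%R -> (t <= 0)%R -> (t' <= 0)%R ->
  slice X t x -> slice X t' y ->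
  forall A : set (borel (ambient X s)), measurable A ->
  hker X x s A = 0 <-> hker X y s A = 0.
Proof.
move=> st st' t0 t'0 Sx Sy A mA; have [tt'|t't] := leP t t'.
  by apply: iff_sym; exact: (hker_null_later hPhi hX st tt' t'0 Sy Sx mA).
exact: (hker_null_later hPhi hX st' (ltW t't) t0 Sx Sy mA).
Qed.

Context (t0 : R) (x0 : ambient X t0).
Hypothesis t00 : (t0 <= 0)%R.
Hypothesis Sx0 : slice X t0 x0.

(** The part of the slice that carries the heat kernels at later points. By
    [visible_base] it does not depend on the base point [x0], as long as [s] precedes
    the times of the base points. *)
Definition visible (s : R) : set (ambient X s) := slice X s `&` supp (hker X x0 s).
Arguments visible s _ : clear implicits.

Lemma visible_measurable s : (s <= 0)%R ->
  measurable (visible s : set (borel (ambient X s))).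
Proof.
move=> s0; apply: measurableI; first exact: slice_measurable hX _ s0.
by apply: borel_closed; exact: closed_supp.
Qed.

Lemma visible_full s t (x : ambient X t) : (s < t)%R -> (s < t0)%R -> (t <= 0)%R ->
  slice X t x -> hker X x s (visible s) = 1.
Proof.
move=> st st0 tle0 Sx; have s0 := le_trans (ltW st) tle0.
have mV := visible_measurable s0.
have h0 : hker X x0 s (visible s) = 1.
  apply: supp_full; first exact: slice_separable hX _ s0.
    exact: slice_measurable hX _ s0.
  exact: (hker_slice hX (ltW st0) t00 Sx0).
have mVc : measurable (~` (visible s : set (borel (ambient X s)))) by exact: measurableC.
have /(hker_null_equiv st st0 tle0 t00 Sx Sx0 mVc) n0 :
  hker X x0 s (~` visible s) = 0 by exact: probability_full.
have := probability_setC (hker X x s) mVc.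
by rewrite setCK n0 sube0.
Qed.

Lemma visible_nonempty s : (s < t0)%R -> visible s !=set0.
Proof.
move=> st0; apply/set0P/eqP => V0.
have := visible_full st0 st0 t00 Sx0.
by rewrite V0 measure0 => /eqP; rewrite eqe eq_sym oner_eq0.
Qed.

Lemma visible_separable s : (s < t0)%R -> separable_space (subspace_of (visible s)).
Proof.
move=> st0; apply: separable_subspace (slice_separable hX _) _ (visible_nonempty st0).
  exact: le_trans (ltW st0) t00.
by move=> x [].
Qed.

Definition seen t (x : ambient X t) (s : R) :
    borel_probability (subspace_of (visible s)) R :=
  pushed (retract (visible s)) (hker X x s).

(** The flow on the visible parts: its spaces contain nothing but relevant points and
    are separable. *)
Definition model : flow R :=
  @Flow R (fun s => subspace_of (visible s)) (fun s => setT)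
    (fun t x s => seen (sval x) s).

Lemma seenE s t (x : ambient X t) A : (s < t0)%R ->
  seen x s A = hker X x s (retract (visible s) @^-1` A).
Proof.
move=> st0; apply: pushedE; apply: measurable_retract; apply: visible_measurable.
exact: le_trans (ltW st0) t00.
Qed.

Lemma model_slice u (x : ambient model u) : (u < t0)%R -> slice X u (sval x).
Proof. by move=> ut0; have [] := sval_in x (visible_nonempty ut0). Qed.

Lemma hker_dirac u (x : ambient X u) : (u <= 0)%R -> slice X u x ->
  forall A : set (borel (ambient X u)), measurable A ->
  hker X x u A = \d_(x : borel (ambient X u)) A.
Proof. by move=> u0 Sx A mA; case: hX => _ _ h _ _; exact: h. Qed.

Lemma model_full s u (x : ambient model u) : (s <= u)%R -> (u < t0)%R ->
  hker X (sval x) s (visible s) = 1.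
Proof.
move=> su ut0; have u0 : (u <= 0)%R by exact: le_trans (ltW ut0) t00.
move: su; rewrite le_eqVlt => /predU1P[->|su].
  rewrite hker_dirac//; first last.
  - exact: visible_measurable.
  - exact: model_slice.
  by rewrite diracE mem_set//; exact: (sval_in x (visible_nonempty ut0)).
apply: visible_full => //; first exact: lt_trans ut0.
exact: model_slice.
Qed.

Lemma measurable_preimage_retract s (A : set (borel (subspace_of (visible s)))) :
  (s < t0)%R -> measurable A ->
  measurable (retract (visible s) @^-1` A : set (borel (ambient X s))).
Proof.
move=> st0 mA; rewrite -[_ @^-1` _]setTI.
apply: (measurable_retract (visible_measurable _)) => //.
exact: le_trans (ltW st0) t00.
Qed.

Lemma seen_dirac u (x : ambient model u) : (u < t0)%R ->
  forall A : set (borel (ambient model u)), measurable A ->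
  seen (sval x) u A = \d_(x : borel (ambient model u)) A.
Proof.
move=> ut0 A mA; have u0 : (u <= 0)%R by exact: le_trans (ltW ut0) t00.
rewrite seenE// hker_dirac//; first last.
- exact: measurable_preimage_retract.
- exact: model_slice.
rewrite !diracE; congr (_%:R%:E); congr nat_of_bool.
by apply/idP/idP; rewrite !inE /= svalK.
Qed.

Lemma seen_variation s u (x y : ambient model u) : (s < u)%R -> (u < t0)%R ->
  forall A : set (borel (ambient model s)), measurable A ->
  seen (sval x) s A <= seen (sval y) s A + (mdist x y / Num.sqrt (u - s))%:E.
Proof.
move=> su ut0 A mA; have st0 := lt_trans su ut0.
rewrite !seenE//; apply: (hker_variation hPhi hX su).
- exact: le_trans (ltW ut0) t00.
- exact: model_slice.
- exact: model_slice.
- exact: measurable_preimage_retract.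
Qed.

Lemma model_kernel s u : (s <= u)%R -> (u < t0)%R ->
  kernel_like (fun x : borel (ambient model u) => seen (sval (x : ambient model u)) s).
Proof.
move=> su ut0 A mA; move: su; rewrite le_eqVlt => /predU1P[su|su].
  move: A mA; rewrite su => A mA.
  rewrite (_ : (fun x => _) = (fun x : borel (ambient model u) => (\1_A x)%:E)).
    exact: measurable_indicE.
  by apply/funext => x; rewrite seen_dirac.
pose f (x : borel (ambient model u)) := fine (seen (sval (x : ambient model u)) s A).
have fE (x : borel (ambient model u)) : seen (sval (x : ambient model u)) s A = (f x)%:E.
  by rewrite fineK// fin_num_measure.
rewrite (_ : (fun x => _) = (fun x => (f x)%:E)); last by apply/funext => x; rewrite fE.
apply/measurable_EFinP.
have sq : (0 < Num.sqrt (u - s))%R by rewrite sqrtr_gt0 subr_gt0.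
rewrite (_ : f = (fun x => (Num.sqrt (u - s))^-1 * (Num.sqrt (u - s) * f x))%R); last first.
  by apply/funext => x; rewrite mulrA mulVf ?gt_eqF// mul1r.
apply: measurable_funM => //; apply: measurable_lip => x y.
have := seen_variation x y su ut0 mA; rewrite !fE -EFinD lee_fin.
by rewrite -(ler_pM2l sq) mulrDr [(_ * (mdist x y / _))%R]mulrC divfK ?gt_eqF.
Qed.

Lemma seen_evolves s u t (x : ambient X t) : (s <= u)%R -> (u < t0)%R -> (u <= t)%R ->
  (t <= 0)%R -> slice X t x -> hker X x u (visible u) = 1 ->
  forall A, measurable A -> seen x s A = \int[seen x u]_y seen (sval y) s A.
Proof.
move=> su ut0 ut tle0 Sx fx A mA; have st0 := le_lt_trans su ut0.
have u0 := le_trans ut tle0; have s0 := le_trans su u0.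
have mr := measurable_retract (visible_measurable u0).
rewrite (integral_pushed _ mr (f := fun y => seen (sval (y : ambient model u)) s A)) => //.
  2: exact: model_kernel.
rewrite seenE//.
have mA' := measurable_preimage_retract st0 mA.
have -> : hker X x s (retract (visible s) @^-1` A) = \int[hker X x u]_(y in slice X u)
    hker X y s (retract (visible s) @^-1` A).
  by case: hX => _ _ _ _ h; apply: (h s u t).
rewrite integral_full//; last 2 first.
- exact: slice_measurable hX _ u0.
- exact: (hker_slice hX ut tle0 Sx).
apply: (eq_integral_full (visible_measurable u0) fx) => // y Vy.
by rewrite seenE// retractK.
Qed.

End model.
Arguments visible {R X t0} x0 s _.

Section scale_flow.
Local Open Scope ereal_scope.
Context {R : realType}.

Definition scale_flow (l : {posnum R}) (Z : flow R) : flow R :=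
  @Flow R (fun u => scaled l (ambient Z u)) (fun u => slice Z u)
    (fun u x s => hker Z (x : ambient Z u) s).

Lemma mdist_scaled (l : {posnum R}) (T : pmetricType R) (x y : T) :
  @mdist R (scaled l T) x y = (l%:num * mdist x y)%R.
Proof. by []. Qed.

Lemma mutual_variance_scaled (l : {posnum R}) (T : pmetricType R)
    (P Q : borel_probability T R) : separable_space T ->
  @mutual_variance R (scaled l T) P Q = ((l%:num ^+ 2)%R)%:E * mutual_variance P Q.
Proof.
move=> sT; have d0 (x y : T) : 0 <= ((mdist x y) ^+ 2)%:E by rewrite lee_fin sqr_ge0.
have m2 := measurable_mdist2 sT.
have l20 : (0 <= l%:num ^+ 2)%R by rewrite sqr_ge0.
rewrite !mutual_varianceE -integralZT//; first last.
- by move=> x; apply: integral_ge0.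
- exact: (measurable_mean _ (f := fun z : borel T * borel T => ((@mdist R T z.1 z.2) ^+ 2)%:E)).
apply: eq_integral => x _; rewrite -integralZT//; last first.
  rewrite (_ : (fun y => _) = (fun y : borel T => ((@mdist R T y x) ^+ 2)%:E)).
    exact: measurable_mdist2l.
  by apply/funext => y; rewrite mdistC.
by apply: eq_integral => y _; rewrite mdist_scaled exprMn EFinM.
Qed.

Lemma sqrt_scale (l : {posnum R}) (x : R) :
  Num.sqrt (l%:num ^+ 2 * x) = (l%:num * Num.sqrt x)%R.
Proof. by rewrite sqrtrM ?sqr_ge0// sqrtr_sqr ger0_norm. Qed.

Lemma separable_scaled (l : {posnum R}) (T : pmetricType R) :
  separable_space T -> separable_space (scaled l T).
Proof.
move=> [a ha]; exists a => x e e0.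
have [|n hn] := ha x (e / l%:num)%R; first by rewrite divr_gt0.
exists n; move: hn; rewrite ltr_pdivlMr// => hn.
by rewrite mdist_scaled mulrC.
Qed.

Lemma regular_scale_flow (b H : R) (c : R -> R) (l : {posnum R}) (Z : flow R) :
  regular_flow b 1 H c Z -> regular_flow b (l%:num ^+ 2) H c (scale_flow l Z).
Proof.
move=> rZ; have l0 : (0 < l%:num)%R by [].
split.
- by move=> u ub; apply: separable_scaled; exact: (regular_separable rZ ub).
- exact: regular_dirac rZ.
- exact: regular_kernel rZ.
- exact: regular_reproduction rZ.
- move=> s u su ub x y A mA.
  have := regular_variation rZ su ub (x : ambient Z u) (y : ambient Z u) mA.
  rewrite mul1r sqrt_scale mdist_scaled.
  by rewrite -mulf_div mulfV ?gt_eqF// mul1r.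
- move=> s u su ub x y A K mA hA hK.
  apply: (regular_harnack rZ su ub (x := (x : ambient Z u)) mA hA).
  by move: hK; rewrite sqrt_scale mdist_scaled mul1r mulrCA ler_pM2l.
- move=> s u su ub x y; have sb := le_lt_trans su ub.
  rewrite (mutual_variance_scaled l _ _ (regular_separable rZ sb)).
  have := regular_concentrated rZ su ub (x : ambient Z u) (y : ambient Z u).
  rewrite mul1r mdist_scaled exprMn -mulrA -mulrDr => h; rewrite [leRHS]EFinM.
  by apply: lee_wpmul2l; rewrite ?lee_fin ?sqr_ge0.
Qed.

End scale_flow.

Section regular_model.
Local Open Scope ereal_scope.
Context {R : realType} (Phi : R -> R) (hPhi : heat_profile Phi) (X : flow R).
Hypothesis hX : metric_flow Phi `]-oo, 0%R] X.
Context (H : R).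
Hypothesis hH : concentrated H `]-oo, 0%R] X.
Context (t0 : R) (x0 : ambient X t0).
Hypothesis t00 : (t0 <= 0)%R.
Hypothesis Sx0 : slice X t0 x0.

Let time (s : R) : (s <= 0)%R -> `]-oo, 0%R]%classic s.
Proof. by move=> s0; rewrite /= in_itv. Qed.

(** At equal points concentration bounds a nonnegative number by [H * (t - s)]. *)
Lemma concentration_ge0 : (0 <= H)%R.
Proof.
have s0 : (t0 - 1 <= 0)%R by move: t00; lra.
have st : (t0 - 1 <= t0)%R by lra.
have h1 : mutual_variance (hker X x0 (t0 - 1)%R) (hker X x0 (t0 - 1)%R) <= H%:E.
  apply: le_trans (hH (time s0) (time t00) st Sx0 Sx0) _; rewrite mdistxx expr0n add0r /=.
  by rewrite lee_fin opprB addrC subrK mulr1.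
have : 0 <= H%:E.
  apply: le_trans h1; apply: integral_ge0 => x _; apply: integral_ge0 => y _.
  by rewrite lee_fin sqr_ge0.
by rewrite lee_fin.
Qed.

Lemma seen_variance s t (x y : ambient X t) : (s < t0)%R -> (s <= t)%R -> (t <= 0)%R ->
  slice X t x -> slice X t y ->
  hker X x s (visible x0 s) = 1 -> hker X y s (visible x0 s) = 1 ->
  mutual_variance (seen x0 x s) (seen x0 y s) <= (mdist x y ^+ 2 + H * (t - s))%:E.
Proof.
move=> st0 st tle0 Sx Sy fx fy; have s0 := le_trans st tle0.
apply: le_trans (hH (time s0) (time tle0) st Sx Sy).
apply: mutual_variance_retract => //; first exact: visible_measurable hX _ _ _ s0.
exact: (visible_separable hPhi hX t00 Sx0 st0).
Qed.

(** [Phi] being 1-Lipschitz gives the variation bound, and [profile_harnack] the Harnack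
    property; the rest is the push-forward of the axioms of a metric flow. *)
Lemma model_regular (c : R -> R) (b : R) : (b <= t0)%R -> (forall K, 0 < c K <= 2^-1)%R ->
  (forall K x y, 2^-1 <= Phi x -> x - K <= y -> c K <= Phi y)%R ->
  regular_flow b 1 H c (model x0).
Proof.
move=> bt0 c0 cP; have lt0 u : (u < b)%R -> (u < t0)%R by move=> ub; exact: lt_le_trans bt0.
have le0 u : (u < b)%R -> (u <= 0)%R by move=> /lt0 ut0; exact: le_trans (ltW ut0) t00.
split.
- move=> u ub; exact: (visible_separable hPhi hX t00 Sx0 (lt0 _ ub)).
- move=> u x ub A mA; exact: (seen_dirac hPhi hX t00 Sx0 x (lt0 _ ub) mA).
- move=> s u su ub; exact: (model_kernel hPhi hX t00 Sx0 su (lt0 _ ub)).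
- move=> t1 t2 t3 t12 t23 t3b x A mA; have t3t0 := lt0 _ t3b.
  apply: (seen_evolves hPhi hX t00 Sx0 t12 _ t23 (le0 _ t3b)) => //.
  + exact: le_lt_trans t3t0.
  + exact: (model_slice hPhi hX t00 Sx0).
  + exact: (model_full hPhi hX t00 Sx0 x t23 t3t0).
- move=> s u su ub x y A mA; rewrite mul1r.
  exact: (seen_variation hPhi hX t00 Sx0 x y su (lt0 _ ub) mA).
- move=> s u su ub x y A K mA; rewrite mul1r.
  have st0 := lt_trans su (lt0 _ ub).
  rewrite !(seenE hX t00 _ _ st0) => hx xy.
  apply: (hker_harnack hX c0 cP su (le0 _ ub) _ _ _ hx xy).
  + exact: (model_slice hPhi hX t00 Sx0 _ (lt0 _ ub)).
  + exact: (model_slice hPhi hX t00 Sx0 _ (lt0 _ ub)).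
  + exact: (measurable_preimage_retract hX t00).
- move=> s u su ub x y; rewrite mul1r; have ut0 := lt0 _ ub.
  apply: seen_variance => //; first exact: le_lt_trans ut0.
  + exact: le0.
  + exact: (model_slice hPhi hX t00 Sx0 _ ut0).
  + exact: (model_slice hPhi hX t00 Sx0 _ ut0).
  + exact: (model_full hPhi hX t00 Sx0 _ su ut0).
  + exact: (model_full hPhi hX t00 Sx0 _ su ut0).
Qed.

(** The two heat kernels have the same null sets, hence the same support. *)
Lemma visible_base s0 (y0 : ambient X s0) s : (s0 <= 0)%R -> slice X s0 y0 ->
  (s < t0)%R -> (s < s0)%R -> visible y0 s = visible x0 s.
Proof.
move=> s00 Sy0 st0 ss0; rewrite /visible; congr (_ `&` _).
have eq (U : set (ambient X s)) x : open_nbhs x U -> (0 < hker X x0 s U) = (0 < hker X y0 s U).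
  move=> [oU _]; have mU := borel_open oU.
  rewrite !lt_neqAle !measure_ge0 !andbT; congr (~~ _).
  have e := hker_null_equiv hPhi hX st0 ss0 t00 s00 Sx0 Sy0 mU.
  by apply/eqP/eqP => h; apply/esym; apply/e.
apply/seteqP; split => x /= h U oU; first by rewrite (eq _ x)//; exact: h.
by rewrite -(eq _ x)//; exact: h.
Qed.

End regular_model.

(** * The bridged union of two spaces *)

Section bridged_union.
Context {R : realType} (Z W : pmetricType R) (rel : Z -> W -> Prop) (eta : R).

(** The gluing of two spaces along an almost isometry. *)
Definition bridged_union (arel : almost_isometry rel eta) : Type := (Z + W)%type.

Context (arel : almost_isometry rel eta).
Let U := bridged_union arel.

HB.instance Definition _ := gen_eqMixin U.
HB.instance Definition _ := gen_choiceMixin U.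

Let udist (x y : U) : R :=
  match (x : Z + W), (y : Z + W) with
  | inl z, inl z' => mdist z z'
  | inl z, inr w => bridge rel eta z w
  | inr w, inl z => bridge rel eta z w
  | inr w, inr w' => mdist w w'
  end.

Let udistxx x : udist x x = 0.
Proof. by case: x => x; exact: mdistxx. Qed.

Let udist_positivity x y : udist x y = 0 -> x = y.
Proof.
case: x => x; case: y => y /= h.
- by rewrite (@mdist_positivity R Z x y h).
- by have := bridge_gt0 arel x y; rewrite h ltxx.
- by have := bridge_gt0 arel y x; rewrite h ltxx.
- by rewrite (@mdist_positivity R W x y h).
Qed.

Let udist_sym x y : udist x y = udist y x.
Proof. by case: x => x; case: y => y //=; exact: mdistC. Qed.

Let udist_tri y x z : udist x z <= udist x y + udist y z.
Proof.
case: x => x; case: y => y; case: z => z /=.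
- exact: mdist_tri.
- exact: bridge_lipl.
- exact: bridge_tril.
- exact: bridge_lipr.
- by rewrite addrC (mdistC y); exact: bridge_lipl.
- exact: bridge_trir.
- by rewrite addrC (mdistC x); exact: bridge_lipr.
- exact: mdist_tri.
Qed.

HB.instance Definition _ := isMetric.Build R U
  udistxx udist_positivity udist_sym udist_tri.
HB.instance Definition _ := isPointed.Build U (inl point).

End bridged_union.

Section bridge_transport.
Local Open Scope ereal_scope.
Context {R : realType}.

Record identification (Y T : pmetricType R) (S : set T) (i : Y -> T) (r : T -> Y) : Prop := {
  ident_isometry : forall x y, mdist (i x) (i y) = mdist x y ;
  ident_measurable : measurable_fun setT (r : borel T -> borel Y) ;
  ident_in : forall x, S (i x) ;
  identK : cancel i r ;
  ident_on : forall x, S x -> i (r x) = x }.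

(** The preimages of the neighbourhoods of a limit point form a Cauchy filter. *)
Lemma closed_isometric_image (T Z : pmetricType R) (S : set T) (f : T -> Z) :
  complete_set S -> isometric_in S f -> closed (f @` S).
Proof.
move=> cS isf z clz.
pose F : set_system T := [set B | exists2 e : R, (0 < e)%R &
  forall a, S a -> (mdist (f a) z < e)%R -> B a].
have FF : ProperFilter F.
  split.
    move=> [e e0 h]; have [_ [[a Sa <-] za]] := clz _ (nbhsx_ballx z e e0).
    by apply: (h a Sa); move: za; rewrite ballEmdist /= mdistC.
  split.
  - by exists 1%R.
  - move=> B C [e e0 eB] [d d0 dC]; exists (Num.min e d); first by rewrite lt_min e0.
    by move=> a Sa; rewrite lt_min => /andP[h1 h2]; split; [exact: eB|exact: dC].
  - by move=> B C BC [e e0 eB]; exists e => // a Sa /eB-/(_ Sa) /BC.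
have FS : F S by exists 1%R.
have cF : cauchy F.
  move=> E; rewrite -entourage_ballE => -[e /= e0 eE].
  have e20 : (0 < e / 2)%R by rewrite divr_gt0.
  pose B := [set a | S a /\ (mdist (f a) z < e / 2)%R].
  have FB : F B by exists (e / 2)%R.
  exists (B, B) => //.
  move=> [a b] /= [[Sa az] [Sb bz]]; apply: eE; rewrite /= ballEmdist /=.
  rewrite -isf//; apply: le_lt_trans (mdist_tri z _ _) _.
  by rewrite (splitr e) ltrD// mdistC.
have [a Sa Fa] := cS F FF FS cF; exists a => //.
apply: mdist_positivity.
apply/eqP; rewrite eq_le mdist_ge0 andbT; apply/ler_addgt0Pl => e e0; rewrite addr0.
have e20 : (0 < e / 2)%R by rewrite divr_gt0.
have FB : F (ball a (e / 2)%R) by apply: Fa; exact: nbhsx_ballx.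
have FC : F [set b | S b /\ (mdist (f b) z < e / 2)%R] by exists (e / 2)%R.
have [b [ab [Sb bz]]] := filter_ex (filterI FB FC).
move: ab; rewrite ballEmdist /= => ab.
apply: le_trans (mdist_tri (f b) _ _) _; rewrite isf// (splitr e).
by apply: lerD; exact: ltW.
Qed.


Lemma complete_measurable (T : pmetricType R) (S : set T) :
  complete_set S -> measurable (S : set (borel T)).
Proof. by move=> cS; apply: borel_closed; exact: complete_closed. Qed.

Lemma measurable_isometry_preimage (T Z : pmetricType R) (f : T -> Z) (B : set Z) :
  (forall x y, mdist (f x) (f y) = mdist x y) ->
  measurable (B : set (borel Z)) -> measurable (f @^-1` B : set (borel T)).
Proof.
move=> hf mB; rewrite -[_ @^-1` _]setTI.
exact: (measurable_isometry (f := f : borel T -> borel Z)).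
Qed.

Lemma probability_fullI d (T : measurableType d) (P : probability T R) (S A : set T) :
  measurable S -> measurable A -> P S = 1 -> P (S `&` A) = P A.
Proof.
move=> mS mA PS; have mSA : measurable (S `&` A) by exact: measurableI.
rewrite -[LHS]integral_indicT// -[RHS]integral_indicT//.
apply: (eq_integral_full mS PS) => x; rewrite ?lee_fin// => Sx.
by rewrite !indicE in_setI [x \in S]mem_set.
Qed.

Lemma le_add_ereal_inf (S : set (\bar R)) (x K : \bar R) : 0 <= K ->
  (forall y, S y -> 0 <= y) -> (forall y, S y -> x <= K + y) -> x <= K + ereal_inf S.
Proof.
move=> K0 S0 h; have i0 : 0 <= ereal_inf S by apply: le_ereal_inf_tmp => y /S0.
case: K K0 h => [k k0 h|_ _|//]; last first.
  by rewrite addye ?leey// gt_eqF// (lt_le_trans _ i0)// ltNy0.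
rewrite -leeBlDl//; apply: le_ereal_inf_tmp => y Sy; rewrite leeBlDl//.
exact: h.
Qed.

(** The triangle inequality for the Wasserstein distance in the bridged union of [Z] and
    [T2]. Couplings on [Z] are first pulled back to [Y1], which is possible as the
    image of the complete set [S1] is closed: [Z] need not be separable, and its
    distance need not be measurable. *)
Lemma bridge_wasserstein (T1 T2 T3 Y1 Y2 Z : pmetricType R) (S1 : set T1) (S2 : set T2)
    (S3 : set T3) (i1 : Y1 -> T1) (r1 : T1 -> Y1) (i2 : Y2 -> T2) (r2 : T2 -> Y2)
    (phi1 : T1 -> Z) (phi3 : T3 -> Z) (rel : Y1 -> Y2 -> Prop) (eta : R) :
  identification S1 i1 r1 -> identification S2 i2 r2 -> separable_space Y1 ->
  complete_set S1 -> complete_set S2 -> isometric_in S1 phi1 -> isometric_in S3 phi3 ->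
  almost_isometry rel eta ->
  exists (Z' : pmetricType R) (e2 : T2 -> Z') (e3 : T3 -> Z'),
  [/\ isometric_in S2 e2, isometric_in S3 e3 &
    forall (n1 : borel_probability T1 R) (n2 : borel_probability T2 R)
      (n3 : borel_probability T3 R) (nu1 nu1' : borel_probability Y1 R)
      (nu2 : borel_probability Y2 R) (M : \bar R) (w rho : R),
    n1 S1 = 1 -> n2 S2 = 1 ->
    (forall A, measurable A -> nu1 A = n1 (r1 @^-1` A)) ->
    (forall A, measurable A -> nu2 A = n2 (r2 @^-1` A)) ->
    @transportable R _ _ (borel Y1) (borel Y2) (bridge rel eta) nu1' nu2 M ->
    @transportable R _ _ (borel Y1) (borel Y1) (fun x y => @mdist R Y1 x y) nu1' nu1 w%:E ->
    (0 < rho)%R ->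
    wasserstein1 (push_in n2 S2 e2) (push_in n3 S3 e3) <=
      M + (rho + w + rho)%:E + wasserstein1 (push_in n1 S1 phi1) (push_in n3 S3 phi3)].
Proof.
move=> id1 id2 sY1 cS1 cS2 is1 is3 arel.
have mS2 := complete_measurable cS2.
have mS1 := complete_measurable cS1.
pose f := phi1 \o i1.
have isf x y : mdist (f x) (f y) = mdist x y.
  by rewrite /f /= is1 ?(ident_isometry id1)//; exact: ident_in id1 _.
have rf : range f = phi1 @` S1.
  apply/seteqP; split => [_ [y _ <-]|_ [x Sx <-]].
    by exists (i1 y) => //; exact: ident_in id1 _.
  by exists (r1 x) => //; rewrite /f /= (ident_on id1).
have mrf : measurable (range f : set (borel Z)).
  by apply: borel_closed; rewrite rf; exact: closed_isometric_image.
pose g (z : Z) : Y1 := if pselect (exists y, f y = z) is left h then sval (cid h) else point.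
have finj x y : f x = f y -> x = y.
  by move=> fxy; apply: mdist_positivity; rewrite -isf fxy mdistxx.
have fK : cancel f g.
  move=> y; rewrite /g; case: pselect => [h|[]]; last by exists y.
  by apply: finj; exact: svalP (cid h).
have gK z : range f z -> f (g z) = z by move=> [y _ <-]; rewrite fK.
have mg : measurable_fun setT (g : borel Z -> borel Y1).
  apply: (measurable_left_inverse isf fK) => //.
  exists point => z nz; rewrite /g; case: pselect => // -[y yz].
  by exfalso; apply: nz; exists y.
(* The relation between [Y1] and [Y2], seen in [Z] and [T2]. *)
pose rel' (z : Z) (x : T2) := exists y1 y2, [/\ rel y1 y2, z = f y1 & x = i2 y2].
have arel' : almost_isometry rel' eta.
  case: arel => eta0 [a [b ab]] hrel; split => //.
    by exists (f a), (i2 b), a, b.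
  move=> z x z' x' [y1 [y2 [r12 -> ->]]] [y1' [y2' [r12' -> ->]]].
  by rewrite isf (ident_isometry id2); exact: hrel.
have brel y1 y2 : (bridge rel' eta (f y1) (i2 y2) <= bridge rel eta y1 y2)%R.
  apply: (bridge_ge arel) => y1' y2' r'.
  have := bridge_le arel' (f y1) (i2 y2) (_ : rel' (f y1') (i2 y2')).
  by rewrite isf (ident_isometry id2); apply; exists y1', y2'.
pose Z' : pmetricType R := bridged_union arel'.
pose inZ (z : Z) : Z' := inl z; pose in2 (x : T2) : Z' := inr x.
have inZ_iso x y : mdist (inZ x) (inZ y) = mdist x y by [].
have in2_iso x y : mdist (in2 x) (in2 y) = mdist x y by [].
have inZ2 z x : mdist (in2 x) (inZ z) = bridge rel' eta z x by [].
exists Z', in2, (inZ \o phi3); split => //.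
move=> n1 n2 n3 nu1 nu1' nu2 M w rho n1S n2S hnu1 hnu2 tM tw rho0.
have M0 : 0 <= M.
  have [q [_ _ qM]] := tM; apply: le_trans qM; apply: integral_ge0 => z _.
  by rewrite lee_fin ltW// (bridge_gt0 arel).
have w0 : (0 <= w)%R.
  have [q [_ _ qw]] := tw; rewrite -lee_fin; apply: le_trans qw.
  by apply: integral_ge0 => z _; rewrite lee_fin mdist_ge0.
apply: le_add_ereal_inf.
- by rewrite adde_ge0// lee_fin; lra.
- move=> _ [k _ <-]; apply: integral_ge0 => z _.
  by rewrite lee_fin mdist_ge0.
move=> _ [k [k1 k2] <-].
set cost := \int[k]_z _.
have [beta [betaE _]] := exists_push k (measurable_snd (T1 := borel Z) (T2 := borel Z)).
have mgk : measurable_fun setT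
    (fun z : borel Z * borel Z => (g z.1 : borel Y1, z.2)).
  apply/measurable_fun_pair => /=; last exact: measurable_snd.
  exact: (measurableT_comp mg measurable_fst).
have [k' [k'E _]] := exists_push k mgk.
have tk : @transportable R _ _ (borel Y1) (borel Z) (fun y z => @mdist R Z (f y) z)
    nu1 beta cost.
  exists k'; split.
  - move=> A mA; rewrite k'E (hnu1 _ mA).
    transitivity (k ((g @^-1` A) `*` setT)).
      by congr (k _); apply/seteqP; split => z [].
    rewrite k1; last by rewrite -[_ @^-1` _]setTI; exact: mg.
    have mrA : measurable (r1 @^-1` A : set (borel T1)).
      by rewrite -[_ @^-1` _]setTI; exact: (ident_measurable id1).
    rewrite -[RHS](probability_fullI mS1 mrA n1S); congr (n1 _).
    have gphi x : S1 x -> g (phi1 x) = r1 x.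
      by move=> Sx; rewrite -{1}(ident_on id1 Sx); exact: fK.
    by apply/seteqP; split => x [Sx] /= Ax; split => //; move: Ax; rewrite /= gphi.
  - move=> A mA; rewrite k'E betaE; congr (k _).
    by apply/seteqP; split => z //= -[].
  - apply: le_trans (integral_push_le mgk (fun A _ => k'E A) _) _.
      by move=> z; rewrite lee_fin mdist_ge0.
    have mD : measurable ((range f : set (borel Z)) `*` [set: borel Z]).
      exact: measurableX.
    have rphi x : S1 x -> range f (phi1 x) by move=> Sx; rewrite rf; exists x.
    apply: (le_integral_full mD).
    + rewrite k1//; transitivity (n1 (S1 `&` setT)).
        congr (n1 _); apply/seteqP; split => x [Sx] _; split => //; exact: rphi.
      by rewrite setIT.
    + by move=> z; rewrite lee_fin mdist_ge0.
    + by move=> z; rewrite lee_fin mdist_ge0.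
    + by move=> z [rz _]; rewrite /= gK.
have mb := measurable_bridge arel sY1.
have b0 y1 y2 : (0 <= bridge rel eta y1 y2)%R by rewrite ltW// (bridge_gt0 arel).
have t21 := transportable_swap mb b0 tM.
have msw : measurable_fun setT (fun z : borel Y2 * borel Y1 => (z.2, z.1)).
  by apply/measurable_fun_pair => /=; [exact: measurable_snd|exact: measurable_fst].
have mb' : measurable_fun setT (fun z : borel Y2 * borel Y1 =>
    (bridge rel eta (z.2 : Y1) (z.1 : Y2))%:E) by exact: (measurableT_comp mb msw).
pose c21 (y2 : borel Y2) (y1 : borel Y1) : R := bridge rel eta (y1 : Y1) (y2 : Y2).
pose d1 (y y' : borel Y1) : R := @mdist R Y1 y y'.
pose d1Z (y : borel Y1) (z : borel Z) : R := @mdist R Z (f y) z.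
pose d2Z (y : borel Y2) (z : borel Z) : R := @mdist R Z' (in2 (i2 y)) (inZ z).
have c210 y2 y1 : (0 <= c21 y2 y1)%R by exact: b0.
have d10 y y' : (0 <= d1 y y')%R by exact: mdist_ge0.
have d1Z0 y z : (0 <= d1Z y z)%R by exact: mdist_ge0.
have d2Z0 y z : (0 <= d2Z y z)%R by exact: mdist_ge0.
have tri1 (y2 : borel Y2) (y y' : Y1) (x : borel Y1) :
    (c21 y2 x <= c21 y2 y + mdist y y' + d1 y' x)%R.
  rewrite /c21 /d1 -addrA addrC; apply: le_trans (bridge_lipl arel _ y y2) _.
  by rewrite lerD2r mdistC; exact: mdist_tri.
have {}t21 := @transportable_trans R _ _ (borel Y2) Y1 (borel Y1) c21 d1 c21
  nu2 nu1' nu1 M w%:E rho sY1 rho0 mb' c210 d10 c210 tri1 t21 tw.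
have tri2 (y2 : borel Y2) (y y' : Y1) (z : borel Z) :
    (d2Z y2 z <= c21 y2 y + mdist y y' + d1Z y' z)%R.
  rewrite /d2Z inZ2; apply: le_trans (bridge_lipl arel' _ (f y) (i2 y2)) _.
  rewrite addrC -addrA; apply: lerD; first exact: brel.
  by rewrite mdistC -isf; exact: mdist_tri.
have [q [q1 q2 qe]] := @transportable_trans R _ _ (borel Y2) Y1 (borel Z) c21 d1Z d2Z
  nu2 nu1 beta _ cost rho sY1 rho0 mb' c210 d1Z0 d2Z0 tri2 t21 tk.
have mi2 : measurable_fun setT ((fun y => in2 (i2 y)) : borel Y2 -> borel Z').
  by apply: measurable_isometry => x y; rewrite in2_iso (ident_isometry id2).
have miZ : measurable_fun setT (inZ : borel Z -> borel Z') by exact: measurable_isometry.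
have mq : measurable_fun setT (fun u : borel Y2 * borel Z =>
    (in2 (i2 u.1) : borel Z', inZ u.2 : borel Z')).
  apply/measurable_fun_pair => /=.
    exact: (measurableT_comp mi2 measurable_fst).
  exact: (measurableT_comp miZ measurable_snd).
have [q' [q'E _]] := exists_push q mq.
apply: (@le_trans _ _ (\int[q']_z (@mdist R Z' z.1 z.2)%:E)).
  apply: ereal_inf_lbound; exists q' => //; split => A mA.
  - rewrite q'E; transitivity (q (((fun y => in2 (i2 y)) @^-1` A) `*` setT)).
      by congr (q _); apply/seteqP; split => z [].
    have mA1 : measurable ((fun y => in2 (i2 y)) @^-1` A : set (borel Y2)).
      by rewrite -[_ @^-1` _]setTI; exact: mi2.
    have mA2 : measurable (in2 @^-1` A : set (borel T2)).
      exact: measurable_isometry_preimage.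
    rewrite q1// hnu2// /push_in.
    have mr2 : measurable (r2 @^-1` ((fun y => in2 (i2 y)) @^-1` A) : set (borel T2)).
      by rewrite -[_ @^-1` _]setTI; exact: (ident_measurable id2).
    rewrite -(probability_fullI mS2 mr2 n2S); congr (n2 _).
    by apply/seteqP; split => x [Sx] /= Ax; split => //; move: Ax;
      rewrite /= (ident_on id2).
  - rewrite q'E; transitivity (q (setT `*` (inZ @^-1` A))).
      by congr (q _); apply/seteqP; split => z //= -[].
    have mA1 : measurable (inZ @^-1` A : set (borel Z)).
      by rewrite -[_ @^-1` _]setTI; exact: miZ.
    rewrite q2// betaE; transitivity (k (setT `*` (inZ @^-1` A))).
      by congr (k _); apply/seteqP; split => z //= -[].
    exact: k2.
apply: le_trans (integral_push_le mq (fun A _ => q'E A) _) _.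
  by move=> z; rewrite lee_fin mdist_ge0.
apply: le_trans qe _; rewrite leeD2r// -addeA -addeA leeD2l//.
by rewrite -!EFinD addrA.
Qed.

End bridge_transport.

(** * Replacing a pair in an F-closeness *)

Section transfer.
Local Open Scope ereal_scope.
Context {R : realType}.

(** The ambient spaces of [P] may be larger than the slices and not separable; the
    comparison takes place on [Y], at the times of [G]. *)
Definition modelled (G : set R) (Y : flow R)
    (m : forall t, borel_probability (ambient Y t) R) (P : flow_pair R) :=
  exists (i : forall t, ambient Y t -> ambient (pflow P) t)
    (r : forall t, ambient (pflow P) t -> ambient Y t),
  [/\ G `<=` ptimes P,
    forall t, G t ->
      [/\ identification (slice (pflow P) t) (i t) (r t),
        complete_set (slice (pflow P) t), separable_space (ambient Y t),
        pmeas P t (slice (pflow P) t) = 1 &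
        forall A, measurable A -> m t A = pmeas P t (r t @^-1` A)] &
    forall s t, G s -> G t -> (s <= t)%R -> forall x : ambient Y t,
      hker (pflow P) (i t x) s (slice (pflow P) s) = 1 /\
      forall A, measurable A -> hker Y x s A = hker (pflow P) (i t x) s (r s @^-1` A)].

Definition equicontinuous_kernels (G : set R) (rho w : R) (Y : flow R) :=
  forall s t, G s -> G t -> (s <= t)%R -> forall x x' : ambient Y t,
  (mdist x x' < rho)%R ->
  @transportable R _ _ (borel (ambient Y s)) (borel (ambient Y s))
    (fun y y' => @mdist R (ambient Y s) y y') (hker Y x s) (hker Y x' s) w%:E.

Lemma wasserstein1_ge0 (Z : pmetricType R) (mu nu : set (borel Z) -> \bar R) :
  0 <= wasserstein1 mu nu.
Proof.
apply: le_ereal_inf_tmp => _ [q _ <-]; apply: integral_ge0 => z _.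
by rewrite lee_fin mdist_ge0.
Qed.

(** The new correspondence is the bridged union, along the relation of the strong
    closeness, of the old one and [P2]. The coupling of [P1] and [P3] is glued to that
    of [P1] and [P2]; as the gluing is approximate, heat kernels at nearby points
    have to be close, with a modulus that is uniform in time. *)
Lemma F_close_transfer (I E' : set R) (P1 P2 P3 : flow_pair R) (Y1 Y2 : flow R)
    (m1 : forall t, borel_probability (ambient Y1 t) R)
    (m2 : forall t, borel_probability (ambient Y2 t) R) (r delta rho : R) :
  measurable E' -> E' `<=` I -> lebesgue_measure E' <= (delta ^+ 2)%:E ->
  (0 < r)%R -> (0 < delta)%R -> (0 < rho)%R ->
  modelled (I `\` E') m1 P1 -> modelled (I `\` E') m2 P2 ->
  strongly_close (I `\` E') delta m1 m2 ->
  equicontinuous_kernels (I `\` E') rho delta Y1 ->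
  (forall t, ptimes P3 t -> measurable (slice (pflow P3) t : set (borel _)) /\
    pmeas P3 t (slice (pflow P3) t) = 1) ->
  F_close I P1 P3 r -> F_close I P2 P3 (r + 4 * delta).
Proof.
move=> mE' E'I lE' r0 d0 rho0.
have h3d : (0 <= delta + delta + delta)%R by lra.
have h4d : (delta + (delta + delta + delta) + r <= r + 4 * delta)%R by lra.
have hsq : (r ^+ 2 + delta ^+ 2 <= (r + 4 * delta) ^+ 2)%R.
  rewrite sqrrD exprMn.
  have p1 : (0 <= r * delta)%R by rewrite mulr_ge0// ltW.
  have p2 : (0 <= delta ^+ 2)%R by rewrite sqr_ge0.
  by rewrite mulrCA; lra.
move=> [i1 [r1 [G1 id1 k1]]] [i2 [r2 [G2 id2 k2]]] sc eq h3.
move=> [C [E [q [[mE EI] Cdom lE qc qI]]]].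
have [rel [eta [Q [arel Qc hM]]]] := sc.
pose G := I `\` (E `|` E').
have GE t : G t -> (I `\` E) t by move=> [It nE]; split => // Et; apply: nE; left.
have GE' t : G t -> (I `\` E') t by move=> [It nE]; split => // Et; apply: nE; right.
pose S1 t := slice (pflow P1) t; pose S2 t := slice (pflow P2) t.
pose S3 t := slice (pflow P3) t.
have exZ t : exists D : {Z : pmetricType R &
    ((ambient (pflow P2) t -> Z) * (ambient (pflow P3) t -> Z))%type}, G t ->
  [/\ isometric_in (S2 t) (projT2 D).1, isometric_in (S3 t) (projT2 D).2 &
    forall (n1 : borel_probability (ambient (pflow P1) t) R)
      (n2 : borel_probability (ambient (pflow P2) t) R)
      (n3 : borel_probability (ambient (pflow P3) t) R)
      (nu1 nu1' : borel_probability (ambient Y1 t) R)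
      (nu2 : borel_probability (ambient Y2 t) R) (M : \bar R) (w rho : R),
    n1 (S1 t) = 1 -> n2 (S2 t) = 1 ->
    (forall A, measurable A -> nu1 A = n1 (r1 t @^-1` A)) ->
    (forall A, measurable A -> nu2 A = n2 (r2 t @^-1` A)) ->
    @transportable R _ _ (borel (ambient Y1 t)) (borel (ambient Y2 t))
      (bridge (rel t) (eta t)) nu1' nu2 M ->
    @transportable R _ _ (borel (ambient Y1 t)) (borel (ambient Y1 t))
      (fun x y => @mdist R (ambient Y1 t) x y) nu1' nu1 w%:E ->
    (0 < rho)%R ->
    wasserstein1 (push_in n2 (S2 t) (projT2 D).1) (push_in n3 (S3 t) (projT2 D).2) <=
      M + (rho + w + rho)%:E +
      wasserstein1 (push_in n1 (S1 t) (@cemb1 _ _ _ _ C t)) (push_in n3 (S3 t) (@cemb2 _ _ _ _ C t))].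
  have [Gt|nGt] := pselect (G t); last first.
    by exists (existT _ (ambient (pflow P2) t) (id, fun=> point)).
  have [id1t c1t s1t _ _] := id1 _ (GE' _ Gt).
  have [id2t c2t _ _ _] := id2 _ (GE' _ Gt).
  have [C1 C2] := Cdom _ (GE _ Gt).
  have [Z' [e2 [e3 [h1 h2 hW]]]] := bridge_wasserstein id1t id2t s1t c1t c2t
    (cemb1_isometric C1) (cemb2_isometric C2) (arel _ (GE' _ Gt)).
  by exists (existT _ Z' (e2, e3)) => _; split.
pose D t := sval (cid (exZ t)); have DP t := svalP (cid (exZ t)).
have sub1 : G `<=` I `&` ptimes P2 by move=> t Gt; split; [case: Gt|exact: G2 (GE' _ Gt)].
have sub2 : G `<=` I `&` ptimes P3.
  by move=> t Gt; have [_ /(@cdom2_sub _ _ _ _ C)] := Cdom _ (GE _ Gt).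
pose C' := @Correspondence R I P2 P3 (fun t => projT1 (D t)) G G
  (fun t => (projT2 (D t)).1) (fun t => (projT2 (D t)).2) sub1 sub2
  (fun t Gt => let: And3 h _ _ := DP t Gt in h)
  (fun t Gt => let: And3 _ h _ := DP t Gt in h).
have exq t : exists q' : probability (borel (ambient (pflow P2) t) *
    borel (ambient (pflow P3) t))%type R, G t ->
    coupling (pmeas P2 t) (pmeas P3 t) q' /\
    forall s, G s -> (s <= t)%R ->
      \int[q']_(x in S2 t `*` S3 t) wasserstein1
         (push_in (hker (pflow P2) x.1 s) (S2 s) (@cemb1 _ _ _ _ C' s))
         (push_in (hker (pflow P3) x.2 s) (S3 s) (@cemb2 _ _ _ _ C' s)) <= (r + 4 * delta)%:E.
  have [Gt|nGt] := pselect (G t); last first.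
    by have [q' _] := exists_prod (pmeas P2 t) (pmeas P3 t); exists q'.
  have [id1t c1t s1t f1t m1t] := id1 _ (GE' _ Gt).
  have [id2t c2t _ f2t m2t] := id2 _ (GE' _ Gt).
  have mS1 := complete_measurable c1t; have mS2 := complete_measurable c2t.
  have [qt1 qt2] := qc _ (GE _ Gt); have [Qt1 Qt2] := Qc _ (GE' _ Gt).
  have [mS3 f3t] := h3 _ (sub2 _ Gt).2.
  pose T1 := borel (ambient (pflow P1) t); pose T2 := borel (ambient (pflow P2) t).
  pose T3 := borel (ambient (pflow P3) t).
  pose V1 := borel (ambient Y1 t); pose V2 := borel (ambient Y2 t).
  have mr1 : measurable_fun setT (fun u : T1 * T3 => (r1 t u.1 : V1, u.2)).
    apply/measurable_fun_pair => /=; last exact: measurable_snd.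
    exact: (measurableT_comp (ident_measurable id1t) measurable_fst).
  have [q1 [q1E _]] := exists_push (q t) mr1.
  have q1P A : measurable A -> q1 (A `*` setT) = m1 t A.
    move=> mA; rewrite q1E m1t//; transitivity (q t ((r1 t @^-1` A) `*` setT)).
      by congr (q t _); apply/seteqP; split => z [].
    by rewrite qt1// -[_ @^-1` _]setTI; exact: (ident_measurable id1t).
  have [q2 [q2a q2b q2I]] := glue_couplings s1t rho0 Qt1 q1P.
  have mi2 : measurable_fun setT (i2 t : V2 -> T2).
    by apply: measurable_isometry; exact: ident_isometry id2t.
  have mi2' : measurable_fun setT (fun u : V2 * T3 => (i2 t u.1 : T2, u.2)).
    apply/measurable_fun_pair => /=; last exact: measurable_snd.
    exact: (measurableT_comp mi2 measurable_fst).
  have [q3 [q3E _]] := exists_push q2 mi2'.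
  exists q3 => _; split; first split => A mA.
  - rewrite q3E; transitivity (q2 ((i2 t @^-1` A) `*` setT)).
      by congr (q2 _); apply/seteqP; split => z [].
    have mA2 : measurable (i2 t @^-1` A : set V2).
      by rewrite -[_ @^-1` _]setTI; exact: mi2.
    have mA3 : measurable (r2 t @^-1` (i2 t @^-1` A) : set T2).
      by rewrite -[_ @^-1` _]setTI; exact: (ident_measurable id2t).
    rewrite q2a// Qt2// m2t// -(probability_fullI mS2 mA3 f2t).
    rewrite -[RHS](probability_fullI mS2 mA f2t); congr (pmeas P2 t _).
    by apply/seteqP; split => x [Sx] /= Ax; split => //; move: Ax;
      rewrite /= (ident_on id2t).
  - rewrite q3E; transitivity (q2 (setT `*` A)).
      by congr (q2 _); apply/seteqP; split => z //= -[].
    rewrite q2b// q1E; transitivity (q t (setT `*` A)).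
      by congr (q t _); apply/seteqP; split => z //= -[].
    exact: qt2.
  move=> s Gs st.
  have [M [M0 mM tM IM]] := hM _ _ (GE' _ Gs) (GE' _ Gt) st.
  set Wf' := (fun x => wasserstein1 _ _).
  pose Wf (x : T1 * T3) := wasserstein1
     (push_in (hker (pflow P1) (x.1 : ambient (pflow P1) t) s) (S1 s) (@cemb1 _ _ _ _ C s))
     (push_in (hker (pflow P3) (x.2 : ambient (pflow P3) t) s) (S3 s) (@cemb2 _ _ _ _ C s)).
  (* Extended by 0 outside the slices, where [F_close] says nothing. *)
  pose W (x : ambient Y1 t) (z : T3) := (Wf \_ (S1 t `*` S3 t)) (i1 t x : T1, z).
  pose W' (y : V2) (z : T3) := (Wf' \_ (S2 t `*` S3 t)) (i2 t y : T2, z).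
  have W0 x z : 0 <= W x z.
    by apply: erestrict_ge0 => u _; exact: wasserstein1_ge0.
  have W'0 y z : 0 <= W' y z.
    by apply: erestrict_ge0 => u _; exact: wasserstein1_ge0.
  have WW (x x' : ambient Y1 t) (y : V2) (z : T3) : (mdist x x' < rho)%R ->
      W' y z <= M x' y + (delta + delta + delta)%:E + W x z.
    move=> xx'; rewrite /W' patchE; case: ifPn => [|_]; last first.
      by rewrite adde_ge0// adde_ge0// lee_fin.
    rewrite inE => -[_ /= S3z].
    have [f1 e1] := k1 _ _ (GE' _ Gs) (GE' _ Gt) st x.
    have [f2 e2] := k2 _ _ (GE' _ Gs) (GE' _ Gt) st (y : ambient Y2 t).
    have -> : W x z = Wf (i1 t x : T1, z).
      rewrite /W patchE mem_set//; split => //=; exact: ident_in id1t _.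
    have [_ _ hW] := DP _ Gs.
    apply: (hW _ _ _ _ _ _ _ _ _ f1 f2 e1 e2 (tM x' y) _ d0).
    apply: eq; [exact: GE'|exact: GE'|exact: st|by rewrite mdistC].
  have IW' := q2I M W W' _ h3d M0 W0 W'0 mM WW.
  rewrite integral_mkcond.
  apply: le_trans (integral_push_le mi2' (fun A _ => q3E A) _) _.
    by move=> u; apply: erestrict_ge0 => v _; exact: wasserstein1_ge0.
  apply: le_trans IW' _.
  have IW : \int[q1]_u W u.1 u.2 <= r%:E.
    apply: le_trans (integral_push_le mr1 (fun A _ => q1E A) _) _.
      by move=> u; exact: W0.
    apply: le_trans (qI s t (GE _ Gs) (GE _ Gt) st); rewrite [leRHS]integral_mkcond.
    have mSS : measurable ((S1 t : set T1) `*` [set: T3]) by exact: measurableX.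
    apply: (le_integral_full mSS).
    + by rewrite qt1.
    + by move=> u; exact: W0.
    + by move=> u; apply: erestrict_ge0 => v _; exact: wasserstein1_ge0.
    + by move=> [u v] [/= Su _]; rewrite /W /= (ident_on id1t).
  apply: le_trans (leeD (leeD2r _ IM) IW) _.
  by rewrite -!EFinD lee_fin.
pose q' t := sval (cid (exq t)); have q'P t := svalP (cid (exq t)).
exists C', (E `|` E'), q'; split.
- by split; [exact: measurableU|move=> t []; [exact: EI|exact: E'I]].
- by move=> t Gt; split.
- apply: le_trans (measureU2 _ _ _) _ => //.
  by apply: le_trans (leeD lE lE') _; rewrite -EFinD lee_fin.
- by move=> t /q'P[].
- by move=> s t Gs Gt st; have [_ h] := q'P _ Gt; exact: h.
Qed.

End transfer.

(** * Tangent flows at infinity *)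

Section equicontinuity.
Local Open Scope ereal_scope.
Context {R : realType}.

Lemma regular_equicontinuous (c : R -> R) (b Theta H T w : R) :
  (0 <= H)%R -> (0 <= T)%R -> (0 < w)%R -> (0 < Theta)%R ->
  exists2 rho : R, (0 < rho)%R & forall (Z : flow R) (tau : R -> R) (G : set R),
    regular_flow b Theta H c Z -> (forall t, G t -> (tau t < b)%R) ->
    (forall s t, G s -> G t -> (s <= t)%R -> (tau s <= tau t)%R /\
      (Theta * (tau t - tau s) <= T)%R) ->
    equicontinuous_kernels G rho w (time_change Z tau).
Proof.
move=> H0 T0 w0 Th0.
have [h [r [K [e [[h0 r0 K0 e0] Hr hw]]]]] := modulus_constants H0 T0 w0.
have L0 : (0 <= 2 * H * T + 1)%R by rewrite addr_ge0// !mulr_ge0.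
set L := (2 * H * T + 1)%R in hw L0.
(* At distances below [e] the modulus is at most [w]. *)
exists e => // Z tau G rZ Gb Gtau s t Gs Gt st x x' xx'.
have [tst stT] := Gtau _ _ Gs Gt st; have tb := Gb _ Gt.
have dirx := evolves_dirac rZ (x : ambient Z (tau t)) tst tb.
have [q [[q1 q2] qI]] := kernel_coupling Th0 H0 rZ (x' : ambient Z (tau t)) tst tb dirx
  h0 r0 K0 Hr stT.
exists q; split => //; apply: le_trans qI _.
rewrite integral_dirac//; last exact: measurable_modulus.
rewrite diracT mul1e lee_fin; apply: le_trans hw; rewrite /modulus -/L.
set d := mdist _ _; have d0 : (0 <= d)%R by exact: mdist_ge0.
have de : (d <= e)%R by exact: ltW.
rewrite -!addrA lerD2l [((1 + _) * e)%R]mulrDl mul1r -addrA lerD//; apply: lerD.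
  rewrite mulrA mulrAC; apply: ler_wpM2l => //.
  by rewrite !divr_ge0 ?sqrtr_ge0// ltW.
rewrite ler_pM2r ?invr_gt0// lerD2r.
by rewrite ler_pXn2r// nnegrE// ltW.
Qed.

End equicontinuity.

Section modelled_pairs.
Context {R : realType}.

(** The limit in [A] also lies in the closed set [B], which the filter contains. *)
Lemma complete_setI (T : pmetricType R) (A B : set T) :
  complete_set A -> closed B -> complete_set (A `&` B).
Proof.
move=> cA cB F FF FAB cF.
have FA : F A by apply: filterS FAB => x [].
have [x Ax Fx] := cA F FF FA cF; exists x => //; split => //.
apply: cB => U Ux; have [y [[_ By] Uy]] := filter_ex (filterI FAB (Fx _ Ux)).
by exists y.
Qed.

(** For [o = t0] this is [rescaled_pair]. The comparison of two base points at different
    times passes through a pair with the base point of the one and the origin of time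
    of the other. *)
Definition pointed_pair (X : flow R) (o : R) t0 (x0 : ambient X t0) (l : {posnum R})
    (T : R) : flow_pair R :=
  support_pair (@FlowPair R (rescale X o l)
    ([set l%:num ^+ 2 * (t - o) | t in `]-oo, 0]] `&` `[- T, 0])
    (fun t => hker X x0 (t / l%:num ^+ 2 + o))).

Context (Phi : R -> R) (hPhi : heat_profile Phi) (X : flow R).
Hypothesis hX : metric_flow Phi `]-oo, 0] X.
Context (t0 : R) (x0 : ambient X t0).
Hypothesis t00 : (t0 <= 0).
Hypothesis Sx0 : slice X t0 x0.

Let time (s : R) : (s <= 0) -> `]-oo, 0]%classic s.
Proof. by move=> s0; rewrite /= in_itv. Qed.

Lemma modelled_pointed_pair (o T b t1 : R) (z : ambient X t1) (l : {posnum R}) (G : set R) :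
  (o <= 0) -> (b <= t0) -> (b <= t1) -> (t1 <= 0) -> slice X t1 z ->
  G `<=` `[- T, 0] -> (forall t, G t -> (scaled_time (l%:num ^+ 2) o t < b)) ->
  modelled (Y := time_change (scale_flow l (model x0)) (scaled_time (l%:num ^+ 2) o)) G
    (fun t => seen x0 z (scaled_time (l%:num ^+ 2) o t)) (pointed_pair o z l T).
Proof.
move=> o0 bt0 bt1 t10 Sz GT Gb.
pose tau := scaled_time (l%:num ^+ 2) o.
have tau0 t : G t -> (tau t < t0) by move=> /Gb h; exact: lt_le_trans bt0.
have tau1 t : G t -> (tau t < t1) by move=> /Gb h; exact: lt_le_trans bt1.
have taule t : G t -> (tau t <= 0).
  by move=> /tau0 h; exact: le_trans (ltW h) t00.
have vis t : G t -> visible z (tau t) = visible x0 (tau t).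
  by move=> Gt; exact: (visible_base hPhi hX t00 Sx0 t10 Sz (tau0 _ Gt) (tau1 _ Gt)).
exists (fun t => sval), (fun t => retract (visible x0 (tau t))); split.
- move=> t Gt; have tT := GT _ Gt; split => //; exists (tau t); first exact/time/taule.
  rewrite /tau /scaled_time addrK mulrC divfK//.
- move=> t Gt.
  have sE : slice (pflow (pointed_pair o z l T)) t = visible x0 (tau t).
    by rewrite -(vis _ Gt).
  have mV := visible_measurable hX x0 (taule _ Gt).
  split.
  + split.
    * by [].

    * exact: measurable_retract mV.
    * by move=> x; rewrite sE; exact: (sval_in x (visible_nonempty hPhi hX t00 Sx0 (tau0 _ Gt))).
    * exact: svalK.
    * move=> x; rewrite sE => Vx.
      exact: (@retractK R (ambient X (tau t)) (visible x0 (tau t)) x Vx).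
  + have cS : complete_set (slice X (tau t)) by case: hX => h _ _ _ _; case: (h _ (time (taule _ Gt))).
    exact: (complete_setI cS (@closed_supp _ _ (hker X z (tau t)))).
  + by apply: separable_scaled; exact: (visible_separable hPhi hX t00 Sx0 (tau0 _ Gt)).
  + have f1 := visible_full hPhi hX t10 Sz (tau1 _ Gt) (tau1 _ Gt) t10 Sz.
    exact: f1.
  + move=> A mA; exact: (seenE hX t00 _ _ (tau0 _ Gt)).
- move=> s t Gs Gt st x.
  have ss : tau s <= tau t by rewrite /tau /scaled_time lerD2r ler_pM2r// invr_gt0.
  split.
    have f1 := model_full hPhi hX t00 Sx0 x ss (tau0 _ Gt).
    by move: f1; rewrite -(vis _ Gs).
  move=> A mA; exact: (seenE hX t00 _ _ (tau0 _ Gs)).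
Qed.

End modelled_pairs.

Section finite_variance.
Local Open Scope ereal_scope.
Context {R : realType}.

Lemma mutual_variance_ge0 (T : pmetricType R) (P Q : borel_probability T R) :
  0 <= mutual_variance P Q.
Proof.
by apply: integral_ge0 => x _; apply: integral_ge0 => y _; rewrite lee_fin sqr_ge0.
Qed.

(** Both measures have a finite second moment about some point, [p] and [p']. *)
Lemma mutual_variance_fin (T : pmetricType R) (P Q : borel_probability T R) :
  separable_space T -> mutual_variance P P < +oo -> mutual_variance Q Q < +oo ->
  mutual_variance P Q < +oo.
Proof.
move=> sT VP VQ.
have d0 (x y : T) : 0 <= ((mdist x y) ^+ 2)%:E by rewrite lee_fin sqr_ge0.
have m2 p : measurable_fun setT (fun x : borel T => ((@mdist R T p x) ^+ 2)%:E).
  rewrite (_ : (fun x => _) = (fun x : borel T => ((@mdist R T x p) ^+ 2)%:E)).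
    exact: measurable_mdist2l.
  by apply/funext => x; rewrite mdistC.
have ex (P' : borel_probability T R) : mutual_variance P' P' < +oo ->
    exists p : T, \int[P']_x ((@mdist R T p x) ^+ 2)%:E < +oo.
  move=> V; apply: (exists_le_integral (P := P')) => // p.
  by apply: integral_ge0 => x _; exact: d0.
have [p hp] := ex _ VP; have [p' hp'] := ex _ VQ.
pose k : R := (mdist p p' ^+ 2)%R.
have le3 (x y : T) : ((mdist x y) ^+ 2)%:E <= 3%:E * ((mdist p x) ^+ 2)%:E +
    (3%:E * k%:E + 3%:E * ((mdist p' y) ^+ 2)%:E).
  rewrite /k -!EFinM -!EFinD lee_fin.
  have h : (mdist x y <= mdist p x + mdist p p' + mdist p' y)%R.
    apply: le_trans (mdist_tri p' _ _) _; rewrite lerD2r.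
    by rewrite (mdistC p x); exact: mdist_tri.
  move: (mdist_ge0 x y) (mdist_ge0 p x) (mdist_ge0 p p') (mdist_ge0 p' y) h.
  set a := mdist x y; set b := mdist p x; set c := mdist p p'; set d := mdist p' y.
  move=> a0 b0 c0 d0'.
  rewrite -(ler_pXn2r (n := 2))// ?nnegrE ?addr_ge0// => h.
  apply: le_trans h _; have := sqr_ge0 (b - c); have := sqr_ge0 (b - d).
  have := sqr_ge0 (c - d); clear; rewrite !expr2; lra.
have i0 (P' : borel_probability T R) p1 : 0 <= \int[P']_x ((@mdist R T p1 x) ^+ 2)%:E.
  by apply: integral_ge0 => x _; exact: d0.
have c30 : (0 <= 3 :> R)%R by [].
have k0 : 0 <= 3%:E * k%:E by rewrite -EFinM lee_fin mulr_ge0// sqr_ge0.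
apply: (@le_lt_trans _ _ (3%:E * \int[P]_x ((@mdist R T p x) ^+ 2)%:E +
   (3%:E * k%:E + 3%:E * \int[Q]_y ((@mdist R T p' y) ^+ 2)%:E))); last first.
  apply: lte_add_pinfty; first by apply: lte_mul_pinfty.
  by apply: lte_add_pinfty; [rewrite -EFinM ltry|apply: lte_mul_pinfty].
have [q [q1 q2 qE]] := exists_prod P Q.
have mf1 p1 : measurable_fun setT (fun x : borel T => 3%:E * ((@mdist R T p1 x) ^+ 2)%:E).
  exact: measurable_funeM.
have f10 p1 (x : borel T) : 0 <= 3%:E * ((@mdist R T p1 x) ^+ 2)%:E by rewrite mule_ge0.
apply: (@le_trans _ _ (\int[P]_x (3%:E * ((@mdist R T p x) ^+ 2)%:E +
    \int[Q]_y (3%:E * k%:E + 3%:E * ((@mdist R T p' y) ^+ 2)%:E)))).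
  apply: le_integral_ge0 => x; first by apply: integral_ge0 => y _; exact: d0.
  pose f y : \bar R := 3%:E * k%:E + 3%:E * ((@mdist R T p' y) ^+ 2)%:E.
  have mf : measurable_fun setT (f : borel T -> \bar R) by exact: emeasurable_funD.
  have f0 y : 0 <= f y by rewrite adde_ge0.
  rewrite -[X in X + _](integral_cstT Q).
  rewrite -(integralDT Q (measurable_cst _) (fun _ => f10 p x) mf f0).
  by apply: le_integral_ge0 => y; [exact: d0|exact: le3].
have I0 : 0 <= \int[Q]_y (3%:E * k%:E + 3%:E * ((@mdist R T p' y) ^+ 2)%:E).
  by apply: integral_ge0 => y _; rewrite adde_ge0.
rewrite (integralDT P (mf1 p) (f10 p) (measurable_cst _) (fun _ => I0)).
rewrite integral_cstT (integralZT P c30 (m2 p) (d0 p)) leeD2l//.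
rewrite (integralDT Q (measurable_cst _) (fun _ => k0) (mf1 p') (f10 p')).
by rewrite integral_cstT (integralZT Q c30 (m2 p') (d0 p')).
Qed.

End finite_variance.

Section interchange.
Context {R : realType}.

(** A symmetric condition under which the pairs may replace each other in an
    [F]-closeness, up to [4 * delta]. *)
Definition interchangeable (I : set R) (delta : R) (P1 P2 : flow_pair R) :=
  exists (E : set R) (Y1 Y2 : flow R)
    (m1 : forall t, borel_probability (ambient Y1 t) R)
    (m2 : forall t, borel_probability (ambient Y2 t) R) (rho : R),
  [/\ measurable E, E `<=` I, (lebesgue_measure E <= (delta ^+ 2)%:E)%E, 0 < rho &
    [/\ modelled (I `\` E) m1 P1, modelled (I `\` E) m2 P2,
      strongly_close (I `\` E) delta m1 m2,
      equicontinuous_kernels (I `\` E) rho delta Y1 &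
      equicontinuous_kernels (I `\` E) rho delta Y2]].

Lemma interchangeable_sym I delta P1 P2 :
  interchangeable I delta P1 P2 -> interchangeable I delta P2 P1.
Proof.
move=> [E [Y1 [Y2 [m1 [m2 [rho [mE EI lE r0 [M1 M2 sc e1 e2]]]]]]]].
exists E, Y2, Y1, m2, m1, rho; split => //; split => //.
apply: strongly_close_sym sc => t Gt; have [i [r [_ h _]]] := M1.
by have [] := h _ Gt.
Qed.

Lemma F_dist_ge0 I (P1 P3 : flow_pair R) : (0 <= F_dist I P1 P3)%E.
Proof. by apply: le_ereal_inf_tmp => _ [r [r0 _] <-]; rewrite lee_fin ltW. Qed.

(** [F_close_transfer] with errors tending to 0. *)
Lemma F_dist_interchange I (P1 P2 : nat -> flow_pair R) (P3 : flow_pair R) :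
  (forall t, ptimes P3 t -> measurable (slice (pflow P3) t : set (borel _)) /\
    pmeas P3 t (slice (pflow P3) t) = 1%E) ->
  (forall delta, 0 < delta -> \forall j \near \oo, interchangeable I delta (P1 j) (P2 j)) ->
  F_dist I (P1 j) P3 @[j --> \oo] --> 0%E -> F_dist I (P2 j) P3 @[j --> \oo] --> 0%E.
Proof.
move=> h3 hI h1 A [e /= e0 eA].
have e50 : 0 < e / 10 by rewrite divr_gt0.
have hB : \forall j \near \oo, (F_dist I (P1 j) P3 < (e / 10)%:E)%E.
  apply: (h1 [set x | (x < (e / 10)%:E)%E]); exists (e / 10) => //= r.
  by rewrite /= sub0r normrN lte_fin => /(le_lt_trans (ler_norm r)).
apply: filterS2 (hI _ e50) hB => j.
move=> [E [Y1 [Y2 [m1 [m2 [rho [mE EI lE r0 [M1 M2 sc e1 e2]]]]]]]] /ereal_inf_lt.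
move=> [_ [r [r0' Fr] <-]]; rewrite lte_fin => re.
have F2 := F_close_transfer mE EI lE r0' e50 r0 M1 M2 sc e1 h3 Fr.
change (A (F_dist I (P2 j) P3)).
have := F_dist_ge0 I (P2 j) P3.
have : (F_dist I (P2 j) P3 <= (r + 4 * (e / 10))%:E)%E.
  by apply: ereal_inf_lbound; exists (r + 4 * (e / 10)) => //; split => //; lra.
case: (F_dist I (P2 j) P3) => [x| |]; rewrite ?leNye// ?leye_eq// !lee_fin => xle x0.
apply: eA; rewrite /= sub0r normrN ger0_norm//; lra.
Qed.

Lemma isometric_pairs_refl Phi I (P : flow_pair R) :
  metric_flow_pair Phi I P -> isometric_pairs P P.
Proof.
move=> [_ _ [hS hK _ _ _] [hm _] _].
have mS t : ptimes P t -> measurable (slice (pflow P) t : set (borel (ambient (pflow P) t))).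
  by move=> Pt; apply: complete_measurable; case: (hS _ Pt).
exists set0, (fun t x => x); split.
- exact: negligible_set0.
- by [].
- move=> t _; split; last by [].
  by split; [move=> x Sx|move=> x y _ _|move=> x Sx; exists x].
- move=> s t [Ps _] [Pt _] st x Sx A mA.
  by rewrite /push_in [RHS](probability_fullI (mS _ Ps) mA (hK _ _ _ Ps Pt st Sx)).
- move=> t [Pt _] A mA.
  by rewrite /push_in [RHS](probability_fullI (mS _ Pt) mA (hm _ Pt)).
Qed.

End interchange.

Section base_points.
Context {R : realType} (Phi : R -> R) (hPhi : heat_profile Phi) (H : R) (X : flow R).
Hypothesis hX : metric_flow Phi `]-oo, 0] X.
Hypothesis hH : concentrated H `]-oo, 0] X.
Context (t0 s0 : R) (x0 : ambient X t0) (y0 : ambient X s0).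
Hypotheses (t00 : t0 <= 0) (s00 : s0 <= 0).
Hypotheses (Sx0 : slice X t0 x0) (Sy0 : slice X s0 y0).

Let b := Num.min t0 s0.
Let bt0 : b <= t0. Proof. by rewrite ge_min lexx. Qed.
Let bs0 : b <= s0. Proof. by rewrite ge_min lexx orbT. Qed.
Let lt0 u : u < b -> u < t0. Proof. by move=> ub; exact: lt_le_trans bt0. Qed.
Let ls0 u : u < b -> u < s0. Proof. by move=> ub; exact: lt_le_trans bs0. Qed.
Let H0 : 0 <= H. Proof. exact: (concentration_ge0 hH t00 Sx0). Qed.

Lemma evolves_seen (l : {posnum R}) t1 (z : ambient X t1) s u : b <= t1 -> t1 <= 0 ->
  slice X t1 z -> s <= u -> u < b ->
  evolves (Z := scale_flow l (model x0)) (seen x0 z u) (seen x0 z s).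
Proof.
move=> bt1 t10 Sz su ub A mA; have ut1 := lt_le_trans ub bt1.
apply: (seen_evolves hPhi hX t00 Sx0 su (lt0 ub) (ltW ut1) t10 Sz _ mA).
exact: (visible_full hPhi hX t00 Sx0 ut1 (lt0 ub) t10 Sz).
Qed.

Lemma seen_variance_bound b1 : b1 < b -> exists2 C0, 0 < C0 & forall l : {posnum R},
  let V (P Q : borel_probability (subspace_of (visible x0 b1)) R) :=
    @mutual_variance R (scaled l (subspace_of (visible x0 b1))) P Q in
  [/\ (V (seen x0 x0 b1) (seen x0 y0 b1) <= (l%:num ^+ 2 * C0 ^+ 2)%:E)%E,
      (V (seen x0 y0 b1) (seen x0 x0 b1) <= (l%:num ^+ 2 * C0 ^+ 2)%:E)%E &
      (V (seen x0 y0 b1) (seen x0 y0 b1) <= (l%:num ^+ 2 * C0 ^+ 2)%:E)%E].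
Proof.
move=> b1b; have sT := visible_separable hPhi hX t00 Sx0 (lt0 b1b).
have fx := visible_full hPhi hX t00 Sx0 (lt0 b1b) (lt0 b1b) t00 Sx0.
have fy := visible_full hPhi hX t00 Sx0 (ls0 b1b) (lt0 b1b) s00 Sy0.
have vx : (mutual_variance (seen x0 x0 b1) (seen x0 x0 b1) < +oo)%E.
  apply: le_lt_trans (seen_variance hPhi hX hH t00 Sx0 (lt0 b1b) (ltW (lt0 b1b))
    t00 Sx0 Sx0 fx fx) _; exact: ltry.
have vy : (mutual_variance (seen x0 y0 b1) (seen x0 y0 b1) < +oo)%E.
  apply: le_lt_trans (seen_variance hPhi hX hH t00 Sx0 (lt0 b1b) (ltW (ls0 b1b))
    s00 Sy0 Sy0 fy fy) _; exact: ltry.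
have vxy := mutual_variance_fin sT vx vy; have vyx := mutual_variance_fin sT vy vx.
have fin (P Q : borel_probability (subspace_of (visible x0 b1)) R) :
    (mutual_variance P Q < +oo)%E -> exists2 v : R, 0 <= v & mutual_variance P Q = v%:E.
  move=> V; exists (fine (mutual_variance P Q)).
    by rewrite fine_ge0// mutual_variance_ge0.
  by rewrite fineK// ge0_fin_numE// mutual_variance_ge0.
have [v1 v10 E1] := fin _ _ vxy; have [v2 v20 E2] := fin _ _ vyx.
have [v3 v30 E3] := fin _ _ vy.
have C0 : 0 < v1 + v2 + v3 + 1 by lra.
exists (Num.sqrt (v1 + v2 + v3 + 1)); first by rewrite sqrtr_gt0.
move=> l; rewrite /= sqr_sqrtr ?(ltW C0)//.
have l20 : 0 < l%:num ^+ 2 by rewrite exprn_gt0.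
by rewrite !mutual_variance_scaled// E1 E2 E3 -!EFinM !lee_fin !ler_pM2l//; split; lra.
Qed.

Let scaled_time_mono (l : {posnum R}) o (T : R) (G : set R) : G `<=` `[- T, 0] ->
  forall s t, G s -> G t -> s <= t ->
  scaled_time (l%:num ^+ 2) o s <= scaled_time (l%:num ^+ 2) o t /\
  l%:num ^+ 2 * (scaled_time (l%:num ^+ 2) o t - scaled_time (l%:num ^+ 2) o s) <= T.
Proof.
move=> GT s t /GT + /GT; rewrite /= !in_itv /= => /andP[s1 s2] /andP[t1 t2] st; split.
  by rewrite /scaled_time lerD2r ler_pM2r// invr_gt0.
by rewrite scaled_time_diff// subrr mulr0 addr0; lra.
Qed.

(** At the fixed time [b - 1] the variances are finite, hence of order [Theta] after
    scaling. *)
Lemma base_point_interchangeable (o T delta : R) : o <= 0 -> 0 <= T -> 0 < delta ->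
  \forall Th \near (0 : R)^'+, forall l : {posnum R}, l%:num ^+ 2 = Th ->
    interchangeable `[- T, 0] delta (pointed_pair o x0 l T) (pointed_pair o y0 l T).
Proof.
move=> o0 T0 d0; have b1b : b - 1 < b by lra.
have [C0 C00 hV] := seen_variance_bound b1b.
have [c [c0 cP]] := profile_harnack hPhi.
apply: filterS (base_change_asymptotic c o H0 b1b C00 T0 d0) => Th h l lTh.
rewrite -{}lTh in h; have [V1 V2 V3] := hV l.
have rM := regular_scale_flow l (model_regular hPhi hX hH t00 Sx0 bt0 c0 cP).
have [E [mE EI lE Eb sc]] := h _ rM (fun u => seen x0 x0 u) (fun u => seen x0 y0 u)
  (fun s u su ub => @evolves_seen l _ x0 s u bt0 t00 Sx0 su ub)
  (fun s u su ub => @evolves_seen l _ y0 s u bs0 s00 Sy0 su ub) V1 V2 V3.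
have l20 : 0 < l%:num ^+ 2 by rewrite exprn_gt0.
have GT : `[- T, 0] `\` E `<=` `[- T, 0] by move=> t [].
have [rho rho0 heq] := regular_equicontinuous c b H0 T0 d0 l20.
have eq := heq _ _ _ rM Eb (fun s t => @scaled_time_mono l _ T _ GT s t).
pose Y o := time_change (scale_flow l (model x0)) (scaled_time (l%:num ^+ 2) o).
exists E, (Y o), (Y o), (fun t => seen x0 x0 (scaled_time (l%:num ^+ 2) o t)),
  (fun t => seen x0 y0 (scaled_time (l%:num ^+ 2) o t)), rho; split => //; split => //.
- exact: (modelled_pointed_pair hPhi hX t00 Sx0 o0 bt0 bt0 t00 Sx0 GT Eb).
- exact: (modelled_pointed_pair hPhi hX t00 Sx0 o0 bt0 bs0 s00 Sy0 GT Eb).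
Qed.

Lemma origin_interchangeable (o1 o2 T delta : R) : o1 <= 0 -> o2 <= o1 ->
  0 <= T -> 0 < delta ->
  \forall Th \near (0 : R)^'+, forall l : {posnum R}, l%:num ^+ 2 = Th ->
    interchangeable `[- T, 0] delta (pointed_pair o1 y0 l T) (pointed_pair o2 y0 l T).
Proof.
move=> o0 o21 T0 d0; have b1b : b - 1 < b by lra.
have [C0 C00 hV] := seen_variance_bound b1b.
have [c [c0 cP]] := profile_harnack hPhi.
have c0' K : 0 < c K by case/andP: (c0 K).
apply: filterS (shift_asymptotic H0 b1b c0' C00 T0 d0 o21) => Th h l lTh.
rewrite -{}lTh in h; have [_ _ V3] := hV l.
have rM := regular_scale_flow l (model_regular hPhi hX hH t00 Sx0 bt0 c0 cP).
have [E [mE EI lE Eb sc]] := h _ rM (fun u => seen x0 y0 u)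
  (fun s u su ub => @evolves_seen l _ y0 s u bs0 s00 Sy0 su ub) V3.
have l20 : 0 < l%:num ^+ 2 by rewrite exprn_gt0.
have GT : `[- T, 0] `\` E `<=` `[- T, 0] by move=> t [].
have Eb2 t : (`[- T, 0] `\` E) t -> scaled_time (l%:num ^+ 2) o2 t < b.
  by move=> /Eb; apply: le_lt_trans; rewrite /scaled_time lerD2l.
have [rho rho0 heq] := regular_equicontinuous c b H0 T0 d0 l20.
pose Y o := time_change (scale_flow l (model x0)) (scaled_time (l%:num ^+ 2) o).
exists E, (Y o1), (Y o2), (fun t => seen x0 y0 (scaled_time (l%:num ^+ 2) o1 t)),
  (fun t => seen x0 y0 (scaled_time (l%:num ^+ 2) o2 t)), rho; split => //; split => //.
- exact: (modelled_pointed_pair hPhi hX t00 Sx0 o0 bt0 bs0 s00 Sy0 GT Eb).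
- exact: (modelled_pointed_pair hPhi hX t00 Sx0 (le_trans o21 o0) bt0 bs0 s00 Sy0 GT Eb2).
- exact: (heq _ _ _ rM Eb (fun s t => @scaled_time_mono l _ T _ GT s t)).
- exact: (heq _ _ _ rM Eb2 (fun s t => @scaled_time_mono l _ T _ GT s t)).
Qed.

(** First the base point is changed, then the origin of time. *)
Lemma tangent_flow_base_point (P : flow_pair R) :
  tangent_flows_at_infinity Phi `]-oo, 0] x0 P ->
  tangent_flows_at_infinity Phi `]-oo, 0] y0 P.
Proof.
move=> [hP [hmax [l [ldec l0 hl]]]]; split => //; split => //.
exists l; split => // T T0.
have near0 (Q : R -> Prop) : (\forall Th \near (0 : R)^'+, Q Th) ->
    \forall j \near \oo, Q ((l j)%:num ^+ 2).
  move=> [e /= e0 eQ].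
  have e1 : 0 < Num.min 1 e by rewrite lt_min ltr01.
  have hj : \forall j \near \oo, (l j)%:num < Num.min 1 e := cvgr_lt _ l0 _ e1.
  have hQ j : (l j)%:num < Num.min 1 e -> Q ((l j)%:num ^+ 2).
    rewrite lt_min => /andP[lj1 lje].
    apply: eQ; last by rewrite exprn_gt0.
    rewrite /= sub0r normrN ger0_norm ?sqr_ge0// expr2.
    by apply: le_lt_trans lje; rewrite -[leRHS]mul1r ler_pM2r// ltW.
  exact: filterS hQ (hj _).
pose I : set R := `[- T, 0]%classic.
have h3 t : ptimes (restrict_pair P I) t ->
    measurable (slice (pflow (restrict_pair P I)) t : set (borel _)) /\
    pmeas (restrict_pair P I) t (slice (pflow (restrict_pair P I)) t) = 1%E.
  move=> [Pt _]; case: hP => _ _ [hS _ _ _ _] [hm _] _; split; last exact: hm.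
  by apply: complete_measurable; case: (hS _ Pt).
have step1 : F_dist I (pointed_pair t0 y0 (l j) T) (restrict_pair P I)
    @[j --> \oo] --> 0%E.
  apply: (F_dist_interchange h3 _ (hl T T0)) => delta d0.
  have := near0 _ (base_point_interchangeable t00 (ltW T0) d0).
  by apply: filterS => j; apply.
apply: (F_dist_interchange h3 _ step1) => delta d0.
have [st|ts] := leP s0 t0.
  have := near0 _ (origin_interchangeable t00 st (ltW T0) d0).
  by apply: filterS => j; apply.
have := near0 _ (origin_interchangeable s00 (ltW ts) (ltW T0) d0).
by apply: filterS => j /(_ (l j) erefl); exact: interchangeable_sym.
Qed.

End base_points.

Theorem theorem1p5 (R : realType) (Phi : R -> R) (hPhi : heat_profile Phi)
    (H : R) (X : flow R)
    (hX : metric_flow Phi `]-oo, 0] X)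
    (hH : concentrated H `]-oo, 0] X)
    (t0 s0 : R) (ht0 : t0 <= 0) (hs0 : s0 <= 0)
    (x0 : ambient X t0) (y0 : ambient X s0)
    (hx0 : slice X t0 x0) (hy0 : slice X s0 y0) :
  same_up_to_isometry
    (tangent_flows_at_infinity Phi `]-oo, 0] x0)
    (tangent_flows_at_infinity Phi `]-oo, 0] y0).
Proof.
split=> P hP; exists P.
- exact: (tangent_flow_base_point hPhi hX hH ht0 hs0 hx0 hy0 hP).
- by case: hP => h _; exact: isometric_pairs_refl h.
- exact: (tangent_flow_base_point hPhi hX hH hs0 ht0 hy0 hx0 hP).
- by case: hP => h _; exact: isometric_pairs_refl h.
Qed.
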